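(* There exists a polynomial-time algorithm that, given a Cameron graph $G$, computes the Grundy number $\Gamma(G)$ of $G$.
   Context: All graphs are finite and simple. A proper coloring of a graph $G$ is a partition of $V(G)$ into independent sets (color classes). A proper coloring with color classes $C_1,\dots,C_k$ is a first-fit coloring if for every $j$, each vertex of $C_j$ has at least one neighbor in every color class $C_i$ with $i<j$. The Grundy number $\Gamma(G)$ is the maximum number $k$ of color classes in a first-fit coloring of $G$. A cograph is a graph with no induced path on four vertices ($P_4$). For $S\subseteq V(G)$, the Seidel switch of $G$ with respect to $S$ is the graph on $V(G)$ obtained from $G$ by complementing adjacency (replacing edges by non-edges and non-edges by edges) for exactly those pairs of vertices with one vertex in $S$ and the other in $V(G)\setminus S$, leaving all other pairs unchanged. A graph is a Cameron graph if it can be obtained from a cograph by a Seidel switch with respect to some vertex subset. *)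

(* Defs.v *)
From mathcomp Require Import all_boot.
Set Implicit Arguments. Unset Strict Implicit. Unset Printing Implicit Defensive.

Definition simple_graph (T : finType) (e : rel T) : Prop :=
  symmetric e /\ irreflexive e.

Definition first_fit (T : finType) (e : rel T) (k : nat) (c : {ffun T -> 'I_k}) : bool :=
  [&& [forall i : 'I_k, exists x : T, c x == i],
      [forall x : T, forall y : T, e x y ==> (c x != c y)] &
      [forall x : T, forall i : 'I_k, (i < c x) ==> [exists y : T, e x y && (c y == i)]]].

(* Grundy number: the maximum number of classes of a first-fit coloring
   (a first-fit coloring has at most #|T| nonempty classes). *)
Definition grundy (T : finType) (e : rel T) : nat :=
  \max_(k < #|T|.+1 | [exists c : {ffun T -> 'I_k}, first_fit e c]) k.

Definition cograph (T : finType) (e : rel T) : bool :=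
  [forall a : T, forall b : T, forall c : T, forall d : T,
     ~~ [&& uniq [:: a; b; c; d],
            e a b, e b c, e c d,
            ~~ e a c, ~~ e b d & ~~ e a d]].

Definition seidel_switch (T : finType) (e : rel T) (S : {set T}) : rel T :=
  fun x y => if (x \in S) != (y \in S) then ~~ e x y else e x y.

Definition cameron (T : finType) (e : rel T) : Prop :=
  exists S : {set T}, cograph (seidel_switch e S).

Inductive dir := DL | DR | DS.

Record TM := {
  St : finType;
  Sy : finType;
  blank : Sy;
  sym0 : Sy;
  sym1 : Sy;
  start : St;
  delta : St -> Sy -> option (St * Sy * dir)  (* None = halt *)
}.

(* A tape: (cells to the left, nearest first; scanned cell; cells to the right).
   All other cells are blank. *)
Definition tape (M : TM) := (seq (Sy M) * Sy M * seq (Sy M))%type.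
Definition config (M : TM) := (St M * tape M)%type.

Definition move (M : TM) (d : dir) (t : tape M) : tape M :=
  let: (l, a, r) := t in
  match d with
  | DS => (l, a, r)
  | DL => match l with [::] => ([::], blank M, a :: r) | x :: l' => (l', x, a :: r) end
  | DR => match r with [::] => (a :: l, blank M, [::]) | x :: r' => (a :: l, x, r') end
  end.

Definition step (M : TM) (cf : config M) : option (config M) :=
  let: (q, (l, a, r)) := cf in
  match delta q a with
  | None => None
  | Some (q', a', d) => Some (q', move d (l, a', r))
  end.

(* exec M t cf = Some cf' iff M, started in cf, halts in configuration cf'
   after fewer than t steps. *)
Fixpoint exec (M : TM) (t : nat) (cf : config M) : option (config M) :=
  match t with
  | 0 => None
  | t'.+1 => match step cf with None => Some cf | Some cf' => exec t' cf' end
  end.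

Definition init (M : TM) (w : seq (Sy M)) : config M :=
  match w with
  | [::] => (start M, ([::], blank M, [::]))
  | x :: w' => (start M, ([::], x, w'))
  end.

(* Output (in unary): number of consecutive sym1 cells starting at the head. *)
Definition output (M : TM) (cf : config M) : nat :=
  let: (_, (_, a, r)) := cf in find (fun s => s != sym1 M) (a :: r).

Definition encode (M : TM) (n : nat) (e : rel 'I_n) : seq (Sy M) :=
  [seq (if e i j then sym1 M else sym0 M) | i <- enum 'I_n, j <- enum 'I_n].
Arguments encode M n e : clear implicits.

Definition computes_within (M : TM) (p : nat -> nat)
  (P : forall n, rel 'I_n -> Prop) (f : forall n, rel 'I_n -> nat) : Prop :=
  forall n (e : rel 'I_n), P n e ->
    exists cf, exec (p (size (encode M n e))) (init (encode M n e)) = Some cf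
               /\ output cf = f n e.

Definition well_formed_TM (M : TM) : bool :=
  [&& sym0 M != blank M, sym1 M != blank M & sym0 M != sym1 M].

(* Main.v *)
Require Import Defs.
From mathcomp Require Import all_boot.
From mathcomp Require Import zify.
Set Implicit Arguments. Unset Strict Implicit. Unset Printing Implicit Defensive.

(* Fix the vertex [v] of largest colour in a first-fit colouring of the Cameron graph
   [e], and let [S] be its neighbourhood.  Switching at [S] isolates [v] and gives a
   cograph [H], which shrinks to a point by merging twins.  For a module [M] of [H] count
   the colours that occur in [M] only on [S] ([p]), only off [S] ([q]), or on both sides
   ([r]).  If [M] is a disjoint union in [H], colours of the last kind add up, and the
   vertex of largest colour on a side forces all one-sided colours of that side into
   its own part; if [M] is a join, a class that is one-sided in both parts, on opposite
   sides, becomes two-sided.  Conversely every triple [(p, q, r)] produced by these rules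
   comes from classes with one vertex on each side, or a single one: a vertex outside of a
   module is adjacent to exactly one of two vertices of the module on opposite sides.
   Hence the Grundy number is the maximum of [p + r + 1] over the tables of the root,
   and the tables have polynomial size.

   The tables satisfy a recursion given by a formula of bounded arithmetic.  Such
   formulas are evaluated by nested loops of a counter machine with a bit memory, whose
   registers become marks on the tape of a Turing machine; as a register grows by
   at most one per instruction, the simulation is polynomial. *)

(** Adjacency in [e] agrees with [H] inside a side of [S] and is complementary to it across the
    sides. Seen from outside of a module, its vertices on one side therefore look alike, so
    one-sided classes are interchangeable and only their number matters. A two-sided class has a
    neighbour of every outside vertex: no outside vertex can join it, and every outside class may be
    placed after it. This is why three numbers describe a module. The vertex [v] has the largest
    colour so that it sees every smaller colour: all these colours occur on [S], and [v] adds its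
    own. As [S] is the neighbourhood of one vertex, trying every [v] replaces the search for the
    unknown switching set. Any list of independent classes in which each vertex of a later class
    sees every earlier class extends to a first-fit colouring with at least as many colours, so the
    vertices that are left over can be forgotten. *)

(** * Counter machines with a bit memory *)

Definition store := ((nat -> nat) * (nat -> option bool))%type.

Definition upd (A : Type) (f : nat -> A) (x : nat) (a : A) : nat -> A :=
  fun y => if y == x then a else f y.

Lemma updE A (f : nat -> A) x a : upd f x a x = a.
Proof. by rewrite /upd eqxx. Qed.

Inductive cond := CEq (x y : nat) | CMem (x : nat) (s : option bool).

Definition test (b : cond) (s : store) : bool :=
  match b with
  | CEq x y => s.1 x == s.1 y
  | CMem x a => s.2 (s.1 x) == a
  end.

Inductive instr :=
  | IInc (x : nat)
  | ICopy (x y : nat)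
  | IWrite (x : nat) (a : bool)
  | IJump (b : cond) (l : nat).

Definition effect (i : instr) (pc : nat) (s : store) : nat * store :=
  match i with
  | IInc x => (pc.+1, (upd s.1 x (s.1 x).+1, s.2))
  | ICopy x y => (pc.+1, (upd s.1 x (s.1 y), s.2))
  | IWrite x a => (pc.+1, (s.1, upd s.2 (s.1 x) (Some a)))
  | IJump b l => (if test b s then l else pc.+1, s)
  end.

Definition cond_regs (b : cond) : seq nat :=
  match b with CEq x y => [:: x; y] | CMem x _ => [:: x] end.

Definition instr_regs (i : instr) : seq nat :=
  match i with
  | IInc x => [:: x]
  | ICopy x y => [:: x; y]
  | IWrite x _ => [:: x]
  | IJump b _ => cond_regs b
  end.

(* A copy of a register to itself is excluded: the machine erases the old mark
   before it looks for the new position. *)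
Definition instr_ok (K : nat) (i : instr) : bool :=
  all (fun x => x < K) (instr_regs i)
  && (if i is ICopy x y then x != y else true).

(** The bound on the new program counter keeps it in the finite state set of the simulating machine,
    where the value [size P] means halting. *)
Inductive flat (P : seq instr) : nat -> nat * store -> nat * store -> Prop :=
  | flat0 cf : flat P 0 cf cf
  | flatS t pc s cf :
      pc < size P ->
      (effect (nth (IInc 0) P pc) pc s).1 <= size P ->
      flat P t (effect (nth (IInc 0) P pc) pc s) cf ->
      flat P t.+1 (pc, s) cf.

Lemma flat_trans P t1 t2 a b c : flat P t1 a b -> flat P t2 b c -> flat P (t1 + t2) a c.
Proof.
move=> H; elim: H => {t1 a b} [//|t pc s cf lt le _ IH H2].
by rewrite addSn; apply: flatS => //; apply: IH.
Qed.

(** * Simulation by a Turing machine *)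

(* Cell [j] carries the memory symbol [mem j] and the set of the registers with
   value [j]; the last boolean singles out the end marker in cell [-1]. *)
Section Simulation.
Variables (K : nat) (P : seq instr).

Definition cell : finType := (option bool * {ffun 'I_K -> bool} * bool)%type.
Definition nomark : {ffun 'I_K -> bool} := [ffun => false].
Definition endcell : cell := (None, nomark, true).

(** [Find] looks for the mark of the main register. After that [IInc] drops the mark one cell
    further ([Put]), [ICopy] returns to the end marker ([Back]) and looks for the source register
    ([Find2]), and every instruction ends with the way back to cell [0] ([Home]). The [Start] phases
    write the end marker and put all marks on cell [0]. Phases are coded in ['I_8] because the
    states must form a [finType]. *)
Inductive phase := Find | Put | Back | Find2 | Home | Start0 | Start1 | Start2.

Definition nat_of_phase (p : phase) : 'I_8 :=
  inord (match p with Find => 0 | Put => 1 | Back => 2 | Find2 => 3 | Home => 4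
         | Start0 => 5 | Start1 => 6 | Start2 => 7 end).
Definition phase_of_nat (i : 'I_8) : phase :=
  match val i with 0 => Find | 1 => Put | 2 => Back | 3 => Find2 | 4 => Home
         | 5 => Start0 | 6 => Start1 | _ => Start2 end.

Definition state : finType := ('I_(size P).+1 * 'I_8)%type.
Definition st (pc : nat) (p : phase) : state := (inord pc, nat_of_phase p).

Lemma nat_of_phaseK : cancel nat_of_phase phase_of_nat.
Proof. by case; rewrite /phase_of_nat /nat_of_phase /= inordK. Qed.

Definition marked (m : {ffun 'I_K -> bool}) (x : nat) : bool :=
  [exists i : 'I_K, (val i == x) && m i].
Definition unmark (m : {ffun 'I_K -> bool}) (x : nat) : {ffun 'I_K -> bool} :=
  [ffun i : 'I_K => (val i != x) && m i].
Definition mark (m : {ffun 'I_K -> bool}) (x : nat) : {ffun 'I_K -> bool} :=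
  [ffun i : 'I_K => (val i == x) || m i].

Definition main_reg (i : instr) : nat :=
  match i with
  | IInc x => x | ICopy x _ => x | IWrite x _ => x
  | IJump (CEq x _) _ => x | IJump (CMem x _) _ => x
  end.

Definition act (i : instr) (pc : nat) (a : cell) : state * cell * dir :=
  let: (b, m, k) := a in
  match i with
  | IInc x => (st pc Put, (b, unmark m x, k), DR)
  | ICopy x y => (st pc Back, (b, unmark m x, k), DS)
  | IWrite x c => (st pc.+1 Home, (Some c, m, k), DS)
  | IJump (CEq x y) l => (st (if marked m y then l else pc.+1) Home, a, DS)
  | IJump (CMem x c) l => (st (if b == c then l else pc.+1) Home, a, DS)
  end.

Definition trans (q : state) (a : cell) : option (state * cell * dir) :=
  let: (b, m, k) := a in
  let pc := val q.1 in
  let i := nth (IInc 0) P pc in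
  match phase_of_nat q.2 with
  | Find => if pc < size P then
              if marked m (main_reg i) then Some (act i pc a)
              else Some (st pc Find, a, DR)
            else None
  | Put => Some (st pc.+1 Home, (b, mark m (main_reg i), k), DS)
  | Back => if k then Some (st pc Find2, a, DR) else Some (st pc Back, a, DL)
  | Find2 => if i is ICopy x y then
               if marked m y then Some (st pc.+1 Home, (b, mark m x, k), DS)
               else Some (st pc Find2, a, DR)
             else None
  | Home => if k then Some (st pc Find, a, DR) else Some (st pc Home, a, DL)
  | Start0 => Some (st 0 Start1, a, DL)
  | Start1 => Some (st 0 Start2, endcell, DR)
  | Start2 => Some (st 0 Find, (b, [ffun => true], k), DS)
  end.

Definition machine : TM := {|
  St := state; Sy := cell;
  blank := (None, nomark, false);
  sym0 := (Some false, nomark, false);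
  sym1 := (Some true, nomark, false);
  start := st 0 Start0;
  delta := trans |}.

Fixpoint steps (t : nat) (a b : config machine) : Prop :=
  match t with
  | 0 => a = b
  | t'.+1 => exists2 c, step a = Some c & steps t' c b
  end.

Lemma steps_trans t1 t2 a b c : steps t1 a b -> steps t2 b c -> steps (t1 + t2) a c.
Proof.
elim: t1 a => [a -> //|t IH a [d Hd H] H2] /=.
by exists d => //; apply: IH.
Qed.

Lemma steps_cons t a b c : step a = Some b -> steps t b c -> steps t.+1 a c.
Proof. by move=> H1 H2; exists b. Qed.

Lemma exec_steps t t' a b : steps t a b -> step b = None -> t < t' -> exec t' a = Some b.
Proof.
elim: t a t' => [a [//|t'] /= -> -> //|t IH a [//|t'] /= [c -> H] Hb lt].
exact: IH H Hb lt.
Qed.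

(** Cells beyond the stored list are blank. The right part is compared through [nth] with the blank
    as default, so lists that differ in trailing blanks describe the same tape. *)
Definition at_pos (f : nat -> cell) (p : nat) (t : tape machine) : Prop :=
  let: (l, a, r) := t in
  [/\ l = rcons (rev (mkseq f p)) endcell, a = f p
    & forall i, nth (blank machine) r i = f (p.+1 + i)].

Definition at_end (f : nat -> cell) (t : tape machine) : Prop :=
  let: (l, a, r) := t in
  [/\ l = [::], a = endcell & forall i, nth (blank machine) r i = f i].

Lemma move_right f p t : at_pos f p t -> at_pos f p.+1 (move (M := machine) DR t).
Proof.
case: t => [[l a] r] [-> -> H] /=.
have E : f p :: rcons (rev (mkseq f p)) endcell = rcons (rev (mkseq f p.+1)) endcell.
  by rewrite mkseqS rev_rcons.
case: r H => [|x r] H /=; split; rewrite ?E //;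
  try by [rewrite -(addn0 p.+1) -H].
- by move=> i; rewrite nth_nil addSnnS -H.
- by move=> i; rewrite addSnnS -H.
Qed.

Lemma move_left f p t : at_pos f p.+1 t -> at_pos f p (move (M := machine) DL t).
Proof.
case: t => [[l a] r] [-> -> H].
rewrite mkseqS rev_rcons /=; split=> // [[|i]] /=; first by rewrite addn0.
by rewrite H addSnnS.
Qed.

Lemma move_left0 f t : at_pos f 0 t -> at_end f (move (M := machine) DL t).
Proof.
case: t => [[l a] r] [-> -> H]; rewrite /=; split=> // [[|i]] //=.
Qed.

Lemma move_right0 f t : at_end f t -> at_pos f 0 (move (M := machine) DR t).
Proof.
case: t => [[l a] r] [-> -> H] /=.
case: r H => [|x r] H /=; split=> //; try by [rewrite -H].
- by move=> i; rewrite nth_nil -H.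
- by move=> i; rewrite -H.
Qed.

Lemma at_posE f p t : at_pos f p t -> t = (t.1.1, f p, t.2).
Proof. by case: t => [[l a] r] [-> -> H]. Qed.

Lemma at_endE f t : at_end f t -> t = ([::], endcell, t.2).
Proof. by case: t => [[l a] r] [-> -> H]. Qed.

Lemma at_pos_write f g p l a r b :
  at_pos f p (l, a, r) -> g p = b -> (forall j, j != p -> g j = f j) ->
  at_pos g p (l, b, r).
Proof.
move=> [-> _ H] gp gf; split=> //.
  congr (rcons (rev _) _); apply/eq_in_map => i.
  by rewrite mem_iota /= add0n => ip; rewrite gf // neq_ltn ip.
by move=> i; rewrite H gf //; lia.
Qed.

Definition content (s : store) (j : nat) : cell :=
  (s.2 j, [ffun i : 'I_K => s.1 i == j], false).

Lemma valst pc p : pc <= size P -> val (st pc p).1 = pc.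
Proof. by move=> le; rewrite /= inordK. Qed.

Lemma phst pc p : phase_of_nat (st pc p).2 = p.
Proof. by rewrite /= nat_of_phaseK. Qed.

Lemma marked_content (s : store) x j : x < K ->
  marked [ffun i : 'I_K => s.1 i == j] x = (s.1 x == j).
Proof.
move=> xK; apply/existsP/idP => [[i /andP[/eqP <-]]|E]; first by rewrite ffunE.
by exists (Ordinal xK); rewrite ffunE eqxx.
Qed.

Definition boring (f : nat -> cell) := forall j, (f j).2 = false.

(** From cell [p] there are [p + 1] moves to the end marker and one move back to cell [0]. *)
Lemma run_left (ph : phase) f pc p t :
  ph = Back \/ ph = Home -> pc <= size P -> boring f -> at_pos f p t ->
  exists2 t', steps p.+2 (st pc ph, t) (st pc (if ph is Home then Find else Find2), t')
            & at_pos f 0 t'.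
Proof.
move=> Hph le bf; elim: p t => [|p IH] t Ht.
  exists (move (M := machine) DR (move (M := machine) DL t)); last first.
    exact/move_right0/move_left0.
  have E1 : step (M := machine) (st pc ph, t) = Some (st pc ph, move (M := machine) DL t).
    rewrite (at_posE Ht) /= /trans; move: (bf 0); case: (f 0) => [[b m] k] /= ->.
    by rewrite nat_of_phaseK inordK //; case: Hph => ->.
  have := move_left0 Ht; set t1 := move _ _ in E1 * => H1.
  exists (st pc ph, t1) => //.
  exists (st pc (if ph is Home then Find else Find2), move (M := machine) DR t1) => //.
  rewrite (at_endE H1) /= nat_of_phaseK inordK //.
  by case: Hph => ->.
have [t' S1 P1] := IH _ (move_left Ht).
exists t' => //; exists (st pc ph, move (M := machine) DL t) => //.
rewrite (at_posE Ht) /= /trans; move: (bf p.+1); case: (f p.+1) => [[b m] k] /= ->.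
by rewrite nat_of_phaseK inordK //; case: Hph => ->.
Qed.

Lemma run_find f pc x p t :
  pc < size P -> main_reg (nth (IInc 0) P pc) = x ->
  (forall j, j < p -> ~~ marked (f j).1.2 x) -> at_pos f 0 t ->
  exists2 t', steps p (st pc Find, t) (st pc Find, t') & at_pos f p t'.
Proof.
move=> lt Ex; elim: p => [|p IH] nm Ht; first by exists t.
have [|t' S1 P1] := IH _ Ht; first by move=> j jp; apply: nm; lia.
exists (move (M := machine) DR t'); last exact: move_right.
rewrite -addn1; apply: steps_trans S1 _.
exists (st pc Find, move (M := machine) DR t') => //.
rewrite (at_posE P1) /= /trans; have := nm p (ltnSn p).
case: (f p) => [[b m] k] /= /negbTE nmp.
by rewrite nat_of_phaseK inordK ?lt ?Ex ?nmp // ltnW.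
Qed.

Lemma run_find2 f pc x y p t :
  pc < size P -> nth (IInc 0) P pc = ICopy x y ->
  (forall j, j < p -> ~~ marked (f j).1.2 y) -> at_pos f 0 t ->
  exists2 t', steps p (st pc Find2, t) (st pc Find2, t') & at_pos f p t'.
Proof.
move=> lt Ex; elim: p => [|p IH] nm Ht; first by exists t.
have [|t' S1 P1] := IH _ Ht; first by move=> j jp; apply: nm; lia.
exists (move (M := machine) DR t'); last exact: move_right.
rewrite -addn1; apply: steps_trans S1 _.
exists (st pc Find2, move (M := machine) DR t') => //.
rewrite (at_posE P1) /= /trans; have := nm p (ltnSn p).
case: (f p) => [[b m] k] /= /negbTE nmp.
by rewrite nat_of_phaseK inordK ?lt ?Ex ?nmp // ltnW.
Qed.

Lemma find_reg s pc t x :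
  pc < size P -> main_reg (nth (IInc 0) P pc) = x -> x < K ->
  at_pos (content s) 0 t ->
  exists2 t', steps (s.1 x) (st pc Find, t) (st pc Find, t')
            & at_pos (content s) (s.1 x) t'.
Proof.
move=> lt Ex xK; apply: run_find => // j jx.
by rewrite Ex marked_content // neq_ltn jx orbT.
Qed.

Lemma step_act s pc t i q a d :
  pc < size P -> nth (IInc 0) P pc = i -> main_reg i < K ->
  at_pos (content s) (s.1 (main_reg i)) t ->
  act i pc (content s (s.1 (main_reg i))) = (q, a, d) ->
  step (M := machine) (st pc Find, t) = Some (q, move (M := machine) d (t.1.1, a, t.2)).
Proof.
move=> lt Ei xK Ht Ea; have le := ltnW lt.
have Et : trans (st pc Find) (content s (s.1 (main_reg i))) = Some (q, a, d).
  by rewrite -Ea /trans {1}/content phst valst // lt Ei marked_content // eqxx.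
by rewrite {1}(at_posE Ht) /step [delta _ _]Et.
Qed.

Lemma home s pc p t : pc <= size P -> at_pos (content s) p t ->
  exists2 t', steps p.+2 (st pc Home, t) (st pc Find, t') & at_pos (content s) 0 t'.
Proof. by move=> le; apply: run_left => //; right. Qed.

(** The tape between the removal of the mark of [x] and its reinsertion. *)
Definition erased (s : store) (x j : nat) : cell :=
  (s.2 j, [ffun i : 'I_K => (val i != x) && (s.1 i == j)], false).

Lemma at_pos_erase s x l r :
  at_pos (content s) (s.1 x) (l, content s (s.1 x), r) ->
  at_pos (erased s x) (s.1 x)
    (l, (s.2 (s.1 x), unmark [ffun i : 'I_K => s.1 i == s.1 x] x, false), r).
Proof.
move=> H; apply: at_pos_write H _ _; rewrite /erased /unmark.
  by congr (_, _, _); apply/ffunP => i; rewrite !ffunE.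
move=> j jx; congr (_, _, _); apply/ffunP => i; rewrite !ffunE.
by case: eqP => //= ->; rewrite eq_sym (negbTE jx).
Qed.

Lemma at_pos_mark s x v l r :
  at_pos (erased s x) v (l, erased s x v, r) ->
  at_pos (content (upd s.1 x v, s.2)) v
    (l, (s.2 v, mark [ffun i : 'I_K => (val i != x) && (s.1 i == v)] x, false), r).
Proof.
move=> H; apply: at_pos_write H _ _; rewrite /content /mark /=.
  congr (_, _, _); apply/ffunP => i; rewrite !ffunE /upd.
  by case: (val i =P x) => //= _; rewrite ?eqxx.
move=> j jx; congr (_, _, _); apply/ffunP => i; rewrite !ffunE /upd.
by case: (val i =P x) => //= _; rewrite eq_sym (negbTE jx).
Qed.

(** The costliest instruction is [ICopy]: reach the mark of [x], return, reach the mark of [y],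
    return. This takes four walks of length at most [B] and six further steps. *)
Lemma run_instr s pc t B :
  pc < size P -> instr_ok K (nth (IInc 0) P pc) ->
  (forall x, x < K -> s.1 x <= B) ->
  (effect (nth (IInc 0) P pc) pc s).1 <= size P ->
  at_pos (content s) 0 t ->
  exists d t', [/\ d <= 4 * B + 6,
     steps d (st pc Find, t) (st (effect (nth (IInc 0) P pc) pc s).1 Find, t')
   & at_pos (content (effect (nth (IInc 0) P pc) pc s).2) 0 t'].
Proof.
move=> lt ok HB le' Ht; have le := ltnW lt.
case E: (nth (IInc 0) P pc) ok le' => [x|x y|x a|[x y|x a] l] /=;
  rewrite /instr_ok /= ?andbT.
- move=> xK le'; have [t1 S1 P1] := find_reg lt (f_equal main_reg E) xK Ht.
  have S2 := step_act lt E xK P1 erefl.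
  have := move_right (at_pos_erase (l := t1.1.1) (r := t1.2) (s := s) (x := x) _).
  rewrite -(at_posE P1) => /(_ P1).
  set t2 := move _ _ in S2 * => P2.
  have S3 : step (M := machine) (st pc Put, t2) =
      Some (st pc.+1 Home, (t2.1.1, (s.2 (s.1 x).+1,
        mark [ffun i : 'I_K => (val i != x) && (s.1 i == (s.1 x).+1)] x, false), t2.2)).
    by rewrite (at_posE P2) /= nat_of_phaseK inordK // E.
  have P2' := P2; rewrite (at_posE P2) in P2'; have P3 := at_pos_mark P2'.
  have [t4 S4 P4] := home le' P3.
  exists (s.1 x + (s.1 x).+3.+2), t4; split=> //.
    by have := HB _ xK; lia.
  apply: steps_trans S1 _; apply: steps_cons S2 _.
  by apply: steps_cons S3 S4.
- move=> /andP[/andP[xK yK] xy] le'.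
  have [t1 S1 P1] := find_reg lt (f_equal main_reg E) xK Ht.
  have S2 := step_act lt E xK P1 erefl.
  have := at_pos_erase (l := t1.1.1) (r := t1.2) (s := s) (x := x) _.
  rewrite -(at_posE P1) => /(_ P1) P2.
  have [t3 S3 P3] := run_left (or_introl erefl) le (fun j => erefl : (erased s x j).2 = false) P2.
  have [t4 S4 P4] : exists2 t', steps (s.1 y) (st pc Find2, t3) (st pc Find2, t')
      & at_pos (erased s x) (s.1 y) t'.
    apply: (run_find2 lt E) P3 => j jy /=; apply/existsP => -[i /andP[/eqP iy]].
    by rewrite ffunE iy => /andP[_ /eqP ?]; lia.
  have S5 : step (M := machine) (st pc Find2, t4) =
      Some (st pc.+1 Home, (t4.1.1, (s.2 (s.1 y),
        mark [ffun i : 'I_K => (val i != x) && (s.1 i == s.1 y)] x, false), t4.2)).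
    rewrite (at_posE P4) /= nat_of_phaseK inordK // E /marked.
    case: existsP => // -[]; exists (Ordinal yK).
    by rewrite ffunE /= !eqxx eq_sym xy.
  have P4' := P4; rewrite (at_posE P4) in P4'; have P5 := at_pos_mark P4'.
  have [t6 S6 P6] := home le' P5.
  exists (s.1 x + ((s.1 x).+2 + (s.1 y + (s.1 y).+3)).+1), t6; split=> //.
    by have := HB _ xK; have := HB _ yK; lia.
  apply: steps_trans S1 _; apply: steps_cons S2 _.
  apply: steps_trans S3 _; apply: steps_trans S4 _.
  by apply: steps_cons S5 S6.
- move=> xK le'; have [t1 S1 P1] := find_reg lt (f_equal main_reg E) xK Ht.
  have S2 := step_act lt E xK P1 erefl.
  have P2 : at_pos (content (s.1, upd s.2 (s.1 x) (Some a))) (s.1 x)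
      (t1.1.1, (Some a, [ffun i : 'I_K => s.1 i == s.1 x], false), t1.2).
    have P1' := P1; rewrite (at_posE P1) in P1'; apply: at_pos_write P1' _ _.
      by rewrite /content /= updE.
    by move=> j jx; rewrite /content /= /upd (negbTE jx).
  have [t3 S3 P3] := home le' P2.
  exists (s.1 x + (s.1 x).+3), t3; split=> //.
    by have := HB _ xK; lia.
  by apply: steps_trans S1 _; apply: steps_cons S2 S3.
- move=> /andP[xK yK] le'; have [t1 S1 P1] := find_reg lt (f_equal main_reg E) xK Ht.
  have S2 : step (M := machine) (st pc Find, t1) =
      Some (st (if s.1 x == s.1 y then l else pc.+1) Home, t1).
    by rewrite (step_act lt E xK P1 erefl) marked_content // eq_sym
      -[move _ _]/(t1.1.1, content s (s.1 x), t1.2) -(at_posE P1).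
  have [t3 S3 P3] := home le' P1.
  exists (s.1 x + (s.1 x).+3), t3; split=> //.
    by have := HB _ xK; lia.
  by apply: steps_trans S1 _; apply: steps_cons S2 S3.
- move=> xK le'; have [t1 S1 P1] := find_reg lt (f_equal main_reg E) xK Ht.
  have S2 : step (M := machine) (st pc Find, t1) =
      Some (st (if s.2 (s.1 x) == a then l else pc.+1) Home, t1).
    by rewrite (step_act lt E xK P1 erefl)
      -[move _ _]/(t1.1.1, content s (s.1 x), t1.2) -(at_posE P1).
  have [t3 S3 P3] := home le' P1.
  exists (s.1 x + (s.1 x).+3), t3; split=> //.
    by have := HB _ xK; lia.
  by apply: steps_trans S1 _; apply: steps_cons S2 S3.
Qed.

Lemma effect_le i pc s B : (forall x, s.1 x <= B) ->
  forall x, (effect i pc s).2.1 x <= B.+1.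
Proof.
move=> HB x; case: i => [y|y z|y a|b l] /=; rewrite /upd; try case: ifP => _;
  by rewrite ?ltnS //; apply: leqW.
Qed.

Lemma run_flat n cf cf' t B :
  all (instr_ok K) P -> flat P n cf cf' -> (forall x, cf.2.1 x <= B) ->
  at_pos (content cf.2) 0 t ->
  exists d t', [/\ d <= n * (4 * (B + n) + 6),
     steps d (st cf.1 Find, t) (st cf'.1 Find, t') & at_pos (content cf'.2) 0 t'].
Proof.
move=> okP H; elim: H t B => {n cf cf'} [cf|n pc s cf lt le _ IH] t B HB Ht.
  by exists 0, t.
have ok := all_nthP (IInc 0) okP _ lt.
have [d1 [t1 [D1 S1 P1]]] := run_instr lt ok (fun x _ => HB x) le Ht.
have [d2 [t2 [D2 S2 P2]]] := IH t1 B.+1 (effect_le _ _ HB) P1.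
exists (d1 + d2), t2; split=> //; first by nia.
exact: steps_trans S1 S2.
Qed.

Lemma start_run (w : seq bool) :
  let s := (fun=> 0, fun j => nth None (map some w) j) : store in
  exists2 t, steps 3 (init [seq if b then sym1 machine else sym0 machine | b <- w])
                     (st 0 Find, t) & at_pos (content s) 0 t.
Proof.
move=> s; pose f j := nth (blank machine) [seq if b then sym1 machine else sym0 machine | b <- w] j.
have P0 : at_end f ([::], endcell, [seq if b then sym1 machine else sym0 machine | b <- w]) by [].
have P1 := move_right0 P0; set t1 := move _ _ in P1.
exists (t1.1.1, ((f 0).1.1, [ffun => true], (f 0).2), t1.2); last first.
  have P2 := P1; rewrite (at_posE P1) in P2; apply: at_pos_write P2 _ _.
    have -> : f 0 = (s.2 0, nomark, false) by rewrite /f /s; case: (w) => [|[] ?].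
    by rewrite /content /=; congr (_, _, _); apply/ffunP => i; rewrite !ffunE.
  move=> j j0; rewrite /f /content /s /=.
  have -> : [ffun i : 'I_K => 0 == j] = nomark.
    by apply/ffunP => i; rewrite !ffunE eq_sym (negbTE j0).
  case: (ltnP j (size w)) => jw; last by rewrite !nth_default ?size_map.
  by rewrite !(nth_map false) //; case: (nth _ _ _).
rewrite /t1 /f; case: (w) => [|b w'] /=.
  eexists; first by rewrite /= nat_of_phaseK.
  eexists; first by rewrite /= nat_of_phaseK.
  by eexists; first by rewrite /= nat_of_phaseK.
set a := if b then _ else _.
have [a1 [a2 [a3 Ea]]] : exists a1 a2 a3, a = (a1, a2, a3) by case: (a) => [[a1 a2] a3]; exists a1, a2, a3.
rewrite Ea.
eexists; first by rewrite /= nat_of_phaseK.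
eexists; first by rewrite /= nat_of_phaseK.
by eexists; first by rewrite /= nat_of_phaseK.
Qed.

Lemma halted t : step (M := machine) (st (size P) Find, t) = None.
Proof.
by case: t => [[l [[b m] k]] r]; rewrite /= nat_of_phaseK inordK // ltnn.
Qed.

(** A marked cell differs from [sym1] whatever its bit is. Marks must avoid the cells before [g],
    but a mark on cell [g] ends the unary output as well as another bit does. *)
Lemma output_content s t pc g :
  at_pos (content s) 0 t ->
  (forall j, j < g -> s.2 j = Some true) -> (forall x j, x < K -> j < g -> s.1 x != j) ->
  s.2 g <> Some true \/ (exists2 x, x < K & s.1 x = g) ->
  output (M := machine) (st pc Find, t) = g.
Proof.
case: t => [[l a] r] [_ -> H] Hm Hr Hg.
have Hc j : nth (blank machine) (content s 0 :: r) j = content s j.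
  by case: j => [//|j] /=; rewrite H.
have C1 j : j < g -> content s j = sym1 machine.
  move=> jg; rewrite /content Hm //; congr (_, _, _); apply/ffunP => i.
  by rewrite !ffunE; apply/negbTE/Hr.
have C2 : content s g != sym1 machine.
  apply/eqP => Ec; case: Hg => [[]|[x xK xg]].
    exact: (f_equal (fun c : cell => c.1.1) Ec).
  have := f_equal (fun c : cell => c.1.2 (Ordinal xK)) Ec.
  by rewrite /= !ffunE xg eqxx.
rewrite /output -[LHS]/(find _ (content s 0 :: r)).
set u := content s 0 :: r in Hc *.
set F := find _ u; apply/eqP; rewrite eqn_leq; apply/andP; split.
  rewrite leqNgt; apply/negP => gF.
  by have := before_find (blank machine) gF; rewrite Hc C2.
rewrite leqNgt; apply/negP => Fg.
have := Hc F; rewrite C1 //; case: (boolP (has (fun s0 => s0 != sym1 machine) u)) => hF.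
  by move=> E; have := nth_find (blank machine) hF; rewrite E eqxx.
by rewrite nth_default // /F hasNfind.
Qed.

End Simulation.
(** * Structured programs *)

Inductive cmd :=
  | Skip
  | Inc (x : nat)
  | Copy (x y : nat)
  | Write (x : nat) (a : bool)
  | Seq (c1 c2 : cmd)
  | If (b : cond) (c1 c2 : cmd)
  | Until (b : cond) (c : cmd).

(* [runs c t s s']: the flat code of [c] leads from [s] to [s'] in exactly [t] instructions. *)
Inductive runs : cmd -> nat -> store -> store -> Prop :=
  | RSkip s : runs Skip 0 s s
  | RInc x s : runs (Inc x) 1 s (upd s.1 x (s.1 x).+1, s.2)
  | RCopy x y s : x != y -> runs (Copy x y) 1 s (upd s.1 x (s.1 y), s.2)
  | RWrite x a s : runs (Write x a) 1 s (s.1, upd s.2 (s.1 x) (Some a))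
  | RSeq c1 c2 t1 t2 s s1 s2 :
      runs c1 t1 s s1 -> runs c2 t2 s1 s2 -> runs (Seq c1 c2) (t1 + t2) s s2
  | RIfT b c1 c2 t s s' : test b s -> runs c1 t s s' -> runs (If b c1 c2) t.+1 s s'
  | RIfF b c1 c2 t s s' : ~~ test b s -> runs c2 t s s' -> runs (If b c1 c2) t.+2 s s'
  | RUntil0 b c s : test b s -> runs (Until b c) 1 s s
  | RUntilS b c t1 t2 s s1 s2 :
      ~~ test b s -> runs c t1 s s1 -> runs (Until b c) t2 s1 s2 ->
      runs (Until b c) (t1.+2 + t2) s s2.

Fixpoint csize (c : cmd) : nat :=
  match c with
  | Skip => 0
  | Inc _ | Copy _ _ | Write _ _ => 1
  | Seq c1 c2 => csize c1 + csize c2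
  | If _ c1 c2 => (csize c1 + csize c2).+2
  | Until _ c => (csize c).+2
  end.

Definition jump (l : nat) : instr := IJump (CEq 0 0) l.

(** Jumps go to absolute positions, so the offset [o] is passed along. A jump is taken when its test
    succeeds, hence the else-branch comes first; comparing register [0] with itself gives the
    unconditional jump. *)
Fixpoint code (c : cmd) (o : nat) : seq instr :=
  match c with
  | Skip => [::]
  | Inc x => [:: IInc x]
  | Copy x y => [:: ICopy x y]
  | Write x a => [:: IWrite x a]
  | Seq c1 c2 => code c1 o ++ code c2 (o + csize c1)
  | If b c1 c2 =>
      IJump b (o + csize c2).+2 :: code c2 o.+1
        ++ jump (o + csize c2 + csize c1).+2 :: code c1 (o + csize c2).+2
  | Until b c => IJump b (o + csize c).+2 :: rcons (code c o.+1) (jump o)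
  end.

Lemma size_code c o : size (code c o) = csize c.
Proof.
elim: c o => //= [c1 IH1 c2 IH2|b c1 IH1 c2 IH2|b c IH] o.
- by rewrite size_cat IH1 IH2.
- by rewrite size_cat /= IH1 IH2; lia.
- by rewrite size_rcons IH.
Qed.

Definition code_at (P : seq instr) (o : nat) (C : seq instr) : Prop :=
  exists2 P1, size P1 = o & exists P2, P = P1 ++ C ++ P2.

Lemma code_at_catl P o C1 C2 : code_at P o (C1 ++ C2) -> code_at P o C1.
Proof. by move=> [P1 E [P2 ->]]; exists P1 => //; exists (C2 ++ P2); rewrite -catA. Qed.

Lemma code_at_catr P o C1 C2 : code_at P o (C1 ++ C2) -> code_at P (o + size C1) C2.
Proof.
move=> [P1 E [P2 ->]]; exists (P1 ++ C1); first by rewrite size_cat E.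
by exists P2; rewrite !catA.
Qed.

Lemma code_at_cons P o i C :
  code_at P o (i :: C) -> [/\ o < size P, nth (IInc 0) P o = i & code_at P o.+1 C].
Proof.
move=> [P1 E [P2 ->]]; split; first by rewrite size_cat E /= size_cat /=; lia.
  by rewrite nth_cat E ltnn subnn.
exists (rcons P1 i); first by rewrite size_rcons E.
by exists P2; rewrite -cats1 -catA.
Qed.

Lemma code_at_le P o C : code_at P o C -> o + size C <= size P.
Proof. by move=> [P1 E [P2 ->]]; rewrite !size_cat E; lia. Qed.

Lemma flat1 P pc s : pc < size P -> (effect (nth (IInc 0) P pc) pc s).1 <= size P ->
  flat P 1 (pc, s) (effect (nth (IInc 0) P pc) pc s).
Proof. by move=> lt le; apply: flatS => //; apply: flat0. Qed.

Lemma flat_code c t s s' P o :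
  runs c t s s' -> code_at P o (code c o) -> flat P t (o, s) (o + csize c, s').
Proof.
move=> H; elim: H P o => {c t s s'} /=.
- by move=> s P o _; rewrite addn0; apply: flat0.
- move=> x s P o /code_at_cons[lt E _]; have := @flat1 P o s lt.
  by rewrite E /= addn1; apply.
- move=> x y s _ P o /code_at_cons[lt E _]; have := @flat1 P o s lt.
  by rewrite E /= addn1; apply.
- move=> x a s P o /code_at_cons[lt E _]; have := @flat1 P o s lt.
  by rewrite E /= addn1; apply.
- move=> c1 c2 t1 t2 s s1 s2 _ IH1 _ IH2 P o H.
  apply: flat_trans (IH1 _ _ (code_at_catl H)) _.
  by rewrite addnA; apply: IH2; have := code_at_catr H; rewrite size_code.
- move=> b c1 c2 t s s' Hb _ IH P o /code_at_cons[lt E].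
  move/code_at_catr; rewrite size_code => /code_at_cons[_ _ H].
  rewrite -(addn1 t) addnC; apply: flat_trans (flat1 (s := s) lt _) _; rewrite E /= Hb.
    by have := code_at_le H; rewrite size_code; lia.
  rewrite (_ : o + (csize c1 + csize c2).+2 = (o + csize c2).+2 + csize c1); last lia.
  by apply: IH; move: H; rewrite addSn.
- move=> b c1 c2 t s s' Hb _ IH P o /code_at_cons[lt E H].
  have := code_at_catr H; rewrite size_code => /code_at_cons[lt' E' H'].
  rewrite (_ : t.+2 = 1 + (t + 1)); last lia.
  apply: flat_trans (flat1 (s := s) lt _) _; rewrite E /= (negbTE Hb) //.
  apply: flat_trans (IH _ _ (code_at_catl H)) _.
  have := @flat1 P (o.+1 + csize c2) s' lt'; rewrite E' /= eqxx.
  rewrite (_ : (o + csize c2 + csize c1).+2 = o + (csize c1 + csize c2).+2); last lia.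
  by apply; have := code_at_le H'; rewrite size_code; lia.
- move=> b c s Hb P o H0; have /code_at_cons[lt E _] := H0.
  have := @flat1 P o s lt; rewrite E /= Hb !addnS; apply.
  by have := code_at_le H0; rewrite /= size_rcons size_code; lia.
- move=> b c t1 t2 s s1 s2 Hb _ IH1 _ IH2 P o H0.
  have /code_at_cons[lt E H] := H0; rewrite -cats1 in H.
  have := code_at_catr H; rewrite size_code => /code_at_cons[lt' E' H'].
  rewrite (_ : t1.+2 + t2 = 1 + (t1 + (1 + t2))); last lia.
  apply: flat_trans (flat1 (s := s) lt _) _; rewrite E /= (negbTE Hb) //.
  apply: flat_trans (IH1 _ _ (code_at_catl H)) _.
  apply: flat_trans (IH2 _ _ H0).
  by have := @flat1 P (o.+1 + csize c) s1 lt'; rewrite E' /= eqxx; apply; lia.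
Qed.

Fixpoint cmd_ok (K : nat) (c : cmd) : bool :=
  match c with
  | Skip => true
  | Inc x | Write x _ => x < K
  | Copy x y => [&& x < K, y < K & x != y]
  | Seq c1 c2 => cmd_ok K c1 && cmd_ok K c2
  | If b c1 c2 => [&& all (fun x => x < K) (cond_regs b), cmd_ok K c1 & cmd_ok K c2]
  | Until b c => all (fun x => x < K) (cond_regs b) && cmd_ok K c
  end.

Lemma code_ok K c o : 0 < K -> cmd_ok K c -> all (instr_ok K) (code c o).
Proof.
move=> K0; elim: c o => //=.
- by move=> x o xK; rewrite /instr_ok /= xK.
- by move=> x y o /and3P[xK yK xy]; rewrite /instr_ok /= xK yK xy.
- by move=> x a o xK; rewrite /instr_ok /= xK.
- by move=> c1 IH1 c2 IH2 o /andP[H1 H2]; rewrite all_cat IH1 ?IH2.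
- move=> b c1 IH1 c2 IH2 o /and3P[Hb H1 H2].
  by rewrite /= all_cat /= IH1 ?IH2 // /instr_ok /= Hb K0.
- by move=> b c IH o /andP[Hb H1]; rewrite all_rcons IH //= /instr_ok /= Hb K0.
Qed.

Lemma cmd_ok_mono K K' c : K <= K' -> cmd_ok K c -> cmd_ok K' c.
Proof.
move=> le; have lt x : x < K -> x < K' by move=> xK; apply: leq_trans xK le.
have al l : all (fun x => x < K) l -> all (fun x => x < K') l.
  by apply: sub_all => x; apply: lt.
elim: c => //=.
- by move=> x y /and3P[/lt-> /lt-> ->].
- by move=> x a; apply: lt.
- by move=> c1 IH1 c2 IH2 /andP[/IH1-> /IH2->].
- by move=> b c1 IH1 c2 IH2 /and3P[/al-> /IH1-> /IH2->].
- by move=> b c IH /andP[/al-> /IH->].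
Qed.

Definition init_store (w : seq bool) : store :=
  (fun=> 0, fun j => nth None (map some w) j).

(* Registers grow by at most one per instruction, so [t] instructions cost [O(t^2)] steps. *)
Lemma machine_runs K c (w : seq bool) t s' g :
  0 < K -> cmd_ok K c -> runs c t (init_store w) s' ->
  (forall j, j < g -> s'.2 j = Some true) ->
  (forall x, x < K -> s'.1 x >= g) ->
  s'.2 g <> Some true \/ (exists2 x, x < K & s'.1 x = g) ->
  let M := machine K (code c 0) in
  exists2 cf, exec (t * (4 * t + 6) + 4)
      (init [seq if b then sym1 M else sym0 M | b <- w]) = Some cf
    & output cf = g.
Proof.
move=> K0 okc H Hm Hr Hg M; set P := code c 0.
have Hat : code_at P 0 (code c 0) by exists [::] => //; exists [::]; rewrite cats0.
have Hf := flat_code H Hat; rewrite add0n -(size_code c 0) in Hf.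
have [t0 S0 P0] := start_run K P w.
have [//|d [t1 [D1 S1 P1]]] := run_flat (B := 0) (code_ok 0 K0 okc) Hf _ P0.
exists (st P (size P) Find, t1).
  (* Three steps set up the tape, and [exec] takes one more unit to see that the machine has
     halted. *)
  apply: (@exec_steps K P (3 + d)) => //; first exact: steps_trans S0 S1.
    exact: halted.
  by move: D1; rewrite add0n; lia.
apply: output_content P1 Hm _ Hg => x j xK jg.
by apply: contraTneq (Hr x xK) => ->; rewrite -ltnNge.
Qed.
(** * Bounded arithmetic formulas *)

(* Register [0] always holds [0] and register [1] the bound [D] of the quantifiers. *)
Inductive term := Var (x : nat) | Succ (a : term) | Plus (a b : term) | Mult (a b : term).

Inductive form :=
  | FMem (a : term)
  | FEq (a b : term)
  | FNot (f : form)
  | FAnd (f g : form)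
  | FEx (x : nat) (f : form).

Fixpoint teval (a : term) (env : nat -> nat) : nat :=
  match a with
  | Var x => env x
  | Succ a => (teval a env).+1
  | Plus a b => teval a env + teval b env
  | Mult a b => teval a env * teval b env
  end.

Fixpoint eval (f : form) (env : nat -> nat) (mem : nat -> bool) : bool :=
  match f with
  | FMem a => mem (teval a env)
  | FEq a b => teval a env == teval b env
  | FNot f => ~~ eval f env mem
  | FAnd f g => eval f env mem && eval g env mem
  | FEx x f => has (fun v => eval f (upd env x v) mem) (iota 0 (env 1))
  end.

Fixpoint sat (f : form) (env : nat -> nat) (mem : nat -> bool) : Prop :=
  match f with
  | FMem a => mem (teval a env)
  | FEq a b => teval a env = teval b env
  | FNot f => ~ sat f env mem
  | FAnd f g => sat f env mem /\ sat g env mem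
  | FEx x f => exists2 v, v < env 1 & sat f (upd env x v) mem
  end.

Lemma satP f env mem : reflect (sat f env mem) (eval f env mem).
Proof.
elim: f env => [a|a b|f IH|f IHf g IHg|x f IH] env /=.
- exact: idP.
- exact: eqP.
- by apply: (iffP negP) => H /IH.
- by apply: (iffP andP) => -[/IHf ? /IHg ?].
- apply: (iffP hasP) => [[v]|[v lt /IH H]]; rewrite ?mem_iota.
    by move=> lt /IH H; exists v.
  by exists v; rewrite ?mem_iota.
Qed.

Fixpoint twf (v : nat) (a : term) : bool :=
  match a with
  | Var x => x < v
  | Succ a => twf v a
  | Plus a b | Mult a b => twf v a && twf v b
  end.

(** Bound variables must exceed [1], so that no quantifier overwrites the constant [0] or the common
    bound of all quantifiers. *)
Fixpoint fwf (v : nat) (f : form) : bool :=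
  match f with
  | FMem a => twf v a
  | FEq a b => twf v a && twf v b
  | FNot f => fwf v f
  | FAnd f g => fwf v f && fwf v g
  | FEx x f => (1 < x < v) && fwf v f
  end.

Lemma eq_teval v a env env' : twf v a -> (forall x, x < v -> env x = env' x) ->
  teval a env = teval a env'.
Proof.
move=> + H; elim: a => //= [a IH|a IHa b IHb|a IHa b IHb].
- by move/IH->.
- by move=> /andP[/IHa-> /IHb->].
- by move=> /andP[/IHa-> /IHb->].
Qed.

Lemma eq_eval v f env env' mem mem' : 1 < v -> fwf v f ->
  (forall x, x < v -> env x = env' x) -> mem =1 mem' ->
  eval f env mem = eval f env' mem'.
Proof.
move=> v1 wf H Hm; elim: f env env' wf H => //= [a|a b|f IH|f IHf g IHg|x f IH] env env'.
- by move=> wf H; rewrite Hm (eq_teval wf H).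
- by move=> /andP[wa wb] H; rewrite (eq_teval wa H) (eq_teval wb H).
- by move=> wf H; rewrite (IH _ _ wf H).
- by move=> /andP[wf wg] H; rewrite (IHf _ _ wf H) (IHg _ _ wg H).
- move=> /andP[_ wf] H; rewrite H //; apply: eq_has => u.
  by apply: IH => // y yv; rewrite /upd; case: eqP => // _; apply: H.
Qed.

(** A weakest precondition with a time bound: postconditions nest in [ends_seq], so a program is
    verified by executing it forwards. *)
Definition ends (c : cmd) (T : nat) (s : store) (Q : store -> Prop) : Prop :=
  exists t s', [/\ runs c t s s', t <= T & Q s'].

Lemma ends_weaken c T T' s (Q Q' : store -> Prop) :
  ends c T s Q -> T <= T' -> (forall s', Q s' -> Q' s') -> ends c T' s Q'.
Proof.
by move=> [t [s' [H le q]]] le' QQ'; exists t, s'; split; auto; apply: leq_trans le'.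
Qed.

Lemma ends_seq c1 c2 T1 T2 s Q :
  ends c1 T1 s (fun s1 => ends c2 T2 s1 Q) -> ends (Seq c1 c2) (T1 + T2) s Q.
Proof.
move=> [t1 [s1 [H1 le1 [t2 [s2 [H2 le2 q]]]]]].
by exists (t1 + t2), s2; split=> //; [exact: RSeq H1 H2 | exact: leq_add].
Qed.

Lemma ends_skip T s (Q : store -> Prop) : Q s -> ends Skip T s Q.
Proof. by move=> q; exists 0, s; split=> //; apply: RSkip. Qed.

Lemma ends_inc x s (Q : store -> Prop) :
  Q (upd s.1 x (s.1 x).+1, s.2) -> ends (Inc x) 1 s Q.
Proof. by move=> q; eexists; eexists; split; [exact: RInc | | exact: q]. Qed.

Lemma ends_copy x y s (Q : store -> Prop) : x != y ->
  Q (upd s.1 x (s.1 y), s.2) -> ends (Copy x y) 1 s Q.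
Proof. by move=> xy q; eexists; eexists; split; [exact: RCopy | | exact: q]. Qed.

Lemma ends_write x a s (Q : store -> Prop) :
  Q (s.1, upd s.2 (s.1 x) (Some a)) -> ends (Write x a) 1 s Q.
Proof. by move=> q; eexists; eexists; split; [exact: RWrite | | exact: q]. Qed.

Lemma ends_if b c1 c2 T s Q :
  (test b s -> ends c1 T s Q) -> (~~ test b s -> ends c2 T s Q) ->
  ends (If b c1 c2) T.+2 s Q.
Proof.
case: (boolP (test b s)) => Hb H1 H2.
  have [t [s' [H le q]]] := H1 isT.
  by exists t.+1, s'; split=> //; [exact: RIfT | lia].
have [t [s' [H le q]]] := H2 isT.
by exists t.+2, s'; split=> //; exact: RIfF.
Qed.

(** A round costs the test, the body and the jump back; the successful last test costs one more
    instruction. *)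
Lemma ends_until b c T N (I : nat -> store -> Prop) s :
  (forall k s, k <= N -> I k s -> test b s = (k == N)) ->
  (forall k s, k < N -> I k s -> ends c T s (I k.+1)) ->
  I 0 s -> ends (Until b c) (N * T.+2 + 1) s (I N).
Proof.
move=> Hb Hc; have gen k j u : k + j = N -> I j u -> ends (Until b c) (k * T.+2 + 1) u (I N).
  elim: k j u => [|k IH] j u E Ij.
    rewrite add0n in E; rewrite {}E in Ij; exists 1, u; split=> //.
    by apply: RUntil0; rewrite (Hb N) // eqxx.
  have lt : j < N by lia.
  have [t1 [s1 [H1 le1 q1]]] := Hc j u lt Ij.
  have [|t2 [s2 [H2 le2 q2]]] := IH j.+1 s1 _ q1; first by rewrite addnS.
  exists (t1.+2 + t2), s2; split=> //; last by rewrite mulSn; lia.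
  by apply: RUntilS H1 H2; rewrite (Hb j) // ?neq_ltn ?lt // ltnW.
exact: gen (addn0 N).
Qed.

Lemma ends_add i n d s N : i != n -> d != i -> d != n ->
  s.1 i = 0 -> s.1 n = N ->
  ends (Until (CEq i n) (Seq (Inc d) (Inc i))) (N * 4 + 1) s
    (fun s' => [/\ s'.2 = s.2, s'.1 d = s.1 d + N
      & forall x, x != d -> x != i -> s'.1 x = s.1 x]).
Proof.
move=> ni di dn i0 nN.
pose I k (s' : store) := [/\ s'.2 = s.2, s'.1 d = s.1 d + k, s'.1 i = k
  & forall x, x != d -> x != i -> s'.1 x = s.1 x].
apply: ends_weaken (ends_until (T := 2) (N := N) (I := I) _ _ _) _ _ => //.
- move=> k s' _ [_ _ E1 E2] /=; rewrite E1 E2 ?nN // eq_sym //.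
- move=> k s' lt [E1 E2 E3 E4]; apply: (@ends_seq _ _ 1 1); apply/ends_inc/ends_inc.
  rewrite /= /I /= /upd eqxx (negbTE di) eqxx (eq_sym i) (negbTE di).
  split=> //; [by rewrite E2 addnS | by rewrite E3 |].
  by move=> x xd xi; rewrite (negbTE xd) (negbTE xi) E4.
- by split=> //; rewrite addn0.
- by move=> s' [? ? ? ?]; split.
Qed.

(** The value is left in register [d], and the registers above [d] are scratch. Incrementing is the
    only arithmetic of the machine, so sums are loops and products are nested loops. *)
Fixpoint cterm (a : term) (d : nat) : cmd :=
  match a with
  | Var x => Copy d x
  | Succ a => Seq (cterm a d) (Inc d)
  | Plus a b =>
      Seq (cterm a d) (Seq (cterm b d.+1) (Seq (Copy d.+2 0)
        (Until (CEq d.+2 d.+1) (Seq (Inc d) (Inc d.+2)))))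
  | Mult a b =>
      Seq (cterm a d.+1) (Seq (cterm b d.+2) (Seq (Copy d 0) (Seq (Copy d.+3 0)
        (Until (CEq d.+3 d.+2)
          (Seq (Copy d.+4 0)
            (Seq (Until (CEq d.+4 d.+1) (Seq (Inc d) (Inc d.+4))) (Inc d.+3)))))))
  end.

Fixpoint tbound (a : term) (B : nat) : nat :=
  match a with
  | Var x => B
  | Succ a => (tbound a B).+1
  | Plus a b => tbound a B + tbound b B
  | Mult a b => tbound a B * tbound b B
  end.

Fixpoint tcost (a : term) (B : nat) : nat :=
  match a with
  | Var x => 1
  | Succ a => tcost a B + 1
  | Plus a b => tcost a B + (tcost b B + (1 + (tbound b B * 4 + 1)))
  | Mult a b =>
      tcost a B + (tcost b B + (1 + (1 +
        (tbound b B * (1 + ((tbound a B * 4 + 1) + 1)).+2 + 1))))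
  end.

Lemma teval_bound v a env B : twf v a -> (forall x, x < v -> env x <= B) ->
  teval a env <= tbound a B.
Proof.
move=> + H; elim: a => //= [a IHa b IHb|a IHa b IHb].
- by move=> /andP[/IHa ? /IHb ?]; exact: leq_add.
- by move=> /andP[/IHa ? /IHb ?]; exact: leq_mul.
Qed.

Lemma ends_term v a d B s : twf v a -> 0 < v <= d -> s.1 0 = 0 ->
  (forall x, x < v -> s.1 x <= B) ->
  ends (cterm a d) (tcost a B) s
    (fun s' => [/\ s'.2 = s.2, forall x, x < d -> s'.1 x = s.1 x & s'.1 d = teval a s.1]).
Proof.
move=> + /andP[v0]; elim: a d s => /= [x|a IH|a IHa b IHb|a IHa b IHb] d s.
- move=> xv vd s0 HB; apply: ends_copy; first by lia.
  by split=> //= [y yd|]; rewrite /upd ?eqxx //; case: eqP => // ?; lia.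
- move=> wf vd s0 HB; apply: ends_seq; apply: ends_weaken (IH d s wf vd s0 HB) (leqnn _) _.
  move=> s' [E1 E2 E3]; apply: ends_inc; split=> //= [y yd|]; rewrite /upd ?eqxx ?E3 //.
  by case: eqP => [?|_]; [lia | exact: E2].
- move=> /andP[wa wb] vd s0 HB; apply: ends_seq.
  apply: ends_weaken (IHa d s wa vd s0 HB) (leqnn _) _ => s1 [E1 E2 E3].
  apply: ends_seq; apply: ends_weaken (IHb d.+1 s1 wb _ _ _) (leqnn _) _.
  + exact: leqW.
  + by rewrite E2 //; lia.
  + by move=> x xv; rewrite E2 ?HB //; lia.
  move=> s2 [F1 F2 F3]; apply: ends_seq; apply: ends_copy => //.
  apply: ends_weaken (ends_add _ _ _ _ erefl) _ _ => /=; rewrite ?neq_ltn ?ltnS ?leqnn ?leqnSn ?orbT //.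
  + by rewrite updE F2 ?E2 //; lia.
  + rewrite leq_add2r leq_mul2r /upd orbC; case: eqP => [|_]; first lia.
    rewrite F3 (eq_teval (env' := s.1) wb) ?(teval_bound wb HB) //.
    by move=> x xv; apply: E2; lia.
  + move=> s3 [G1 G2 G3]; split; first by rewrite G1 F1.
      by move=> x xd; rewrite G3 ?neq_ltn ?xd // /upd; try case: eqP => [|_];
        rewrite ?F2 ?E2 //; lia.
    rewrite G2 /upd; do 2!(case: eqP => [|_]; first lia).
    rewrite F2 // E3 F3 (eq_teval (env' := s.1) wb) //.
    by move=> x xv; apply: E2; lia.
- move=> /andP[wa wb] vd s0 HB; apply: ends_seq.
  apply: ends_weaken (IHa d.+1 s wa _ s0 HB) (leqnn _) _; first exact: leqW.
  move=> s1 [E1 E2 E3].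
  apply: ends_seq; apply: ends_weaken (IHb d.+2 s1 wb _ _ _) (leqnn _) _.
  + by do 2!apply: leqW.
  + by rewrite E2 //; lia.
  + by move=> x xv; rewrite E2 ?HB //; lia.
  move=> s2 [F1 F2 F3]; apply: ends_seq; apply: ends_copy; first lia.
  apply: ends_seq; apply: ends_copy => //.
  have Eb : s2.1 d.+2 = teval b s.1.
    by rewrite F3 (eq_teval (env' := s.1) wb) // => x xv; apply: E2; lia.
  have Ea : s2.1 d.+1 = teval a s.1 by rewrite F2.
  have Ez : s2.1 0 = 0 by rewrite F2 ?E2 //; lia.
  set s3 := (upd _ _ _, _).
  pose I k (s' : store) := [/\ s'.2 = s.2, s'.1 d = teval a s.1 * k, s'.1 d.+3 = k
    & forall x, x < d \/ x = d.+1 \/ x = d.+2 -> s'.1 x = s2.1 x].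
  apply: ends_weaken (ends_until (N := teval b s.1)
    (T := 1 + ((tbound a B * 4 + 1) + 1)) (I := I) _ _ _) _ _.
  + move=> k s' _ [_ _ G3 G4] /=; rewrite G3 G4; last by right; right.
    by rewrite Eb.
  + move=> k s' lt [G1 G2 G3 G4]; apply: ends_seq; apply: ends_copy => //.
    apply: ends_seq; apply: ends_weaken (ends_add _ _ _ _ erefl) _ _ => /=;
      rewrite ?neq_ltn ?ltnS ?leqnn ?leqnSn ?orbT //; try by lia.
    * by rewrite updE G4 //; case: (d) vd => [|?]; [lia | left].
    * rewrite leq_add2r leq_mul2r /upd orbC; case: eqP => [|_]; first lia.
      by rewrite G4 ?Ea ?(teval_bound wa HB) //; right; left.
    move=> s4 [K1 K2 K3]; apply: ends_inc; split=> /=.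
    * by rewrite K1.
    * rewrite /upd; case: eqP => [|_]; first lia.
      rewrite K2 /upd; do 2!(case: eqP => [|_]; first lia).
      by rewrite G2 G4 ?Ea ?mulnS 1?addnC //; right; left.
    * rewrite updE K3 /upd; try lia.
      by case: eqP => [|_]; [lia | rewrite G3].
    * move=> x Hx; rewrite /upd; case: eqP => [|_]; first lia.
      rewrite K3 /upd; try lia.
      by case: eqP => [|_]; [lia | rewrite G4].
  + split=> /=; rewrite ?F1 ?E1 //.
    * by rewrite /upd; case: eqP => [|_]; [lia | rewrite eqxx Ez muln0].
    * by rewrite updE /upd; case: ifP.
    * by move=> x Hx; rewrite /upd; do 2!(case: eqP => [|_]; first lia).
  + by rewrite leq_add2r leq_mul2r (teval_bound wb HB) orbT.
  + move=> s' [G1 G2 G3 G4]; split=> // x xd.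
    by rewrite G4 ?F2 ?E2 //; try lia; left.
Qed.

(** The truth value, [0] or [1], is left in register [d]. A quantifier uses its own variable [x] as
    loop counter; the old value is saved in [d.+1] and restored, so variables may be bound
    repeatedly. *)
Fixpoint cform (f : form) (d : nat) : cmd :=
  match f with
  | FMem a =>
      Seq (cterm a d.+1) (Seq (Copy d 0) (If (CMem d.+1 (Some true)) (Inc d) Skip))
  | FEq a b =>
      Seq (cterm a d.+1) (Seq (cterm b d.+2) (Seq (Copy d 0)
        (If (CEq d.+1 d.+2) (Inc d) Skip)))
  | FNot f => Seq (cform f d) (If (CEq d 0) (Inc d) (Copy d 0))
  | FAnd f g => Seq (cform f d) (If (CEq d 0) Skip (cform g d))
  | FEx x f =>
      Seq (Copy d.+1 x) (Seq (Copy d 0) (Seq (Copy x 0) (Seq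
        (Until (CEq x 1)
          (Seq (cform f d.+2) (Seq (If (CEq d.+2 0) Skip (Copy d d.+2)) (Inc x))))
        (Copy x d.+1))))
  end.

Fixpoint fcost (f : form) (B : nat) : nat :=
  match f with
  | FMem a => tcost a B + (1 + 3)
  | FEq a b => tcost a B + (tcost b B + (1 + 3))
  | FNot f => fcost f B + 3
  | FAnd f g => fcost f B + (fcost g B).+2
  | FEx x f => 1 + (1 + (1 + ((B * (fcost f B + (3 + 1)).+2 + 1) + 1)))
  end.

Definition bits (mem : nat -> option bool) : nat -> bool := fun j => mem j == Some true.

Lemma ends_form v f d B s : fwf v f -> 1 < v <= d -> s.1 0 = 0 ->
  (forall x, x < v -> s.1 x <= B) ->
  ends (cform f d) (fcost f B) s
    (fun s' => [/\ s'.2 = s.2, forall x, x < d -> s'.1 x = s.1 x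
      & s'.1 d = eval f s.1 (bits s.2) :> nat]).
Proof.
move=> + /andP[v1]; have v0 := ltnW v1.
elim: f d s => /= [a|a b|f IH|f IHf g IHg|x f IH] d s.
- move=> wf vd s0 HB; apply: ends_seq.
  apply: ends_weaken (ends_term (d := d.+1) wf _ s0 HB) (leqnn _) _; first by rewrite v0 leqW.
  move=> s1 [E1 E2 E3]; apply: ends_seq; apply: ends_copy; first lia.
  have Ed : upd s1.1 d (s1.1 0) d.+1 = teval a s.1.
    by rewrite /upd; case: eqP => [|_]; [lia | rewrite E3].
  apply: ends_if; rewrite /= Ed E1 => Hm.
    apply: ends_inc; split=> //=.
      by move=> x xd; rewrite /upd; do ?(case: eqP => [|_]; first lia); apply: E2; lia.
    by rewrite !updE /bits Hm E2 // s0.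
  apply: ends_skip; split=> //=.
    by move=> x xd; rewrite /upd; do ?(case: eqP => [|_]; first lia); apply: E2; lia.
  by rewrite !updE /bits (negbTE Hm) E2 // s0.
- move=> /andP[wa wb] vd s0 HB; apply: ends_seq.
  apply: ends_weaken (ends_term (d := d.+1) wa _ s0 HB) (leqnn _) _; first by rewrite v0 leqW.
  move=> s1 [E1 E2 E3]; apply: ends_seq.
  apply: ends_weaken (ends_term (d := d.+2) (B := B) wb _ _ _) (leqnn _) _.
  + by rewrite v0 /= !leqW.
  + by rewrite E2.
  + by move=> x xv; rewrite E2 ?HB //; lia.
  move=> s2 [F1 F2 F3]; apply: ends_seq; apply: ends_copy; first lia.
  have Eb : s2.1 d.+2 = teval b s.1.
    by rewrite F3 (eq_teval (env' := s.1) wb) // => x xv; apply: E2; lia.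
  have Ea : s2.1 d.+1 = teval a s.1 by rewrite F2.
  have Ez : s2.1 0 = 0 by rewrite F2 ?E2 //; lia.
  have Ed1 : upd s2.1 d (s2.1 0) d.+1 = teval a s.1.
    by rewrite /upd; case: eqP => [|_]; [lia | rewrite Ea].
  have Ed2 : upd s2.1 d (s2.1 0) d.+2 = teval b s.1.
    by rewrite /upd; case: eqP => [|_]; [lia | rewrite Eb].
  apply: ends_if; rewrite /= Ed1 Ed2 => Hm.
    apply: ends_inc; split=> //=; first by rewrite F1.
      by move=> x xd; rewrite /upd; do ?(case: eqP => [|_]; first lia); rewrite F2 ?E2; lia.
    by rewrite !updE Hm Ez.
  apply: ends_skip; split=> //=; first by rewrite F1.
    by move=> x xd; rewrite /upd; do ?(case: eqP => [|_]; first lia); rewrite F2 ?E2; lia.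
  by rewrite !updE (negbTE Hm) Ez.
- move=> wf vd s0 HB; apply: ends_seq.
  apply: ends_weaken (IH d s wf vd s0 HB) (leqnn _) _ => s1 [E1 E2 E3].
  have Ez : s1.1 0 = 0 by rewrite E2 //; lia.
  apply: ends_if; rewrite /= Ez E3.
    case Ev: (eval _ _ _) => // _; apply: ends_inc; split=> //=; rewrite ?updE ?E3 ?Ev //.
    by move=> x xd; rewrite /upd; case: eqP => [|_]; [lia | exact: E2].
  case Ev: (eval _ _ _) => // _; apply: ends_copy; first lia.
  split=> //=; rewrite ?updE ?E3 ?Ev //.
  by move=> x xd; rewrite /upd; case: eqP => [|_]; [lia | exact: E2].
- move=> /andP[wf wg] vd s0 HB; apply: ends_seq.
  apply: ends_weaken (IHf d s wf vd s0 HB) (leqnn _) _ => s1 [E1 E2 E3].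
  have Ez : s1.1 0 = 0 by rewrite E2 //; lia.
  have Eg : eval g s1.1 (bits s1.2) = eval g s.1 (bits s.2).
    by apply: (eq_eval v1 wg) => [y yv|]; [apply: E2; lia | rewrite E1].
  apply: ends_if; rewrite /= Ez E3.
    case Ev: (eval f _ _) => // _; apply: ends_skip; split=> //=; rewrite ?E3 ?Ev //.
  case Ev: (eval f _ _) => // _.
  apply: ends_weaken (IHg d s1 wg vd Ez _) (leqnn _) _.
    by move=> y yv; rewrite E2 ?HB //; lia.
  by move=> s2 [F1 F2 F3]; split; rewrite ?F1 ?F3 ?Eg // => y yd; rewrite F2 ?E2.
- move=> /andP[/andP[x1 xv] wf] vd s0 HB.
  apply: ends_seq; apply: ends_copy; first lia.
  apply: ends_seq; apply: ends_copy; first lia.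
  apply: ends_seq; apply: ends_copy; first lia.
  apply: ends_seq; set s1 := (upd _ _ _, _).
  pose found k := has (fun u => eval f (upd s.1 x u) (bits s.2)) (iota 0 k).
  have foundS k : found k.+1 = found k || eval f (upd s.1 x k) (bits s.2).
    by rewrite /found -(addn1 k) iotaD has_cat /= orbF.
  pose I k (s' : store) := [/\ s'.2 = s.2, s'.1 d = found k :> nat, s'.1 x = k,
    s'.1 d.+1 = s.1 x & forall y, y < d -> y != x -> s'.1 y = s.1 y].
  apply: ends_weaken (ends_until (N := s.1 1) (T := fcost f B + (3 + 1)) (I := I) _ _ _) _ _.
  + move=> k s' _ [_ _ G3 _ G5] /=; rewrite G3 G5 //; [lia|].
    by rewrite neq_ltn x1.
  + move=> k s' lt [G1 G2 G3 G4 G5]; apply: ends_seq.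
    have G6 y : y < v -> s'.1 y = upd s.1 x k y.
      by move=> yv; rewrite /upd; case: eqP => [->|/eqP yx]; rewrite ?G3 ?G5 //; lia.
    have Ez : s'.1 0 = 0 by rewrite G5 //; lia.
    apply: ends_weaken (IH d.+2 s' wf _ _ _) (leqnn _) _ => //; first lia.
      by move=> y yv; rewrite G6 // /upd; case: eqP => _;
        [apply: leq_trans (ltnW lt) (HB _ v1) | exact: HB].
    move=> s2 [E1 E2 E3].
    have {}E3 : s2.1 d.+2 = eval f (upd s.1 x k) (bits s.2) :> nat.
      by rewrite E3 (eq_eval (mem' := bits s.2) v1 wf G6) // G1.
    have Ez' : s2.1 0 = 0 by rewrite E2.
    apply: ends_seq; apply: ends_if; rewrite /= Ez' E3 => Hk.
      have {}Hk : eval f (upd s.1 x k) (bits s.2) = false by case: (eval _ _ _) Hk.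
      apply: ends_skip; apply: ends_inc; split=> /=; rewrite ?E1 //.
      * rewrite /upd; case: eqP => [|_]; first lia.
        rewrite E2 ?G2; last lia.
        by rewrite foundS Hk orbF.
      * by rewrite updE E2 ?G3 //; lia.
      * by rewrite /upd; case: eqP => [|_]; [lia | rewrite E2 ?G4].
      * by move=> y yd yx; rewrite /upd (negbTE yx) E2 ?G5 //; lia.
    have {}Hk : eval f (upd s.1 x k) (bits s.2) = true by case: (eval _ _ _) Hk.
    apply: ends_copy; first lia.
    apply: ends_inc; split=> /=; rewrite ?E1 //.
    * rewrite /upd; case: eqP => [|_]; first lia.
      by rewrite eqxx E3 foundS Hk orbT.
    * by rewrite updE /upd; case: eqP => [|_]; [lia | rewrite E2 ?G3 //; lia].
    * by rewrite /upd; do 2!(case: eqP => [|_]; first lia); rewrite E2 ?G4.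
    * move=> y yd yx; rewrite /upd (negbTE yx); case: eqP => [|_]; first lia.
      by rewrite E2 ?G5 //; lia.
  + split=> //=; rewrite /upd.
    * by do 3!(try (case: eqP => [|_]; first lia)); rewrite ?eqxx ?s0; do ?case: eqP; lia.
    * by rewrite eqxx; do ?(case: eqP => [|_]; first lia); rewrite s0.
    * by do 2!(case: eqP => [|_]; first lia); rewrite eqxx.
    * by move=> y yd yx; rewrite (negbTE yx); do 2!(case: eqP => [|_]; first lia).
  + by rewrite leq_add2r leq_mul2r HB ?orbT.
  + move=> s' [G1 G2 G3 G4 G5]; apply: ends_copy; first lia.
    split=> //= [y yd|].
      by rewrite /upd; case: eqP => [->|/eqP yx]; rewrite ?G4 ?G5.
    by rewrite /upd; case: eqP => [|_]; [lia | rewrite G2].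
Qed.

(** * Polynomial bounds *)

(** The base [B.+1] is positive, so its powers increase with the exponent and two bounds can be
    brought to a common one. *)
Definition polybounded (f : nat -> nat) : Prop :=
  exists a b, forall B, f B <= a * B.+1 ^ b.

Lemma polybounded_const c : polybounded (fun=> c).
Proof. by exists c, 0 => B; rewrite muln1. Qed.

Lemma polybounded_id : polybounded id.
Proof. by exists 1, 1 => B; rewrite mul1n expn1. Qed.

Lemma polybounded_add f g :
  polybounded f -> polybounded g -> polybounded (fun B => f B + g B).
Proof.
move=> [a [b Hf]] [a' [b' Hg]]; exists (a + a'), (b + b') => B; rewrite mulnDl.
apply: leq_add; [apply: leq_trans (Hf B) _ | apply: leq_trans (Hg B) _];
  by rewrite leq_mul2l leq_pexp2l ?leq_addr ?leq_addl ?orbT.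
Qed.

Lemma polybounded_mul f g :
  polybounded f -> polybounded g -> polybounded (fun B => f B * g B).
Proof.
move=> [a [b Hf]] [a' [b' Hg]]; exists (a * a'), (b + b') => B.
by rewrite expnD mulnACA; apply: leq_mul.
Qed.

(** The factor [a'.+1] absorbs the successor in [(g B).+1], because a power of [B.+1] is at least
    [1]. *)
Lemma polybounded_comp f g :
  polybounded f -> polybounded g -> polybounded (fun B => f (g B)).
Proof.
move=> [a [b Hf]] [a' [b' Hg]]; exists (a * a'.+1 ^ b), (b' * b) => B.
apply: leq_trans (Hf _) _; rewrite -mulnA leq_mul2l expnM -expnMn.
case: b {Hf} => [|b]; first by rewrite !expn0 leqnn orbT.
rewrite leq_exp2r // mulSn; apply/orP; right; rewrite -addn1 addnC.
by apply: leq_add; rewrite ?expn_gt0.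
Qed.

Lemma polybounded_le f g : (forall B, f B <= g B) -> polybounded g -> polybounded f.
Proof. by move=> H [a [b Hg]]; exists a, b => B; apply: leq_trans (Hg B). Qed.

Lemma polybounded_succ f : polybounded f -> polybounded (fun B => (f B).+1).
Proof.
move=> Hf; apply: polybounded_le (polybounded_add Hf (polybounded_const 1)) => B.
by rewrite addn1.
Qed.

Ltac polybound := repeat first
  [ exact: polybounded_const | exact: polybounded_id | assumption
  | apply: polybounded_add | apply: polybounded_mul | apply: polybounded_succ ].

Lemma polybounded_tbound a : polybounded (tbound a).
Proof. by elim: a => /= *; polybound. Qed.

Lemma polybounded_tcost a : polybounded (tcost a).
Proof.
elim: a => [x|a IH|a IHa b IHb|a IHa b IHb] /=; polybound; exact: polybounded_tbound.
Qed.

Lemma polybounded_fcost f : polybounded (fcost f).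
Proof.
elim: f => [a|a b|f IH|f IHf g IHg|x f IH] /=; polybound; exact: polybounded_tcost.
Qed.

Lemma ends_until_bound b c T N N' (I : nat -> store -> Prop) s Q :
  (forall k s, k <= N -> I k s -> test b s = (k == N)) ->
  (forall k s, k < N -> I k s -> ends c T s (I k.+1)) ->
  I 0 s -> N <= N' -> (forall s', I N s' -> Q s') ->
  ends (Until b c) (N' * T.+2 + 1) s Q.
Proof.
move=> H1 H2 H3 le HQ; apply: ends_weaken (ends_until H1 H2 H3) _ HQ.
by rewrite leq_add2r leq_mul2r le orbT.
Qed.

(* Register [2] holds the address that is being filled. *)
Definition env_at (D i : nat) : nat -> nat := upd (upd (fun=> 0) 1 D) 2 i.

(* [Z] extends the input [w] (followed by one blank) by defining its values on
   [size w < i < E + D] recursively through [phi]. *)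
Definition solution (phi : form) (top : term) (w : seq bool) (Z : nat -> bool) : Prop :=
  let D := (size w).+1 in
  let E := teval top (env_at D 0) in
  (forall i, i < D -> Z i = nth false w i) /\
  (forall i, D <= i < E + D -> Z i = eval phi (env_at D i) (fun j => (j < i) && Z j)).

(** * The program that solves a recursion *)

Section MainProgram.
Variables (v : nat) (phi : form) (top : term).
Hypotheses (v2 : 2 < v) (phi_wf : fwf v phi) (top_wf : twf 2 top).

(** The first blank has the length of the input as its address; one more increment gives [D]. *)
Definition seek : cmd := Seq (Until (CMem 1 None) (Inc 1)) (Inc 1).

(** Register [v] holds the end of the range. It lies above the variables of [phi] and below the
    scratch registers, which start at [v.+1]. *)
Definition fill : cmd :=
  Until (CEq 2 v)
    (Seq (cform phi v.+1)
      (Seq (If (CEq v.+1 0) (Write 2 false) (Write 2 true)) (Inc 2))).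

(** The output is read from cell [0] on, so the [D] result cells that start at [E] are copied over
    the input. *)
Definition deliver : cmd :=
  Until (CEq 2 1)
    (Seq (cterm (Plus top (Var 2)) v.+1)
      (Seq (If (CMem v.+1 (Some true)) (Write 2 true) (Write 2 false)) (Inc 2))).

Definition body : cmd :=
  Seq seek (Seq (cterm (Plus top (Var 1)) v) (Seq (Copy 2 1) (Seq fill
    (Seq (Copy 2 0) deliver)))).

(* A register mark on an output cell would spoil the unary output. *)
Definition park (l : seq nat) : cmd :=
  foldr (fun x c => Seq (if x == 1 then Skip else Copy x 1) c) Skip l.

Lemma ends_park l s :
  ends (park l) (size l) s
    (fun s' => s'.2 = s.2 /\ forall x, s'.1 x = if x \in l then s.1 1 else s.1 x).
Proof.
elim: l s => [|x l IH] s /=; first by apply: ends_skip.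
rewrite -(add1n (size l)); apply: ends_seq; case: eqP => [->|/eqP x1].
  apply: ends_skip; apply: ends_weaken (IH s) (leqnn _) _ => s' [E2 E1]; split=> // y.
  by rewrite E1 inE; case: eqP => [->|_] //=; case: ifP.
apply: ends_copy => //; apply: ends_weaken (IH _) (leqnn _) _ => s' [E2 E1]; split=> // y.
rewrite E1 inE /= /upd eq_sym (negbTE x1).
by case: (y =P x) => //= _; case: ifP.
Qed.

Lemma ends_seek w Q :
  (forall s, s.2 = (init_store w).2 -> s.1 1 = (size w).+1 ->
     (forall x, x != 1 -> s.1 x = 0) -> Q s) ->
  ends seek ((size w * 3 + 1) + 1) (init_store w) Q.
Proof.
move=> HQ; apply: ends_seq.
pose I k (s : store) :=
  [/\ s.2 = (init_store w).2, s.1 1 = k & forall x, x != 1 -> s.1 x = 0].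
apply: (ends_until_bound (T := 1) (N := size w) (I := I)) => //.
- move=> k s le [E2 E1 E0]; rewrite /= E2 E1 /=.
  move: le; rewrite leq_eqVlt => /predU1P[->|lt].
    by rewrite nth_default ?size_map // !eqxx.
  by rewrite (nth_map false) // ltn_eqF.
- move=> k s lt [E2 E1 E0]; apply: ends_inc; split=> //=; rewrite ?updE ?E1 //.
  by move=> x x1; rewrite /upd (negbTE x1) E0.
- move=> s [E2 E1 E0]; apply: ends_inc; apply: HQ => //=; rewrite ?updE ?E1 //.
  by move=> x x1; rewrite /upd (negbTE x1) E0.
Qed.

Section Run.
Variable w : seq bool.
Let D := (size w).+1.
Let E := teval top (env_at D 0).
Let B := tbound top D + D.

(* The memory after the first [k] rounds of [fill]. *)
Fixpoint stage (k : nat) : nat -> bool :=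
  match k with
  | 0 => nth false w
  | k.+1 => upd (stage k) (D + k) (eval phi (env_at D (D + k)) (stage k))
  end.

(** A cell [i >= D] is written only once, in round [i - D]. The truncated difference [i.+1 - D] is
    the first stage that contains its value, and it is [0] for the cells of the input. *)
Lemma stage_small k i : i < D + k -> stage k i = stage (i.+1 - D) i.
Proof.
elim: k => [|k IH] lt /=.
  by rewrite addn0 in lt; rewrite (_ : i.+1 - D = 0) //; lia.
case: (i =P D + k) => [->|ne].
  rewrite (_ : (D + k).+1 - D = k.+1); last lia.
  by rewrite /= !updE.
by rewrite {1}/upd; case: eqP => // _; apply: IH; lia.
Qed.

Lemma stage_large k i : D + k <= i -> stage k i = false.
Proof.
elim: k => [|k IH] le /=.
  by rewrite nth_default //; rewrite /D in le; lia.
by rewrite /upd; case: eqP => [|_]; [lia | apply: IH; lia].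
Qed.

Lemma env_at_top i : teval top (env_at D i) = E.
Proof.
by apply: (eq_teval top_wf) => x x2; rewrite /env_at /upd; case: eqP => // ?; lia.
Qed.

(** The formula for cell [i] is evaluated in stage [i - D]. At that moment all cells from [i] on are
    still false, so this stage is the final memory cut off below [i]. *)
Lemma stage_solution : solution phi top w (stage E).
Proof.
split=> [i iD|i].
  rewrite stage_small; last by rewrite -/D in iD; lia.
  by rewrite (_ : i.+1 - D = 0) //; rewrite -/D in iD; lia.
rewrite -/D -/E => /andP[Di iE].
rewrite stage_small; last lia.
rewrite (_ : i.+1 - D = (i - D).+1); last lia.
rewrite /= (_ : D + (i - D) = i); last lia.
rewrite updE; apply: (eq_eval _ phi_wf) => //; first lia.
move=> j; case: (ltnP j i) => ji /=; last by rewrite stage_large //; lia.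
by rewrite stage_small ?[RHS]stage_small //; lia.
Qed.

Definition body_cost (m : nat) : nat :=
  let D := m.+1 in let B := tbound top D + D in
  ((m * 3 + 1) + 1) + (tcost (Plus top (Var 1)) D + (1 +
   ((B * (fcost phi B + (3 + 1)).+2 + 1) +
    (1 + (D * (tcost (Plus top (Var 2)) D + (3 + 1)).+2 + 1))))).

Lemma E_bound : E <= tbound top D.
Proof.
apply: (teval_bound top_wf) => x x2.
by rewrite /env_at /upd; do 2!case: eqP => // _.
Qed.

Lemma ends_fill s Q :
  s.1 0 = 0 -> s.1 1 = D -> s.1 2 = D -> s.1 v = E + D ->
  (forall x, 2 < x < v -> s.1 x = 0) -> bits s.2 =1 nth false w ->
  (forall s', s'.1 0 = 0 -> s'.1 1 = D -> (forall x, 2 < x < v -> s'.1 x = 0) ->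
     bits s'.2 =1 stage E -> Q s') ->
  ends fill (B * (fcost phi B + (3 + 1)).+2 + 1) s Q.
Proof.
move=> s0 s1 s2 sv sx sm HQ.
pose I k (s' : store) := [/\ s'.1 v = E + D, s'.1 2 = D + k,
  forall x, x < v -> s'.1 x = env_at D (D + k) x & bits s'.2 =1 stage k].
apply: (ends_until_bound (T := fcost phi B + (3 + 1)) (N := E) (I := I)).
- move=> k s' le [Ev E2 Ex Em]; rewrite /= E2 Ev.
  by rewrite (addnC E) eqn_add2l.
- move=> k s' lt [Ev E2 Ex Em]; apply: ends_seq.
  have E0 : s'.1 0 = 0 by rewrite Ex //; lia.
  apply: ends_weaken (ends_form (d := v.+1) (B := B) phi_wf _ E0 _) (leqnn _) _.
  + by rewrite ltnW //= leqW.
  + move=> x xv; rewrite Ex // /env_at /upd /B.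
    by have := E_bound; case: eqP => _; [lia | case: eqP => _; lia].
  move=> s3 [F2 F1 Fd].
  have {}Fd : s3.1 v.+1 = eval phi (env_at D (D + k)) (stage k) :> nat.
    by rewrite Fd (eq_eval (mem' := stage k) (env' := env_at D (D + k)) _ phi_wf) // ltnW.
  have F0 : s3.1 0 = 0 by rewrite F1.
  have Fw b : eval phi (env_at D (D + k)) (stage k) = b ->
      ends (Inc 2) 1 (s3.1, upd s3.2 (s3.1 2) (Some b)) (I k.+1).
    move=> Eb; apply: ends_inc; split=> /=.
    * by rewrite /upd; case: eqP => [|_]; [lia | rewrite F1 ?Ev].
    * by rewrite updE F1 ?E2 ?addnS //; lia.
    * move=> x xv; rewrite /upd /env_at /upd; case: eqP => [_|/eqP x2].
        by rewrite F1 ?E2 ?addnS //; lia.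
      by rewrite F1 ?Ex // /env_at /upd ?(negbTE x2) //; lia.
    * move=> j; rewrite /bits /upd F1 ?E2; last lia.
      case: (j =P D + k) => _; first by rewrite -Eb; case: (eval _ _ _).
      by rewrite F2 -Em.
  apply: ends_seq; apply: ends_if; rewrite /= Fd F0 => Hb; apply: ends_write; apply: Fw.
    by case: (eval _ _ _) Hb.
  by case: (eval _ _ _) Hb.
- split; rewrite ?addn0 // => x xv; rewrite /env_at /upd.
  case: eqP => [->//|x2]; case: eqP => [->//|x1].
  by case: x xv x2 x1 => [|[|[|x]]] // xv _ _; apply: sx.
- by apply: leq_trans E_bound (leq_addr _ _).
- move=> s' [Ev E2 Ex Em]; apply: HQ => //.
  + by rewrite Ex //; lia.
  + by rewrite Ex //; lia.
  + move=> x /andP[x2 xv]; rewrite Ex // /env_at /upd.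
    by case: eqP => [|_]; [lia|case: eqP => [|_]; [lia|]].
Qed.

(** The condition [D <= E] keeps the cells that are overwritten apart from those that are still to
    be read. *)
Lemma ends_deliver s Q :
  D <= E -> s.1 0 = 0 -> s.1 1 = D -> s.1 2 = 0 ->
  (forall x, 2 < x < v -> s.1 x = 0) -> bits s.2 =1 stage E ->
  (forall s', s'.1 1 = D ->
     (forall i, i < D -> bits s'.2 i = stage E (E + i)) -> Q s') ->
  ends deliver (D * (tcost (Plus top (Var 2)) D + (3 + 1)).+2 + 1) s Q.
Proof.
move=> DE s0 s1 s2 sx sm HQ.
pose I k (s' : store) := [/\ s'.1 2 = k,
  forall x, x < v -> s'.1 x = env_at D k x &
  forall i, bits s'.2 i = if i < k then stage E (E + i) else stage E i].
apply: (ends_until_bound (T := tcost (Plus top (Var 2)) D + (3 + 1)) (N := D) (I := I)) => //.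
- by move=> k s' le [E2 Ex Em]; rewrite /= E2 Ex //; lia.
- move=> k s' lt [E2 Ex Em]; apply: ends_seq.
  have E0 : s'.1 0 = 0 by rewrite Ex //; lia.
  have wf : twf v (Plus top (Var 2)).
    rewrite /= v2 andbT; elim: (top) top_wf => //= [x x2|a IHa b IHb|a IHa b IHb].
    * exact: leq_trans x2 (ltnW v2).
    * by case/andP=> /IHa -> /IHb ->.
    * by case/andP=> /IHa -> /IHb ->.
  apply: ends_weaken (ends_term (d := v.+1) (B := D) wf _ E0 _) (leqnn _) _.
  + by rewrite leqW // andbT; lia.
  + move=> x xv; rewrite Ex // /env_at /upd.
    by case: eqP => _; [lia | case: eqP => _].
  move=> s3 [F2 F1 Fd].
  have {}Fd : s3.1 v.+1 = E + k.
    rewrite Fd (eq_teval (env' := env_at D k) wf) //=.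
    by rewrite env_at_top /env_at updE.
  have Fw b : stage E (E + k) = b ->
      ends (Inc 2) 1 (s3.1, upd s3.2 (s3.1 2) (Some b)) (I k.+1).
    move=> Eb; apply: ends_inc; split=> /=.
    * by rewrite updE F1 ?E2 //; lia.
    * move=> x xv; rewrite /upd /env_at /upd; case: eqP => [_|/eqP x2].
        by rewrite F1 ?E2 //; lia.
      by rewrite F1 ?Ex // /env_at /upd ?(negbTE x2) //; lia.
    * move=> j; rewrite /bits /upd F1 ?E2; last lia.
      case: (j =P k) => [->|ne]; first by rewrite ltnSn Eb; case: (b).
      by rewrite F2 -/(bits s'.2 j) Em ltnS [j <= k]leq_eqVlt; case: eqP.
  have Hm : bits s3.2 (E + k) = stage E (E + k).
    by rewrite F2 Em ltnNge (leq_trans (leq_trans (ltnW lt) DE) (leq_addr _ _)).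
  apply: ends_seq; apply: ends_if; rewrite /= Fd -/(bits s3.2 (E + k)) Hm => Hb;
    apply: ends_write; apply: Fw => //.
  exact: negbTE.
- split=> // x xv.
  rewrite /env_at /upd.
  case: eqP => [->//|x2]; case: eqP => [->//|x1].
  by case: x xv x2 x1 => [|[|[|x]]] // xv _ _; apply: sx.
- move=> s' [E2 Ex Em]; apply: HQ; first by rewrite Ex //; lia.
  by move=> i iD; rewrite Em iD.
Qed.

Lemma ends_body : D <= E ->
  ends body (body_cost (size w)) (init_store w)
    (fun s' => s'.1 1 = D /\ forall i, i < D -> bits s'.2 i = stage E (E + i)).
Proof.
move=> DE; apply: ends_seq; apply: ends_seek => s1 A2 A1 A0; rewrite -/D.
have wf : twf 2 (Plus top (Var 1)) by rewrite /= top_wf.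
apply: ends_seq; apply: ends_weaken (ends_term (d := v) (B := D) wf _ _ _) (leqnn _) _.
- by rewrite (ltnW v2).
- exact: A0.
- by move=> [|[|x]] // _; rewrite ?A1 // A0.
move=> s2 [F2 F1 Fd].
have {}Fd : s2.1 v = E + D.
  rewrite Fd /= A1 -/D; congr (_ + _); apply: (eq_teval top_wf).
  by move=> [|[|x]] // _; rewrite /env_at /upd /= ?A1 // A0.
apply: ends_seq; apply: ends_copy => //; apply: ends_seq.
apply: ends_fill => /=.
- by rewrite /upd /= F1 ?A0 //; lia.
- by rewrite /upd /= F1 ?A1 //; lia.
- by rewrite updE F1 ?A1 //; lia.
- by rewrite /upd; case: eqP => [|_]; [lia |].
- move=> x /andP[x2 xv]; rewrite /upd; case: eqP => [|_]; first lia.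
  by rewrite F1 ?A0 //; lia.
- move=> j; rewrite /bits F2 A2 /=.
  case: (ltnP j (size w)) => jw; last by rewrite !nth_default ?size_map.
  by rewrite (nth_map false) //; case: (nth _ _ _).
move=> s3 B0 B1 Bx Bm; apply: ends_seq; apply: ends_copy => //.
apply: ends_deliver => //=.
by move=> x Hx; rewrite /upd; case: eqP => [|_]; [lia | exact: Bx].
Qed.

End Run.
End MainProgram.

(** * From formulas to polynomial-time Turing machines *)

(** The set of registers enters the tape alphabet, so one number [K] must serve for inputs of all
    sizes. *)
Definition cmd_fits (c : cmd) : Prop := exists K, cmd_ok K c.

Lemma fits_seq c1 c2 : cmd_fits c1 -> cmd_fits c2 -> cmd_fits (Seq c1 c2).
Proof.
move=> [K1 H1] [K2 H2]; exists (maxn K1 K2) => /=.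
by rewrite (cmd_ok_mono (leq_maxl _ _) H1) (cmd_ok_mono (leq_maxr _ _) H2).
Qed.

Lemma cond_fits b : exists K, all (fun x => x < K) (cond_regs b).
Proof.
case: b => [x y|x a] /=; last by exists x.+1; rewrite ltnSn.
by exists (maxn x y).+1; rewrite !ltnS leq_maxl leq_maxr.
Qed.

Lemma fits_if b c1 c2 : cmd_fits c1 -> cmd_fits c2 -> cmd_fits (If b c1 c2).
Proof.
move=> H1 H2; have [K0 H0] := cond_fits b; have [K /= /andP[{}H1 {}H2]] := fits_seq H1 H2.
exists (maxn K0 K) => /=.
rewrite (cmd_ok_mono (leq_maxr _ _) H1) (cmd_ok_mono (leq_maxr _ _) H2) !andbT.
by apply: sub_all H0 => x xK; rewrite leq_max xK.
Qed.

Lemma fits_until b c : cmd_fits c -> cmd_fits (Until b c).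
Proof. by move=> H; have [K /= /and3P[H0 H1 _]] := fits_if b H H; exists K; rewrite /= H0. Qed.

Lemma fits_inc x : cmd_fits (Inc x).
Proof. by exists x.+1 => /=. Qed.

Lemma fits_write x a : cmd_fits (Write x a).
Proof. by exists x.+1 => /=. Qed.

Lemma fits_skip : cmd_fits Skip.
Proof. by exists 0. Qed.

Lemma fits_copy x y : x != y -> cmd_fits (Copy x y).
Proof. by move=> xy; exists (maxn x y).+1; rewrite /= !ltnS leq_maxl leq_maxr. Qed.

Ltac fits := repeat first
  [ assumption | exact: fits_inc | exact: fits_write | exact: fits_skip
  | apply: fits_seq | apply: fits_if | apply: fits_until | apply: fits_copy; lia ].

Lemma fits_cterm v a d : twf v a -> 0 < v <= d -> cmd_fits (cterm a d).
Proof.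
move=> + /andP[v0]; elim: a d => /= [x|a IH|a IHa b IHb|a IHa b IHb] d.
- by move=> xv vd; fits.
- by move=> wf vd; have := IH d wf vd => ?; fits.
- move=> /andP[wa wb] vd; have ? := IHa d wa vd; have ? := IHb d.+1 wb (leqW vd).
  by fits.
- move=> /andP[wa wb] vd; have ? := IHa d.+1 wa (leqW vd).
  by have ? := IHb d.+2 wb (leqW (leqW vd)); fits.
Qed.

Lemma fits_cform v f d : fwf v f -> 1 < v <= d -> cmd_fits (cform f d).
Proof.
move=> + /andP[v1]; elim: f d => /= [a|a b|f IH|f IHf g IHg|x f IH] d.
- move=> wf vd; have ? : cmd_fits (cterm a d.+1) by apply: fits_cterm wf _; lia.
  by fits.
- move=> /andP[wa wb] vd.
  have ? : cmd_fits (cterm a d.+1) by apply: fits_cterm wa _; lia.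
  have ? : cmd_fits (cterm b d.+2) by apply: fits_cterm wb _; lia.
  by fits.
- by move=> wf vd; have ? := IH d wf vd; fits.
- by move=> /andP[wf wg] vd; have ? := IHf d wf vd; have ? := IHg d wg vd; fits.
- by move=> /andP[x1 wf] vd; have ? := IH d.+2 wf (leqW (leqW vd)); fits.
Qed.

Lemma fits_body v phi top : 2 < v -> fwf v phi -> twf 2 top -> cmd_fits (body v phi top).
Proof.
move=> v2 wf wt; have ? : cmd_fits (cform phi v.+1) by apply: fits_cform wf _; lia.
have ? : cmd_fits (cterm (Plus top (Var 1)) v).
  by apply: (@fits_cterm 2); rewrite /= ?wt //; lia.
have ? : cmd_fits (cterm (Plus top (Var 2)) v.+1).
  apply: (@fits_cterm v); last lia.
  rewrite /= v2 andbT; elim: (top) wt => //= [x x2|a IHa b IHb|a IHa b IHb].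
  * exact: leq_trans x2 (ltnW v2).
  * by case/andP=> /IHa -> /IHb ->.
  * by case/andP=> /IHa -> /IHb ->.
by rewrite /body /seek /fill /deliver; fits.
Qed.

Lemma park_ok K l : 1 < K -> all (fun x => x < K) l -> cmd_ok K (park l).
Proof.
move=> K1; elim: l => //= x l IH /andP[xK /IH->]; rewrite andbT.
by case: eqP => //= /eqP x1; rewrite xK K1 x1.
Qed.

Definition adjacency n (e : rel 'I_n) : seq bool :=
  [seq e i j | i <- enum 'I_n, j <- enum 'I_n].

Lemma size_adjacency n (e : rel 'I_n) : size (adjacency e) = n * n.
Proof. by rewrite size_allpairs size_enum_ord. Qed.

Lemma nth_allpairs (S T U : Type) (f : S -> T -> U) s t x0 y0 z0 i j :
  i < size s -> j < size t ->
  nth z0 [seq f x y | x <- s, y <- t] (i * size t + j) = f (nth x0 s i) (nth y0 t j).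
Proof.
move=> + jt; elim: s i => // x s IH [|i] /= lt; rewrite nth_cat size_map.
  by rewrite mul0n add0n jt (nth_map y0).
by rewrite mulSn -addnA ltnNge leq_addr /= addKn IH.
Qed.

Lemma nth_adjacency n (e : rel 'I_n) (i j : 'I_n) :
  nth false (adjacency e) (i * n + j) = e i j.
Proof.
have := @nth_allpairs _ _ _ e (enum 'I_n) (enum 'I_n) i j false i j.
by rewrite !size_enum_ord !nth_ord_enum; apply.
Qed.

Lemma encodeE (M : TM) n (e : rel 'I_n) :
  encode M n e = [seq if b then sym1 M else sym0 M | b <- adjacency e].
Proof. by rewrite /encode /adjacency map_allpairs. Qed.

Lemma exec_mono (M : TM) t t' (cf cf' : config M) :
  exec t cf = Some cf' -> t <= t' -> exec t' cf = Some cf'.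
Proof.
elim: t t' cf => // t IH [//|t'] cf /=.
by case: (step cf) => // cf1 H le; apply: IH.
Qed.

Lemma polybounded_body_cost phi top : polybounded (body_cost phi top).
Proof.
have P1 : polybounded (fun m => m.+1) by exact: (polybounded_succ polybounded_id).
have P2 : polybounded (fun m => tbound top m.+1 + m.+1).
  exact: polybounded_add (polybounded_comp (polybounded_tbound _) P1) P1.
have P3 : polybounded (fun m => fcost phi (tbound top m.+1 + m.+1)).
  exact: polybounded_comp (polybounded_fcost phi) P2.
have P4 x : polybounded (fun m => tcost (Plus top (Var x)) m.+1).
  exact: polybounded_comp (polybounded_tcost _) P1.
have P5 := P4 1; have P6 := P4 2.
by rewrite /body_cost; cbv zeta; polybound.
Qed.

(** Quantifiers range below [D] and addresses below [E + D], both polynomial in the input, so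
    evaluating the formula at each address takes polynomial time. The program computes some
    solution; requiring [g] in unary from every solution separates the machine from the
    combinatorics. *)
Theorem formula_machine v phi top :
  2 < v -> fwf v phi -> twf 2 top ->
  exists (M : TM) (c k : nat), well_formed_TM M /\
    forall n (e : rel 'I_n) g,
      let D := (n * n).+1 in
      let E := teval top (env_at D 0) in
      D <= E -> g <= D ->
      (forall Z, solution phi top (adjacency e) Z -> forall i, i < D -> Z (E + i) = (i < g)) ->
      exists cf, exec (c * size (encode M n e) ^ k + c) (init (encode M n e)) = Some cf
        /\ output cf = g.
Proof.
move=> v2 wf wt; have [K0 ok0] := fits_body v2 wf wt.
(* Parking reads register [1], so there are at least two registers. *)
pose K := maxn K0 2; pose prog := Seq (body v phi top) (park (iota 0 K)).
have K2 : 1 < K by rewrite leq_max orbT.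
have ok : cmd_ok K prog.
  apply/andP; split; first exact: cmd_ok_mono (leq_maxl _ _) ok0.
  by apply: park_ok => //; apply/allP => x; rewrite mem_iota.
pose T m := body_cost phi top m + K.
have [a [b Hab]] : polybounded (fun m => T m * (4 * T m + 6) + 4).
  have := polybounded_body_cost phi top => ?.
  by rewrite /T; polybound.
pose M := machine K (code prog 0).
(* For [m > 0] one has [m.+1 ^ b <= 2 ^ b * m ^ b]; the summand [c] takes care of [m = 0]. *)
exists M, (a * 2 ^ b), b; split.
  by apply/and3P; split.
move=> n e g D E DE gD HZ.
have sz := size_adjacency e.
have DE' : (size (adjacency e)).+1 <= teval top (env_at (size (adjacency e)).+1 0).
  by rewrite sz.
have [t1 [s1 [R1 le1 [s1D s1m]]]] := ends_body v2 wf wt DE'.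
have [t2 [s2 [R2 le2 [s2m s2r]]]] := ends_park (iota 0 K) s1.
have {}s1m i : i < D -> (s2.2 i == Some true) = (i < g).
  move=> iD; rewrite s2m -/(bits s1.2 i) s1m sz // HZ //.
  by have := stage_solution v2 wf wt (adjacency e); rewrite sz.
have {}s2r x : x < K -> s2.1 x = D by move=> xK; rewrite s2r mem_iota xK s1D sz.
have [||||cf Hcf Hout] := @machine_runs K prog (adjacency e) _ s2 g _ ok (RSeq R1 R2) _ _ _.
- exact: ltnW.
- by move=> j jg; apply/eqP; rewrite s1m // (leq_trans jg gD).
- by move=> x xK; rewrite s2r.
(* If the answer fills all [D] cells, the registers parked on cell [D] end the output. *)
- move: gD; rewrite leq_eqVlt => /predU1P[->|lt].
    by right; exists 0; rewrite ?s2r // ltnW.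
  by left; apply/eqP; rewrite s1m // ltnn.
exists cf; split=> //; rewrite encodeE; apply: exec_mono Hcf _.
rewrite size_map sz; set m := n * n.
have leT : t1 + t2 <= T m.
  by apply: leq_add; [rewrite /m -sz | rewrite -(size_iota 0 K)].
apply: leq_trans (leq_trans _ (Hab m)) _.
  by rewrite leq_add2r leq_mul // leq_add2r leq_mul2l leT orbT.
case: m {leT} => [|m].
  by rewrite exp1n muln1 -[X in X <= _]muln1 (leq_trans _ (leq_addl _ _)) // leq_mul2l expn_gt0 orbT.
apply: leq_trans (leq_addr _ _); rewrite -mulnA -expnMn leq_mul2l; apply/orP; right.
by case: (b) => // b'; rewrite leq_exp2r //; lia.
Qed.
(** * Cographs and twins *)

(** In a simple graph the six adjacencies already force four distinct vertices. This leaves a purely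
    Boolean condition, suited to case analysis. *)
Definition P4_free (T : Type) (h : rel T) : Prop :=
  forall a b c d, ~~ [&& h a b, h b c, h c d, ~~ h a c, ~~ h b d & ~~ h a d].

Lemma P4_freeW (T : Type) (h : rel T) a b c d : P4_free h ->
  h a b -> h b c -> h c d -> h a c = false -> h b d = false -> h a d = false -> False.
Proof. by move=> P e1 e2 e3 e4 e5 e6; have := P a b c d; rewrite e1 e2 e3 e4 e5 e6. Qed.

Lemma P4_freeI (T : Type) (h : rel T) :
  (forall a b c d, h a b -> h b c -> h c d -> ~~ h a c -> ~~ h b d -> ~~ h a d -> False) ->
  P4_free h.
Proof.
move=> F a b c d; apply/negP => /and5P[ab bc cd ac /andP[bd ad]].
exact: F ab bc cd ac bd ad.
Qed.

Lemma cograph_P4_free (T : finType) (h : rel T) :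
  symmetric h -> irreflexive h -> cograph h -> P4_free h.
Proof.
move=> sy ir /forallP co; apply: P4_freeI => a b c d ab bc cd ac bd ad.
have /forallP/(_ b)/forallP/(_ c)/forallP/(_ d)/negP := co a; apply.
rewrite ab bc cd ac bd ad !andbT /= !inE !negb_or -!andbA.
apply/and5P; split.
- by apply: contraTneq ab => ->; rewrite ir.
- by apply: contraNneq ad => ->.
- by apply: contraNneq ac => ->; rewrite sy.
- by apply: contraTneq bc => ->; rewrite ir.
- by apply/and3P; split=> //; [apply: contraNneq ad => <- | apply: contraTneq cd => ->; rewrite ir].
Qed.

(* The Seidel switch of [e] with respect to the neighbourhood of [v]: it isolates [v]. *)
Definition isolate (T : Type) (e : rel T) (v : T) : rel T :=
  fun x y => e x y (+) e v x (+) e v y.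

Lemma isolate_sym (T : finType) (e : rel T) v : symmetric e -> symmetric (isolate e v).
Proof. by move=> sy x y; rewrite /isolate sy -!addbA (addbC (e v x)). Qed.

Lemma isolate_irr (T : finType) (e : rel T) v : irreflexive e -> irreflexive (isolate e v).
Proof. by move=> ir x; rewrite /isolate ir addFb addbb. Qed.

(* The sum of the three adjacencies within a triple is invariant under switching. *)
Lemma isolate_switch (T : finType) (e : rel T) S v :
  isolate (seidel_switch e S) v =2 isolate e v.
Proof.
move=> x y; rewrite /isolate /seidel_switch.
by case: (x \in S); case: (y \in S); case: (v \in S) => /=;
  case: (e x y); case: (e v x); case: (e v y).
Qed.

(* An induced [P4] of [isolate h v] and [v] span in [h] a member of the switching
   class of [C5]; all members of this class contain an induced [P4]. *)
Lemma isolate_P4_free (T : finType) (h : rel T) v :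
  symmetric h -> P4_free h -> P4_free (isolate h v).
Proof.
move=> sy P; apply: P4_freeI => a b c d; rewrite /isolate.
have := P4_freeW P; move: (sy a b) (sy b c) (sy c d) (sy a c) (sy b d) (sy a d).
move: (sy v a) (sy v b) (sy v c) (sy v d).
(* The adjacencies of [v] and the path in [isolate h v] determine [h] on the five vertices, so 16
   graphs survive; each contains one of the ten listed paths. *)
case va: (h v a); case vb: (h v b); case vc: (h v c); case vd: (h v d);
  case ab: (h a b); case bc: (h b c); case cd: (h c d);
  case ac: (h a c); case bd: (h b d); case ad: (h a d) => //=;
  move=> av bv cv dv ba cb dc ca db da F _ _ _ _ _ _;
  by [apply: (F a b c d) | apply: (F c b d v) | apply: (F b a c v) | apply: (F c d b v)
     | apply: (F a d v b) | apply: (F a c b d) | apply: (F b c a v) | apply: (F c v a d)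
     | apply: (F a v d b) | apply: (F c a v d)].
Qed.

(** [isolate e v] depends only on the switching class of [e], so it can be computed from [e] without
    knowing the set that makes it a cograph. *)
Lemma cameron_isolate (T : finType) (e : rel T) v :
  simple_graph e -> cameron e -> P4_free (isolate e v).
Proof.
move=> [sy ir] [S co]; have sy' : symmetric (seidel_switch e S).
  by move=> x y; rewrite /seidel_switch eq_sym sy.
have ir' : irreflexive (seidel_switch e S) by move=> x; rewrite /seidel_switch eqxx ir.
have := isolate_P4_free v sy' (cograph_P4_free sy' ir' co).
by move=> P a b c d; have := P a b c d; rewrite !isolate_switch.
Qed.

Section Twins.
Variable T : finType.
Implicit Types (h : rel T) (A B : {set T}).

(** For a simple graph: [h] ([b = false]) or its complement ([b = true]) is disconnected on [A]. *)
Definition homogeneous_split h A : Prop :=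
  exists B b, [/\ B \subset A, B != set0, A :\: B != set0
    & forall x y, x \in B -> y \in A :\: B -> h x y = b].

(** If [a] sees all of [A] or misses a whole component, this gives a split. Otherwise some component
    contains an edge [w' u'] of which [a] sees only [u'], and [a] sees a vertex [z] of another
    component; then [z], [a], [u'], [w'] is an induced path. *)
Lemma split_disconnected h A B a :
  symmetric h -> P4_free h -> a \notin A ->
  B \subset A -> B != set0 -> A :\: B != set0 ->
  (forall x y, x \in B -> y \in A :\: B -> h x y = false) ->
  homogeneous_split h (a |: A).
Proof.
move=> sy P aA BA B0 AB0 HB.
pose R := [rel x y | [&& x \in A, y \in A & h x y]].
have Rsy : connect_sym R by apply: sym_connect_sym => x y /=; rewrite sy andbCA.
pose comp x := [set y | connect R x y].
have comp_in x y : x \in A -> y \in comp x -> y \in A.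
  rewrite inE => xA /connectP[p]; elim: p x xA => [x xA _ -> //|z p IH x xA /=].
  by move=> /andP[/and3P[_ zA _]]; apply: IH.
have comp_out x y z : x \in A -> y \in comp x -> z \in A -> z \notin comp x -> h y z = false.
  move=> xA yx zA zx; apply/negP => yz; case/negP: zx; rewrite inE.
  have yA := comp_in x y xA yx; rewrite inE in yx; apply: connect_trans yx (connect1 _).
  by rewrite /= yA zA.
have comp_split x : x \in A -> (forall y, y \in comp x -> h a y = false) ->
    homogeneous_split h (a |: A).
  move=> xA Hx; exists (comp x), false; split.
  - by apply/subsetP => y yx; rewrite !inE (comp_in x) ?orbT.
  - by apply/set0Pn; exists x; rewrite inE connect0.
  - apply/set0Pn; exists a; rewrite in_setD in_setU1 eqxx andbT.
    by apply: contra aA; apply: comp_in.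
  - move=> y z yx; rewrite in_setD in_setU1 => /andP[zx /predU1P[->|zA]].
      by rewrite sy Hx.
    exact: comp_out zx.
have [/existsP[w /andP[wA aw]]|] := boolP [exists w in A, ~~ h a w]; last first.
  rewrite negb_exists => /forallP Ha; exists [set a], true; split.
  - by rewrite sub1set !inE eqxx.
  - by apply/set0Pn; exists a; rewrite inE.
  - have /set0Pn[x xB] := B0; apply/set0Pn; exists x.
    have xA := subsetP BA _ xB; rewrite !inE xA orbT andbT.
    by apply: contraNneq aA => <-.
  - move=> x y; rewrite !inE => /eqP-> /andP[/negbTE-> /= yA].
    by have := Ha y; rewrite yA /= negbK.
have [/existsP[u /andP[uw au]]|] := boolP [exists u in comp w, h a u]; last first.
  rewrite negb_exists => /forallP Hw; apply: (comp_split w) => // y yw.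
  by have := Hw y; rewrite yw /= => /negbTE.
(* A path from a non-neighbour to a neighbour of [a] crosses from one kind to the other along some
   edge. *)
have [w' [u' [w'w w'u' aw' au']]] : exists w' u',
    [/\ w' \in comp w, R w' u', ~~ h a w' & h a u'].
  move: uw; rewrite inE => /connectP[p].
  elim: p w {wA} aw => [|x p IH] w aw /=; first by move=> _ E; rewrite -E au in aw.
  move=> /andP[wx px Ep]; have [ax|ax] := boolP (h a x).
    by exists w, x; split=> //; rewrite inE connect0.
  have [w' [u' [H1 H2 H3 H4]]] := IH x ax px Ep.
  exists w', u'; split=> //; rewrite inE in H1; rewrite inE.
  by apply: (@connect_trans _ R x) => //; apply: connect1.
(* Components do not cross the given split, so there is a second component. *)
have comp_side x y (b : bool) : x \in A -> (x \in B) = b -> y \in comp x -> (y \in B) = b.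
  move=> xA; rewrite inE => xb /connectP[p].
  elim: p x xA xb => [x xA xb _ -> //|z p IH x xA xb /= /andP[/and3P[_ zA xz]]].
  apply: IH => //; case: b xb => xB.
    apply/negP => /negP zB; have := HB x z xB; rewrite in_setD zA zB xz.
    by move=> /(_ isT).
  apply/negP => zB; have := HB z x zB; rewrite in_setD xA xB sy xz.
  by move=> /(_ isT).
have [z0 z0A z0w] : exists2 z0, z0 \in A & z0 \notin comp w.
  have [wB|wB] := boolP (w \in B).
    have /set0Pn[z] := AB0; rewrite in_setD => /andP[zB zA]; exists z => //.
    by apply: contra zB => zw; rewrite (comp_side w z true).
  have /set0Pn[z zB] := B0; exists z; first exact: (subsetP BA).
  by apply/negP => zw; have := comp_side w z false wA (negbTE wB) zw; rewrite zB.
have [/existsP[z /andP[zz0 az]]|] := boolP [exists z in comp z0, h a z]; last first.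
  rewrite negb_exists => /forallP Hw; apply: (comp_split z0) => // y yw.
  by have := Hw y; rewrite yw /= => /negbTE.
have nz y : y \in comp w -> h z y = false.
  move=> yw; rewrite sy; apply: (comp_out w) => //; first exact: (comp_in z0).
  apply: contra z0w; rewrite !inE in zz0 * => wz.
  by apply: connect_trans wz _; rewrite Rsy.
have u'w : u' \in comp w.
  rewrite inE in w'w; rewrite inE; apply: (@connect_trans _ R w') => //.
  exact: connect1.
case: (P4_freeW P (a := z) (b := a) (c := u') (d := w')) => //; try exact: nz.
- by rewrite sy.
- by rewrite sy; case/and3P: w'u'.
- exact: negbTE.
Qed.

Definition co_rel h : rel T := fun x y => (x != y) && ~~ h x y.

(** The path on four vertices is self-complementary: [a], [b], [c], [d] in the complement is [b],
    [d], [a], [c] in [h]. *)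
Lemma co_rel_P4_free h : symmetric h -> irreflexive h -> P4_free h -> P4_free (co_rel h).
Proof.
move=> sy ir P; apply: P4_freeI => a b c d; rewrite /co_rel.
move=> /andP[ab hab] /andP[bc hbc] /andP[cd hcd]; rewrite !negb_and !negbK.
case: (a =P c) => [->|_ /= ac]; first by rewrite (negbTE cd) (negbTE hcd).
case: (b =P d) => [E|_ /= bd]; first by move=> _; rewrite -E (negbTE ab) (negbTE hab).
case: (a =P d) => [E|_ /= ad]; first by rewrite E sy (negbTE hcd) in ac.
apply: (P4_freeW P (a := b) (b := d) (c := a) (d := c)) => //.
- by rewrite sy.
- by rewrite sy; apply: negbTE.
- by rewrite sy; apply: negbTE.
- exact: negbTE.
Qed.

(** Seinsche's theorem, by induction on the size of [A]: remove a vertex [a], split the rest, and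
    reinsert [a]. If the rest splits as a join, the same argument is applied to the complement. *)
Lemma split_exists h A :
  symmetric h -> irreflexive h -> P4_free h -> 1 < #|A| -> homogeneous_split h A.
Proof.
elim: {A}_.+1 {-2}A (ltnSn #|A|) h => // n IH A lt h sy ir P A1.
have /card_gt0P[a aA] : 0 < #|A| by apply: ltnW.
have cA := cardsD1 a A; rewrite aA add1n in cA.
have EA : A = a |: (A :\ a) by rewrite setD1K.
have nA : a \notin A :\ a by rewrite setD11.
have [A2|] := ltnP 1 #|A :\ a|; last first.
  rewrite leq_eqVlt ltnS leqn0 => /orP[/cards1P[x Ex]|/eqP c0]; last by rewrite cA c0 in A1.
  exists [set a], (h a x); split.
  - by rewrite sub1set.
  - by apply/set0Pn; exists a; rewrite inE.
  - by rewrite Ex; apply/set0Pn; exists x; rewrite inE.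
  - by rewrite Ex => y z; rewrite !inE => /eqP-> /eqP->.
have [B [b [BA B0 AB0 HB]]] := IH (A :\ a) (leq_trans (eq_leq (esym cA)) lt) h sy ir P A2.
case: b HB => HB; last by rewrite EA; apply: split_disconnected HB.
have sy' : symmetric (co_rel h) by move=> x y; rewrite /co_rel eq_sym sy.
have [|C [c [CA C0 AC0 HC]]] := split_disconnected sy' (co_rel_P4_free sy ir P) nA BA B0 AB0.
  by move=> x y xB yA; rewrite /co_rel HB // andbF.
rewrite -EA in CA AC0 HC; exists C, (~~ c); split=> // x y xC yA.
have := HC x y xC yA; rewrite /co_rel; case: eqP => [E|_ /= <-]; last by rewrite negbK.
by move: yA; rewrite in_setD -E xC.
Qed.

(** Take a homogeneous split. Twins inside one part are twins in [A], because the other part does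
    not distinguish them; if both parts are single vertices, these two are twins. *)
Lemma twins_exist h A :
  symmetric h -> irreflexive h -> P4_free h -> 1 < #|A| ->
  exists x y, [/\ x \in A, y \in A, x != y
    & forall z, z \in A -> z != x -> z != y -> h x z = h y z].
Proof.
move=> sy ir P; elim: {A}_.+1 {-2}A (ltnSn #|A|) => // n IH A lt A1.
have [B [b [BA B0 AB0 HB]]] := split_exists sy ir P A1.
have AI : A :&: B = B by apply/setIidPr.
have cA := cardsID B A; rewrite AI in cA.
have cB : 0 < #|B| by rewrite card_gt0.
have cD : 0 < #|A :\: B| by rewrite card_gt0.
have inD x : x \in A :\: B -> x \in A by rewrite in_setD => /andP[].
have inB x : x \in B -> x \in A by apply: (subsetP BA).
have [B2|] := ltnP 1 #|B|.
  have [|x [y [xB yB xy H]]] := IH B _ B2; first by lia.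
  exists x, y; split; rewrite ?inB // => z zA zx zy.
  have [zB|zB] := boolP (z \in B); first exact: H.
  by rewrite !HB // in_setD zB.
have [D2 _|] := ltnP 1 #|A :\: B|.
  have [|x [y [xB yB xy H]]] := IH (A :\: B) _ D2; first by lia.
  exists x, y; split; rewrite ?inD // => z zA zx zy.
  have [zB|zB] := boolP (z \in B); last by apply: H => //; rewrite in_setD zB.
  by rewrite ![h _ z]sy !HB.
move=> D1 B1; have /cards1P[x Ex] : #|B| == 1 by lia.
have /cards1P[y Ey] : #|A :\: B| == 1 by lia.
have xB : x \in B by rewrite Ex set11.
have yD : y \in A :\: B by rewrite Ey set11.
exists x, y; split; [exact: inB | exact: inD | |].
  by apply: contraTneq yD => <-; rewrite in_setD xB.
move=> z zA zx zy; have [|] := boolP (z \in B); first by rewrite Ex inE (negbTE zx).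
move=> zB; have : z \in A :\: B by rewrite in_setD zB.
by rewrite Ey inE (negbTE zy).
Qed.

End Twins.
(** * First-fit colourings *)

Section FirstFit.
Variables (T : finType) (e : rel T).

Lemma greedy_coloring_grundy (c : T -> nat) :
  (forall x y, e x y -> c x != c y) ->
  (forall x i, i < c x -> exists2 y, e x y & c y = i) ->
  forall x, c x < grundy e.
Proof.
move=> pr gr x; pose m := \max_y c y.
have cm y : c y <= m by apply: leq_bigmax.
pose c' := [ffun y => inord (c y) : 'I_m.+1].
have vc' y : c' y = c y :> nat by rewrite ffunE inordK // ltnS.
have [z Ez] : exists z, c z = m.
  have [|z Ez] := @eq_bigmax _ c; last by exists z.
  by apply/card_gt0P; exists x.
have sur (i : 'I_m.+1) : exists y, c' y == i.
  have := ltn_ord i; rewrite ltnS leq_eqVlt => /predU1P[im|im].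
    by exists z; apply/eqP/val_inj; rewrite /= vc' Ez im.
  have [|y _ Ey] := gr z i; first by rewrite Ez.
  by exists y; apply/eqP/val_inj; rewrite /= vc' Ey.
have ff : first_fit e c'.
  apply/and3P; split.
  - by apply/forallP => i; apply/existsP; apply: sur.
  - apply/forallP => a; apply/forallP => b; apply/implyP => /pr.
    by apply: contra => /eqP E; rewrite -!vc' E.
  - apply/forallP => a; apply/forallP => i; apply/implyP; rewrite vc' => /gr[b ab cb].
    by apply/existsP; exists b; rewrite ab; apply/eqP/val_inj; rewrite /= vc'.
have mT : m.+1 < #|T|.+1.
  rewrite ltnS -{1}(card_ord m.+1) -(_ : #|[set c' y | y : T]| = #|'I_m.+1|).
    exact: leq_imset_card.
  apply: eq_card => i; rewrite inE; apply/imsetP.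
  by have [y /eqP E] := sur i; exists y.
apply: leq_ltn_trans (cm x) _.
apply: (@leq_bigmax_cond _ _ (fun k : 'I_#|T|.+1 => k : nat) (Ordinal mT)).
by apply/existsP; exists c'.
Qed.

Lemma lt_grundyP i : i < grundy e ->
  exists k (c : {ffun T -> 'I_k}), [/\ i < k, k <= #|T| & first_fit e c].
Proof.
move=> lt; have [/existsP[k /andP[/existsP[c Hc] ik]]|] := boolP
    [exists k : 'I_#|T|.+1, [exists c : {ffun T -> 'I_k}, first_fit e c] && (i < k)].
  by exists k, c; split=> //; rewrite -ltnS.
rewrite negb_exists => /forallP H; move: lt; rewrite ltnNge => /negP[].
apply/bigmax_leqP => k Hk; have := H k.
by rewrite Hk /= -leqNgt.
Qed.

Hypotheses (sy : symmetric e) (ir : irreflexive e).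

Definition dominated (C C' : seq T) : bool := all (fun x => has (e x) C) C'.

(* A colouring that extends the given classes and has the least possible sum of
   colours is first-fit. *)
Lemma partial_grundy (L : seq (seq T)) :
  (forall C, C \in L -> C != [::]) ->
  (forall C x y, C \in L -> x \in C -> y \in C -> ~~ e x y) ->
  pairwise dominated L -> size L <= grundy e.
Proof.
move=> ne ind dom; pose k := size L.
pose f x := find (fun C : seq T => x \in C) L.
have fk x : f x < k -> x \in nth [::] L (f x).
  by rewrite /f /k -has_find => /(nth_find [::]).
have dom' i j x : i < j -> j < k -> x \in nth [::] L j ->
    exists2 y, y \in nth [::] L i & e x y.
  move=> ij jk xj; have := pairwiseP [::] dom.
  move=> /(_ i j (ltn_trans ij jk) jk ij) /allP/(_ x xj) /hasP[y yi xy].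
  by exists y.
(* The classes are disjoint: a vertex in two of them would have a neighbour in the earlier one, and
   that class is independent. *)
have fE x j : j < k -> x \in nth [::] L j -> f x = j.
  move=> jk xj; apply/eqP; rewrite eqn_leq; apply/andP; split.
    rewrite leqNgt; apply/negP => lt.
    by have := before_find [::] lt; rewrite xj.
  rewrite leqNgt; apply/negP => lt.
  have xf := fk x (ltn_trans lt jk).
  have [y yf xy] := dom' _ _ _ lt jk xj.
  have := ind _ x y (mem_nth [::] (ltn_trans lt jk)) xf yf; rewrite xy //.
pose N := k + #|T|.
pose good (c : {ffun T -> 'I_N.+1}) :=
  [forall x, (f x < k) ==> (c x == f x :> nat)] && [forall x, forall y, e x y ==> (c x != c y)].
(* Vertices outside of the given classes get private colours from [k] on. *)
pose c0 := [ffun x => inord (if f x < k then f x else k + enum_rank x) : 'I_N.+1].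
have vc0 x : c0 x = (if f x < k then f x else k + enum_rank x) :> nat.
  rewrite ffunE inordK // ltnS /N; case: ltnP => [lt|_].
    exact: leq_trans (ltnW lt) (leq_addr _ _).
  by rewrite leq_add2l ltnW.
have g0 : good c0.
  apply/andP; split; apply/forallP => x; first by apply/implyP => lt; rewrite vc0 lt.
  apply/forallP => y; apply/implyP => xy; apply/eqP => /(f_equal val) /=.
  rewrite !vc0; case: ltnP => fx; case: ltnP => fy E; try by lia.
    have xf := fk x fx; have yf := fk y fy; rewrite -E in yf.
    by have := ind _ x y (mem_nth [::] fx) xf yf; rewrite xy.
  by move/addnI/val_inj/enum_rank_inj: E xy => ->; rewrite ir.
pose c := [arg min_(c' < c0 | good c') \sum_x (c' x : nat)].
have [gc minc] : good c /\ forall c', good c' -> \sum_x (c x : nat) <= \sum_x (c' x : nat).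
  by rewrite /c; case: arg_minnP.
have /andP[/forallP g1 /forallP g2] := gc.
have pr x y : e x y -> c x != c y by move=> xy; have /forallP/(_ y)/implyP := g2 x; apply.
have cf x : f x < k -> c x = f x :> nat by move=> lt; have /implyP/(_ lt)/eqP := g1 x.
have gr x i : i < c x -> exists2 y, e x y & c y = i :> nat.
  have [fx|fx] := ltnP (f x) k.
    rewrite cf // => lt; have [y yi xy] := dom' _ _ _ lt fx (fk x fx).
    have ik := ltn_trans lt fx.
    by exists y => //; rewrite cf (fE y i).
  move=> lt; have [/existsP[y /andP[xy /eqP cy]]|] := boolP [exists y, e x y && (c y == i :> nat)].
    by exists y.
  rewrite negb_exists => /forallP Hn.
  have iN : i < N.+1 by apply: ltn_trans lt (ltn_ord _).
  (* Recolouring [x] with the missing smaller colour [i] would keep the colouring good and lower the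
     sum. *)
  pose c' := [ffun y => if y == x then Ordinal iN else c y].
  have gc' : good c'.
    apply/andP; split; apply/forallP => y.
      rewrite ffunE; apply/implyP => fy; case: (y =P x) => [E|_]; last by apply/eqP; apply: cf.
      by move: fx; rewrite -E leqNgt fy.
    apply/forallP => z; apply/implyP => yz; rewrite !ffunE.
    case: (y =P x) => [E|_]; case: (z =P x) => [E'|_].
    - by rewrite E E' ir in yz.
    - apply/eqP => /(f_equal val) /= E2; have := Hn z.
      by rewrite -E yz -E2 eqxx.
    - apply/eqP => /(f_equal val) /= E2; have := Hn y.
      by rewrite -E' sy yz E2 eqxx.
    - exact: pr.
  have := minc c' gc'; rewrite (bigD1 x) //= [X in _ <= X](bigD1 x) //=.
  have -> : \sum_(y | y != x) c' y = \sum_(y | y != x) c y.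
    by apply: eq_bigr => y yx; rewrite ffunE (negbTE yx).
  by rewrite ffunE eqxx /= leq_add2r leqNgt lt.
case: (posnP k) => [k0|k0]; first by rewrite -/k k0.
have kk : k.-1 < k by rewrite prednK.
have := ne (nth [::] L k.-1) (mem_nth [::] kk).
case E: (nth [::] L k.-1) => [//|x C] _.
have xk : x \in nth [::] L k.-1 by rewrite E mem_head.
have := greedy_coloring_grundy (c := fun y => c y) pr gr x.
by rewrite cf (fE x k.-1) // prednK.
Qed.

End FirstFit.
(** * The dynamic programme *)

Section Tables.
Variables (T : finType) (e : rel T) (v : T).
Hypotheses (sy : symmetric e) (ir : irreflexive e).
Let H := isolate e v.

Lemma same_side x y : e v x = e v y -> e x y = H x y.
Proof. by move=> E; rewrite /H /isolate E -addbA addbb addbF. Qed.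

Lemma other_side x y : e v x = ~~ e v y -> e x y = ~~ H x y.
Proof. by move=> E; rewrite /H /isolate E; case: (e v y); case: (e x y). Qed.

Let Hsy : symmetric H := isolate_sym v sy.

Definition meets (a : T * T) (z : T) : bool := e z a.1 || e z a.2.

(* [X] and [Y] are future classes still waiting for a partner from outside of [M],
   [R] lists the finished classes: each vertex of a later class has a neighbour in
   every earlier one. *)
Definition packing (M : {set T}) (p q r : nat) : Prop :=
  exists (X Y : seq T) (R : seq (T * T)),
    [/\ [/\ size X = p, size Y = q & size R = r],
        [/\ {subset X <= M}, {subset Y <= M}
          & forall a, a \in R -> (a.1 \in M) && (a.2 \in M)],
        [/\ all (e v) X, all (fun y => ~~ e v y) Y
          & forall a, a \in R -> [&& e v a.1, ~~ e v a.2 & H a.1 a.2]],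
        pairwise H X /\ pairwise H Y &
        pairwise (fun a b => meets a b.1 && meets a b.2) R /\
        forall a z, a \in R -> (z \in X) || (z \in Y) -> meets a z].

Lemma packing0 M : packing M 0 0 0.
Proof. by exists [::], [::], [::]; do !split. Qed.

Lemma packing_vertex x : packing [set x] (e v x) (~~ e v x) 0.
Proof.
case E: (e v x).
  exists [:: x], [::], [::]; do !split=> //=; rewrite ?E // => y.
  by rewrite !inE.
exists [::], [:: x], [::]; do !split=> //=; rewrite ?E // => y.
by rewrite !inE.
Qed.

Lemma packing_sub M p q r p' q' :
  packing M p q r -> p' <= p -> q' <= q -> packing M p' q' r.
Proof.
move=> [X [Y [R [[sX sY sR] [iX iY iR] [aX aY aR] [pX pY] [pR mR]]]]] lp lq.
have mX x : x \in take p' X -> x \in X by apply: mem_take.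
have mY x : x \in take q' Y -> x \in Y by apply: mem_take.
exists (take p' X), (take q' Y), R; split; split=> //.
- by rewrite size_take_min sX; apply/minn_idPl.
- by rewrite size_take_min sY; apply/minn_idPl.
- by move=> x /mX/iX.
- by move=> y /mY/iY.
- by apply/allP => x /mX; apply: allP.
- by apply/allP => y /mY; apply: (allP aY).
- exact: subseq_pairwise (take_subseq _ _) pX.
- exact: subseq_pairwise (take_subseq _ _) pY.
- by move=> a z aR' /orP[/mX|/mY] zX; apply: mR; rewrite ?zX ?orbT.
Qed.

(* A vertex outside of the module of a finished class sees exactly one of its two vertices. *)
Lemma meets_outside (M N : {set T}) b a z :
  (forall x y, x \in M -> y \in N -> H x y = b) ->
  (a.1 \in M) && (a.2 \in M) -> [&& e v a.1, ~~ e v a.2 & H a.1 a.2] -> z \in N -> meets a z.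
Proof.
move=> HMN /andP[a1 a2] /and3P[va1 va2 _] zN; rewrite /meets.
have H1 := HMN _ _ a1 zN; have H2 := HMN _ _ a2 zN.
rewrite ![e z _]sy; case: (boolP (e v z)) => vz.
  rewrite (same_side (y := z) (x := a.1)) ?va1 ?vz // (other_side (x := a.2)) ?vz ?(negbTE va2) //.
  by rewrite H1 H2; case: (b).
rewrite (other_side (x := a.1)) ?va1 ?(negbTE vz) // (same_side (x := a.2)) ?(negbTE vz) ?(negbTE va2) //.
by rewrite H1 H2; case: (b).
Qed.

(** Vertices of different parts on one side are not adjacent, so [X] has to come from a single part,
    and so does [Y], independently. Finished classes of one part meet every vertex of the other, so
    the two lists are concatenated. *)
Lemma packing_union (M N : {set T}) p1 q1 r1 p2 q2 r2 p q :
  (forall x y, x \in M -> y \in N -> H x y = false) ->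
  packing M p1 q1 r1 -> packing N p2 q2 r2 ->
  p <= p1 \/ p <= p2 -> q <= q1 \/ q <= q2 -> packing (M :|: N) p q (r1 + r2).
Proof.
move=> HMN P1 P2 lp lq.
have HNM x y : x \in N -> y \in M -> H x y = false by move=> xN yM; rewrite Hsy HMN.
have [p1' [p2' [lp1 lp2 Ep]]] : exists p1' p2', [/\ p1' <= p1, p2' <= p2
    & (p1' = p /\ p2' = 0) \/ (p1' = 0 /\ p2' = p)].
  by case: lp => lp; [exists p, 0 | exists 0, p]; split; auto.
have [q1' [q2' [lq1 lq2 Eq]]] : exists q1' q2', [/\ q1' <= q1, q2' <= q2
    & (q1' = q /\ q2' = 0) \/ (q1' = 0 /\ q2' = q)].
  by case: lq => lq; [exists q, 0 | exists 0, q]; split; auto.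
have [X1 [Y1 [R1 [[sX1 sY1 sR1] [iX1 iY1 iR1] [aX1 aY1 aR1] [pX1 pY1] [pR1 mR1]]]]] :=
  packing_sub P1 lp1 lq1.
have [X2 [Y2 [R2 [[sX2 sY2 sR2] [iX2 iY2 iR2] [aX2 aY2 aR2] [pX2 pY2] [pR2 mR2]]]]] :=
  packing_sub P2 lp2 lq2.
exists (X1 ++ X2), (Y1 ++ Y2), (R1 ++ R2); split.
- rewrite !size_cat sX1 sX2 sY1 sY2 sR1 sR2; split=> //; lia.
- split=> [x|x|a]; rewrite mem_cat inE ?[_ \in M :|: N]inE.
  + by case/orP=> [/iX1->|/iX2->]; rewrite ?orbT.
  + by case/orP=> [/iY1->|/iY2->]; rewrite ?orbT.
  + by case/orP=> [/iR1/andP[-> ->]|/iR2/andP[-> ->]]; rewrite ?orbT.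
- split; rewrite ?all_cat ?aX1 ?aX2 ?aY1 ?aY2 // => a; rewrite mem_cat.
  by case/orP=> [/aR1|/aR2].
- rewrite !pairwise_cat pX1 pX2 pY1 pY2 !andbT; split.
    by case: Ep => -[E1 E2]; [rewrite (size0nil (etrans sX2 E2)) allrel0r |
       rewrite (size0nil (etrans sX1 E1)) allrel0l].
  by case: Eq => -[E1 E2]; [rewrite (size0nil (etrans sY2 E2)) allrel0r |
     rewrite (size0nil (etrans sY1 E1)) allrel0l].
- split.
    rewrite pairwise_cat pR1 pR2 !andbT; apply/allrelP => a b aR bR.
    have /andP[b1 b2] := iR2 _ bR.
    by rewrite !(meets_outside HMN (iR1 _ aR) (aR1 _ aR)).
  move=> a z; rewrite !mem_cat => /orP[aR|aR] zXY.
    have [z1|z1] := boolP ((z \in X1) || (z \in Y1)); first exact: mR1.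
    apply: (meets_outside HMN (iR1 _ aR) (aR1 _ aR)).
    by case/norP: z1 zXY => /negbTE-> /negbTE-> /= /orP[/iX2|/iY2].
  have [z1|z1] := boolP ((z \in X2) || (z \in Y2)); first exact: mR2.
  apply: (meets_outside HNM (iR2 _ aR) (aR2 _ aR)).
  by case/norP: z1 zXY => /negbTE-> /negbTE->; rewrite !orbF => /orP[/iX1|/iY1].
Qed.

Lemma mem_zip (X Y : seq T) (a : T * T) : a \in zip X Y -> (a.1 \in X) && (a.2 \in Y).
Proof.
elim: X Y => [|x X IH] [|y Y] //=; rewrite !inE => /predU1P[->|/IH/andP[-> ->]].
  by rewrite !eqxx.
by rewrite !orbT.
Qed.

Lemma pairwise_zip (h : rel T) (X Y : seq T) :
  pairwise h X -> pairwise h Y ->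
  pairwise (fun a b => h a.1 b.1 && h a.2 b.2) (zip X Y).
Proof.
elim: X Y => [|x X IH] [|y Y] //= /andP[hx pX] /andP[hy pY].
rewrite IH // andbT; apply/allP => a /mem_zip/andP[aX aY].
by rewrite /= (allP hx) ?(allP hy).
Qed.

(** Vertices of different parts are adjacent if they lie on one side and not adjacent otherwise. So
    [s] members of [X1] are paired with members of [Y2], and [t] members of [X2] with members of
    [Y1], each pair being independent. Any remaining waiting vertex sees the member of a new pair on
    its own side. *)
Lemma packing_join (M N : {set T}) p1 q1 r1 p2 q2 r2 s t p q :
  (forall x y, x \in M -> y \in N -> H x y = true) ->
  packing M p1 q1 r1 -> packing N p2 q2 r2 ->
  s <= p1 -> s <= q2 -> t <= q1 -> t <= p2 ->
  p + s + t = p1 + p2 -> q + s + t = q1 + q2 ->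
  packing (M :|: N) p q (r1 + r2 + s + t).
Proof.
move=> HMN P1 P2 sp sq tq tp Ep Eq.
have HNM x y : x \in N -> y \in M -> H x y = true by move=> xN yM; rewrite Hsy HMN.
have [X1 [Y1 [R1 [[sX1 sY1 sR1] [iX1 iY1 iR1] [aX1 aY1 aR1] [pX1 pY1] [pR1 mR1]]]]] := P1.
have [X2 [Y2 [R2 [[sX2 sY2 sR2] [iX2 iY2 iR2] [aX2 aY2 aR2] [pX2 pY2] [pR2 mR2]]]]] := P2.
pose A := zip (take s X1) (take s Y2); pose B := zip (take t X2) (take t Y1).
have memA a : a \in A -> (a.1 \in X1) && (a.2 \in Y2).
  by move=> /mem_zip/andP[/mem_take-> /mem_take->].
have memB a : a \in B -> (a.1 \in X2) && (a.2 \in Y1).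
  by move=> /mem_zip/andP[/mem_take-> /mem_take->].
have pwt (u : nat) (X : seq T) : pairwise H X -> pairwise H (take u X).
  exact: subseq_pairwise (take_subseq _ _).
have pwd (u : nat) (X : seq T) : pairwise H X -> pairwise H (drop u X).
  exact: subseq_pairwise (drop_subseq _ _).
have evX1 x : x \in X1 -> e v x by apply: allP.
have evX2 x : x \in X2 -> e v x by apply: allP.
have evY1 x : x \in Y1 -> e v x = false by move=> xY; apply: negbTE; apply: (allP aY1).
have evY2 x : x \in Y2 -> e v x = false by move=> xY; apply: negbTE; apply: (allP aY2).
have crossed (X Y : seq T) (x y : T) : {subset X <= M} -> {subset Y <= N} -> x \in X -> y \in Y -> H x y.
  by move=> XM YN xX yY; apply: HMN; [apply: XM | apply: YN].
have cutX (X : seq T) x u : pairwise H X -> x \in take u X -> forall y, y \in drop u X -> H x y.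
  move=> pX xX y yX; move: pX; rewrite -{1}(cat_take_drop u X) pairwise_cat.
  by move=> /andP[/allrelP Hr _]; apply: Hr.
have newA a z : a \in A -> (z \in drop s X1 ++ drop t X2) || (z \in drop t Y1 ++ drop s Y2) ->
    meets a z.
  move=> aA; have /andP[a1 a2] := memA _ aA; have /andP[t1 t2] := mem_zip aA.
  rewrite /meets !mem_cat ![e z _]sy -!orbA => /or4P[] zX.
  - by rewrite same_side ?(evX1 a.1) ?(evX1 z (mem_drop zX)) // (cutX X1 _ s).
  - rewrite same_side ?(evX1 a.1) ?(evX2 z (mem_drop zX)) //.
    by rewrite (crossed X1 X2) // (mem_drop zX).
  - rewrite (same_side (x := a.2)) ?(evY2 a.2) ?(evY1 z (mem_drop zX)) //.
    by rewrite Hsy (crossed Y1 Y2) ?orbT // (mem_drop zX).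
  - by rewrite (same_side (x := a.2)) ?(evY2 a.2) ?(evY2 z (mem_drop zX)) // (cutX Y2 _ s) ?orbT.
have newB a z : a \in B -> (z \in drop s X1 ++ drop t X2) || (z \in drop t Y1 ++ drop s Y2) ->
    meets a z.
  move=> aA; have /andP[a1 a2] := memB _ aA; have /andP[t1 t2] := mem_zip aA.
  rewrite /meets !mem_cat ![e z _]sy -!orbA => /or4P[] zX.
  - rewrite same_side ?(evX2 a.1) ?(evX1 z (mem_drop zX)) //.
    by rewrite Hsy (crossed X1 X2) // (mem_drop zX).
  - by rewrite same_side ?(evX2 a.1) ?(evX2 z (mem_drop zX)) // (cutX X2 _ t).
  - by rewrite (same_side (x := a.2)) ?(evY1 a.2) ?(evY1 z (mem_drop zX)) // (cutX Y1 _ t) ?orbT.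
  - rewrite (same_side (x := a.2)) ?(evY1 a.2) ?(evY2 z (mem_drop zX)) //.
    by rewrite (crossed Y1 Y2) ?orbT // (mem_drop zX).
have oldM a z : a \in R1 ->
    [|| z \in X1, z \in Y1 | z \in N] -> meets a z.
  move=> aR /or3P[zX|zX|zN]; [apply: mR1 | apply: mR1 |]; rewrite ?zX ?orbT //.
  exact: meets_outside HMN (iR1 _ aR) (aR1 _ aR) zN.
have oldN a z : a \in R2 ->
    [|| z \in X2, z \in Y2 | z \in M] -> meets a z.
  move=> aR /or3P[zX|zX|zN]; [apply: mR2 | apply: mR2 |]; rewrite ?zX ?orbT //.
  exact: meets_outside HNM (iR2 _ aR) (aR2 _ aR) zN.
exists (drop s X1 ++ drop t X2), (drop t Y1 ++ drop s Y2), (R1 ++ R2 ++ A ++ B); split.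
- rewrite !size_cat !size_drop !size_zip !size_take_min sX1 sX2 sY1 sY2 sR1 sR2.
  by split; lia.
- split=> [x|x|a]; rewrite !mem_cat !in_setU.
  + by case/orP=> /mem_drop => [/iX1->|/iX2->]; rewrite ?orbT.
  + by case/orP=> /mem_drop => [/iY1->|/iY2->]; rewrite ?orbT.
  + case/or4P=> [/iR1/andP[-> ->]|/iR2/andP[-> ->]|/memA/andP[/iX1-> /iY2->]|/memB/andP[/iX2-> /iY1->]];
      by rewrite ?orbT.
- split; rewrite ?all_cat.
  + by apply/andP; split; apply/allP => x /mem_drop; [apply: (allP aX1) | apply: (allP aX2)].
  + by apply/andP; split; apply/allP => x /mem_drop; [apply: (allP aY1) | apply: (allP aY2)].
  + move=> a; rewrite !mem_cat => /or4P[/aR1//|/aR2//|/memA/andP[a1 a2]|/memB/andP[a1 a2]].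
      by rewrite evX1 ?evY2 //= HMN ?iX1 ?iY2.
    by rewrite evX2 ?evY1 //= HNM ?iX2 ?iY1.
- rewrite !pairwise_cat !pwd //; split; rewrite !andbT; apply/allrelP => x y /mem_drop xX /mem_drop yY.
    exact: (crossed X1 X2).
  exact: (crossed Y1 Y2).
split; last first.
  move=> a z; rewrite mem_cat [a \in _ ++ _]mem_cat [a \in _ ++ _]mem_cat.
  case/or4P=> aR zXY; [apply: oldM | apply: oldN | exact: newA | exact: newB] => //;
    move: zXY; rewrite !mem_cat -!orbA => /or4P[] /mem_drop zX; rewrite ?zX ?orbT //.
  + by rewrite (iX2 _ zX) !orbT.
  + by rewrite (iY2 _ zX) !orbT.
  + by rewrite (iX1 _ zX) !orbT.
  + by rewrite (iY1 _ zX) !orbT.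
rewrite pairwise_cat pR1 pairwise_cat pR2 pairwise_cat /=; apply/andP; split.
  apply/allrelP => a b aR bR; move: bR; rewrite !mem_cat.
  case/or3P=> [/iR2/andP[b1 b2]|/memA/andP[b1 b2]|/memB/andP[b1 b2]].
  + by rewrite !oldM // ?b1 ?b2 ?orbT.
  + by rewrite !oldM // ?b1 ?(iY2 _ b2) ?orbT.
  + by rewrite !oldM // ?b2 ?(iX2 _ b1) ?orbT.
apply/andP; split.
  apply/allrelP => a b aR bR; move: bR; rewrite !mem_cat.
  case/orP=> [/memA/andP[b1 b2]|/memB/andP[b1 b2]].
  + by rewrite !oldN // ?b2 ?(iX1 _ b1) ?orbT.
  + by rewrite !oldN // ?b1 ?(iY1 _ b2) ?orbT.
apply/and3P; split.
- apply/allrelP => a b /memA/andP[a1 a2] /memB/andP[b1 b2].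
  have E1 : e b.1 a.1.
    by rewrite same_side ?(evX2 _ b1) ?(evX1 _ a1) // Hsy (crossed X1 X2).
  have E2 : e b.2 a.2.
    by rewrite same_side ?(evY1 _ b2) ?(evY2 _ a2) // (crossed Y1 Y2).
  by rewrite /meets E1 E2 orbT.
- have pz : pairwise _ A := pairwise_zip (pwt s _ pX1) (pwt s _ pY2).
  apply: sub_in_pairwise pz; last exact: (allss A).
  move=> a b aA bA /andP[h1 h2]; have /andP[a1 a2] := memA _ aA; have /andP[b1 b2] := memA _ bA.
  have E1 : e b.1 a.1 by rewrite sy same_side ?(evX1 _ a1) ?(evX1 _ b1).
  have E2 : e b.2 a.2 by rewrite sy same_side ?(evY2 _ a2) ?(evY2 _ b2).
  by rewrite /meets E1 E2 orbT.
- have pz : pairwise _ B := pairwise_zip (pwt t _ pX2) (pwt t _ pY1).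
  apply: sub_in_pairwise pz; last exact: (allss B).
  move=> a b aA bA /andP[h1 h2]; have /andP[a1 a2] := memB _ aA; have /andP[b1 b2] := memB _ bA.
  have E1 : e b.1 a.1 by rewrite sy same_side ?(evX2 _ a1) ?(evX2 _ b1).
  have E2 : e b.2 a.2 by rewrite sy same_side ?(evY1 _ a2) ?(evY1 _ b2).
  by rewrite /meets E1 E2 orbT.
Qed.

(** The class of [v] goes on top: [v] sees one vertex of each finished class and all of [X]. The
    members of [Y] are not adjacent to [v] and are left to the extension in [partial_grundy]. *)
Lemma packing_grundy p q r : packing setT p q r -> p + r < grundy e.
Proof.
move=> [X [Y [R [[sX sY sR] _ [aX _ aR] [pX _] [pR mR]]]]].
pose L := [seq [:: a.1; a.2] | a <- R] ++ [seq [:: x] | x <- X] ++ [:: [:: v]].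
have -> : p + r < grundy e = (size L <= grundy e).
  by rewrite /L !size_cat !size_map sX sR /= addn1 addnS addnC.
apply: partial_grundy => //.
- move=> C; rewrite !mem_cat inE => /or3P[/mapP[a _ ->]|/mapP[x _ ->]|/eqP->] //.
- move=> C x y; rewrite !mem_cat inE => /or3P[/mapP[a /aR/and3P[va1 va2 h] ->]|/mapP[z _ ->]|/eqP->].
  + have n12 : e a.1 a.2 = false by rewrite other_side ?va1 ?(negbTE va2) // h.
    by rewrite !inE => /orP[]/eqP-> /orP[]/eqP->; rewrite ?ir ?n12 // sy n12.
  + by rewrite !inE => /eqP-> /eqP->; rewrite ir.
  + by rewrite !inE => /eqP-> /eqP->; rewrite ir.
rewrite !pairwise_cat /= !andbT; apply/and4P; split.
- apply/allrelP => C C' /mapP[a aR' ->]; rewrite mem_cat inE.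
  case/orP=> [/mapP[x xX ->]|/eqP->]; rewrite /dominated /= !andbT !orbF.
    by have := mR a x aR'; rewrite xX; apply.
  by have /and3P[va1 _ _] := aR _ aR'; rewrite va1.
- rewrite pairwise_map; apply: sub_pairwise pR => a b /andP[m1 m2].
  by rewrite /dominated /= !orbF /meets in m1 m2 *; rewrite m1 m2.
- apply/allrelP => C C' /mapP[x xX ->]; rewrite inE => /eqP->.
  by rewrite /dominated /= !andbT orbF; apply: (allP aX).
- rewrite pairwise_map; apply: sub_in_pairwise pX; last exact: (allss X).
  move=> x y xX yX h; rewrite /dominated /= orbF andbT sy same_side //.
  by rewrite !(allP aX).
Qed.

(** * Counting the colours in a module *)

Section Counting.
Variables (k : nat) (c : {ffun T -> 'I_k}).
Hypothesis ff : first_fit e c.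

Lemma ff_proper x y : e x y -> c x != c y.
Proof. by case/and3P: ff => _ /forallP/(_ x)/forallP/(_ y)/implyP. Qed.

Lemma ff_greedy x i : i < c x -> exists2 y, e x y & c y = i :> nat.
Proof.
move=> lt; case/and3P: ff => _ _ /forallP/(_ x)/forallP.
move=> /(_ (Ordinal (ltn_trans lt (ltn_ord _))))/implyP/(_ lt)/existsP[y /andP[xy /eqP cy]].
by exists y; rewrite ?cy.
Qed.

Definition occurs (M : {set T}) (b : bool) (i : 'I_k) : bool :=
  [exists x in M, (e v x == b) && (c x == i)].

Definition only (M : {set T}) (b : bool) : nat :=
  \sum_(i < k) (occurs M b i && ~~ occurs M (~~ b) i).

Definition both (M : {set T}) : nat :=
  \sum_(i < k) (occurs M true i && occurs M false i).

Lemma occursP (M : {set T}) b i :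
  reflect (exists x, [/\ x \in M, e v x = b & c x = i]) (occurs M b i).
Proof.
apply: (iffP existsP) => [[x /and3P[xM /eqP xb /eqP xi]]|[x [xM xb xi]]]; exists x => //.
by rewrite xM xb xi !eqxx.
Qed.

Lemma occursU M N b i : occurs (M :|: N) b i = occurs M b i || occurs N b i.
Proof.
apply/occursP/orP => [[x [/setUP[xM|xN] xb xi]]|[/occursP|/occursP][x [xM xb xi]]].
- by left; apply/occursP; exists x.
- by right; apply/occursP; exists x.
- by exists x; rewrite inE xM.
- by exists x; rewrite inE xM orbT.
Qed.

Lemma only_le M b : only M b <= k.
Proof.
rewrite -[X in _ <= X]card_ord -sum1_card; apply: leq_sum => i _.
by case: (_ && _).
Qed.

Lemma both_le M : both M <= k.
Proof.
rewrite -[X in _ <= X]card_ord -sum1_card; apply: leq_sum => i _.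
by case: (_ && _).
Qed.

Lemma occurs_cross (M N : {set T}) b b' i :
  (forall x y, x \in M -> y \in N -> e v x = b -> e v y = b' -> e x y) ->
  ~~ (occurs M b i && occurs N b' i).
Proof.
move=> Hc; apply/negP => /andP[/occursP[x [xM xb xi]] /occursP[y [yN yb yi]]].
by have := ff_proper (Hc x y xM yN xb yb); rewrite xi yi eqxx.
Qed.

(** Vertices of different parts on opposite sides are adjacent. A two-sided colour of the union is
    therefore two-sided within one part and absent from the other. *)
Lemma both_union (M N : {set T}) :
  (forall x y, x \in M -> y \in N -> H x y = false) ->
  both (M :|: N) = both M + both N.
Proof.
move=> HMN; rewrite /both -big_split; apply: eq_bigr => i _ /=.
have C b : ~~ (occurs M b i && occurs N (~~ b) i).
  by apply: occurs_cross => x y xM yN xb yb; rewrite other_side ?HMN // xb yb negbK.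
have := C true; have := C false; rewrite !occursU.
by do 4!case: (occurs _ _ _).
Qed.

(* The vertex of largest colour on side [b] decides which of the two parts keeps
   all the colours that only occur on side [b]. *)
Lemma only_union (M N : {set T}) b :
  (forall x y, x \in M -> y \in N -> H x y = false) ->
  (forall x y z, x \in M :|: N -> y \in M :|: N -> z \notin M :|: N -> H x z = H y z) ->
  only (M :|: N) b <= only M b \/ only (M :|: N) b <= only N b.
Proof.
move=> HMN mod; set A := M :|: N.
have key (M' N' : {set T}) x : A = M' :|: N' -> (forall x y, x \in M' -> y \in N' -> H x y = false) ->
    x \in M' -> e v x = b -> (forall y, y \in A -> e v y = b -> c y <= c x) ->
    only A b <= only M' b.
  move=> EA HMN' xM xb mx; rewrite /only; apply: leq_sum => i _.
  case: (boolP (occurs A b i)) => //= /occursP[w [wA wb wi]].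
  case: (boolP (occurs A (~~ b) i)) => // nA.
  have nM : occurs M' (~~ b) i = false.
    by apply/negbTE; apply: contra nA => oM; rewrite EA occursU oM.
  rewrite nM andbT; suff -> : occurs M' b i by [].
  have := mx w wA wb; rewrite leq_eqVlt wi => /predU1P[E|lt].
    by apply/occursP; exists x; split=> //; apply: val_inj.
  (* The vertex [x] sees some [z] of colour [i]. Were [z] outside of [A], it would also see [w],
     which is on the side of [x] but shares the colour of [z]. So [z] lies in [A], on side [b], and
     being adjacent to [x] it lies in the part of [x]. *)
  have [z xz zi] := ff_greedy lt; have {}zi : c z = i by apply: val_inj.
  have zA : z \in A.
    apply/negPn/negP => zA; have xA : x \in A by rewrite EA inE xM.
    have : e w z.
      have := mod x w z xA wA zA; move: xz; rewrite /H /isolate xb wb.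
      by case: (e x z); case: (e w z); case: (b); case: (e v z).
    by move/ff_proper; rewrite wi zi eqxx.
  have zb : e v z = b.
    apply/eqP; apply: contraNT nA => zb; apply/occursP; exists z; split=> //.
    by case: (e v z) zb; case: (b).
  apply/occursP; exists z; split=> //.
  move: zA; rewrite EA inE => /orP[//|zN].
  by move: xz; rewrite same_side ?HMN' ?zb.
have [/existsP[x0 /andP[x0A /eqP x0b]]|] := boolP [exists x in A, e v x == b]; last first.
  rewrite negb_exists => /forallP Hn; left; rewrite /only big1 // => i _.
  case: (boolP (occurs A b i)) => // /occursP[x [xA xb _]].
  by have := Hn x; rewrite xA xb eqxx.
have P0 : (x0 \in A) && (e v x0 == b) by rewrite x0A x0b eqxx.
case: (@arg_maxnP _ x0 (fun x => (x \in A) && (e v x == b)) (fun x => c x : nat) P0).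
move=> x /andP[xA /eqP xb] mx.
have mx' y : y \in A -> e v y = b -> c y <= c x by move=> yA yb; apply: mx; rewrite yA yb eqxx.
have := xA; rewrite inE => /orP[xM|xN]; [left | right]; apply: (key _ _ x) => //.
  by rewrite setUC.
by move=> y z yN zM; rewrite Hsy HMN.
Qed.

(** Vertices of different parts on one side are adjacent, so no colour occurs on the same side of
    both parts. This leaves a Boolean identity for each colour. *)
Lemma counts_join (M N : {set T}) :
  (forall x y, x \in M -> y \in N -> H x y = true) ->
  exists s t,
    [/\ [/\ s <= only M true, s <= only N false, t <= only M false & t <= only N true],
        only (M :|: N) true + s + t = only M true + only N true,
        only (M :|: N) false + s + t = only M false + only N false &
        both (M :|: N) = both M + both N + s + t].
Proof.
move=> HMN.
pose f b (i : 'I_k) := [&& occurs M b i, ~~ occurs M (~~ b) i, occurs N (~~ b) i & ~~ occurs N b i].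
have C b i : ~~ (occurs M b i && occurs N b i).
  by apply: occurs_cross => x y xM yN xb yb; rewrite same_side ?HMN // xb yb.
exists (\sum_(i < k) f true i), (\sum_(i < k) f false i); split.
- by split; apply: leq_sum => i _; rewrite /f /=; do 4!case: (occurs _ _ _).
- rewrite /only -!big_split; apply: eq_bigr => i _ /=; rewrite /f /= !occursU.
  by have := C true i; have := C false i; do 4!case: (occurs _ _ _).
- rewrite /only -!big_split; apply: eq_bigr => i _ /=; rewrite /f /= !occursU.
  by have := C true i; have := C false i; do 4!case: (occurs _ _ _).
- rewrite /both -!big_split; apply: eq_bigr => i _ /=; rewrite /f /= !occursU.
  by have := C true i; have := C false i; do 4!case: (occurs _ _ _).
Qed.

Lemma counts_vertex x :
  [/\ only [set x] true = e v x, only [set x] false = ~~ e v x & both [set x] = 0].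
Proof.
have O b i : occurs [set x] b i = (e v x == b) && (c x == i).
  apply/occursP/andP => [[y [/set1P-> <- <-]]|[/eqP xb /eqP xi]]; first by rewrite !eqxx.
  by exists x; rewrite inE eqxx.
rewrite /only /both; split.
- rewrite (bigD1 (c x)) //= big1 => [|i ix]; rewrite !O; last by rewrite [c x == i]eq_sym (negbTE ix) !andbF.
  by rewrite eqxx; case: (e v x).
- rewrite (bigD1 (c x)) //= big1 => [|i ix]; rewrite !O; last by rewrite [c x == i]eq_sym (negbTE ix) !andbF.
  by rewrite eqxx; case: (e v x).
- by rewrite big1 // => i _; rewrite !O; case: (e v x); rewrite /= ?andbF.
Qed.

(** The sum counts the colours in the neighbourhood of [v], and [v] sees every colour below its
    own. *)
Lemma counts_top : c v = k.-1 :> nat -> k.-1 <= only setT true + both setT <= k.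
Proof.
move=> cv; have -> : only setT true + both setT = \sum_(i < k) occurs setT true i.
  rewrite /only /both -big_split; apply: eq_bigr => i _ /=.
  by do 2!case: (occurs _ _ _).
apply/andP; split; last first.
  by rewrite -[X in _ <= X]card_ord -sum1_card; apply: leq_sum => i _; case: (occurs _ _ _).
have k0 : 0 < k by apply: leq_ltn_trans (ltn_ord (c v)).
rewrite (bigD1 (c v)) //= (leq_trans _ (leq_addl _ _)) //.
have -> : k.-1 = \sum_(i < k | i != c v) 1.
  by have := cardC1 (c v); rewrite card_ord -sum1_card => <-; apply: eq_bigl => i; rewrite inE.
apply: leq_sum => i iv; have lt : i < c v.
  have : i <= c v by rewrite cv -ltnS prednK.
  by rewrite leq_eqVlt => /predU1P[/val_inj E|//]; rewrite E eqxx in iv.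
have [y vy yi] := ff_greedy lt.
by have -> : occurs setT true i by apply/occursP; exists y; split=> //; apply: val_inj.
Qed.

End Counting.

(** * Recursive rules for the tables *)

Section Rules.
Variable D : nat.
Hypothesis TD : #|T| < D.

Definition table := nat -> nat -> nat -> Prop.

(** The entry [(0, 0, 0)] belongs to the table of every current module; its presence later tells
    which vertices still represent a module. *)
Definition leaf_rule (x : T) : table := fun p q r =>
  r = 0 /\ ((p = 0 /\ q = 0) \/ (e v x /\ p = 1 /\ q = 0) \/ (~~ e v x /\ p = 0 /\ q = 1)).

Definition union_rule (t1 t2 : table) : table := fun p q r =>
  exists p1 q1 r1 p2 q2 r2,
    [/\ [/\ p1 < D, q1 < D, r1 < D, p2 < D & q2 < D /\ r2 < D],
        t1 p1 q1 r1, t2 p2 q2 r2, r = r1 + r2 &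
        (p <= p1 \/ p <= p2) /\ (q <= q1 \/ q <= q2)].

Definition join_rule (t1 t2 : table) : table := fun p q r =>
  exists p1 q1 r1 p2 q2 r2,
    [/\ [/\ p1 < D, q1 < D, r1 < D, p2 < D & q2 < D /\ r2 < D],
        t1 p1 q1 r1, t2 p2 q2 r2 & exists s t, [/\ s < D, t < D,
        [/\ s <= p1, s <= q2, t <= q1 & t <= p2],
        p + s + t = p1 + p2 /\ q + s + t = q1 + q2 & r = r1 + r2 + s + t]].

(** The table is squeezed between the counts of the first-fit colourings and the triples that
    packings realize; at the root both yield the same maximum. *)
Definition correct (M : {set T}) (t : table) : Prop :=
  [/\ t 0 0 0, forall p q r, p < D -> q < D -> r < D -> t p q r -> packing M p q r
    & forall k (c : {ffun T -> 'I_k}), k <= #|T| -> first_fit e c ->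
        t (only c M true) (only c M false) (both c M)].

Lemma correct_leaf x (t : table) :
  (forall p q r, p < D -> q < D -> r < D -> t p q r <-> leaf_rule x p q r) ->
  correct [set x] t.
Proof.
move=> Ht; have D0 : 0 < D by apply: leq_ltn_trans TD.
have D1 : 1 < D by apply: leq_ltn_trans TD; rewrite -(cards1 x) max_card.
split; first by apply/Ht => //; split=> //; left.
  move=> p q r pD qD rD /Ht -[] // -> [[-> ->]|[[vx [-> ->]]|[vx [-> ->]]]].
  - exact: packing0.
  - by have := packing_vertex x; rewrite vx.
  - by have := packing_vertex x; rewrite (negbTE vx).
move=> k c lk ff; have [-> -> ->] := counts_vertex c x.
apply/Ht => //; first by case: (e v x).
  by case: (e v x).
by split=> //; right; case: (e v x); [left | right].
Qed.

Lemma correct_union (M N : {set T}) (t1 t2 t : table) :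
  correct M t1 -> correct N t2 ->
  (forall x y, x \in M -> y \in N -> H x y = false) ->
  (forall x y z, x \in M :|: N -> y \in M :|: N -> z \notin M :|: N -> H x z = H y z) ->
  (forall p q r, p < D -> q < D -> r < D -> t p q r <-> union_rule t1 t2 p q r) ->
  correct (M :|: N) t.
Proof.
move=> [z1 s1 u1] [z2 s2 u2] HMN mod Ht; have D0 : 0 < D by apply: leq_ltn_trans TD.
split.
- by apply/Ht => //; exists 0, 0, 0, 0, 0, 0; do !split=> //; left.
- move=> p q r pD qD rD /Ht -[] // p1 [q1 [r1 [p2 [q2 [r2 [[b1 b2 b3 b4 [b5 b6]] h1 h2 -> [lp lq]]]]]]].
  by apply: packing_union lp lq; [exact: HMN | exact: s1 | exact: s2].
move=> k c lk ff; have bo M' b : only c M' b < D.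
  exact: leq_ltn_trans (leq_trans (only_le c M' b) lk) TD.
have bb M' : both c M' < D by exact: leq_ltn_trans (leq_trans (both_le c M') lk) TD.
apply/Ht => //.
exists (only c M true), (only c M false), (both c M),
  (only c N true), (only c N false), (both c N); split.
- by do !split.
- exact: u1.
- exact: u2.
- exact: both_union.
- by split; apply: only_union.
Qed.

Lemma correct_join (M N : {set T}) (t1 t2 t : table) :
  correct M t1 -> correct N t2 ->
  (forall x y, x \in M -> y \in N -> H x y = true) ->
  (forall p q r, p < D -> q < D -> r < D -> t p q r <-> join_rule t1 t2 p q r) ->
  correct (M :|: N) t.
Proof.
move=> [z1 s1 u1] [z2 s2 u2] HMN Ht; have D0 : 0 < D by apply: leq_ltn_trans TD.
split.
- apply/Ht => //; exists 0, 0, 0, 0, 0, 0; split=> //.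
  by exists 0, 0; split.
- move=> p q r pD qD rD /Ht -[] // p1 [q1 [r1 [p2 [q2 [r2 [[b1 b2 b3 b4 [b5 b6]] h1 h2]]]]]].
  move=> [s [t' [_ _ [l1 l2 l3 l4] [Ep Eq] ->]]].
  by apply: packing_join l1 l2 l3 l4 Ep Eq; [exact: HMN | exact: s1 | exact: s2].
move=> k c lk ff; have bo M' b : only c M' b < D.
  exact: leq_ltn_trans (leq_trans (only_le c M' b) lk) TD.
have bb M' : both c M' < D by exact: leq_ltn_trans (leq_trans (both_le c M') lk) TD.
apply/Ht => //; have [s [t' [[l1 l2 l3 l4] Ep Eq Er]]] := counts_join ff HMN.
exists (only c M true), (only c M false), (both c M),
  (only c N true), (only c N false), (both c N).
split; [by do !split | exact: u1 | exact: u2 |].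
exists s, t'; split=> //.
- exact: leq_ltn_trans l1 _.
- exact: leq_ltn_trans l3 _.
Qed.

End Rules.
End Tables.

(** * Merging twin modules *)

Section Merging.
Variables (n : nat) (e : rel 'I_n) (v : 'I_n) (D : nat).
Hypotheses (sy : symmetric e) (ir : irreflexive e) (P4 : P4_free (isolate e v)).
Hypothesis nD : n < D.
Let H := isolate e v.
Let Hsy : symmetric H := isolate_sym v sy.
Let TD : #|'I_n| < D. Proof. by rewrite card_ord. Qed.

Implicit Types (tau : 'I_n -> table).

Definition twins tau (x y : 'I_n) : Prop :=
  [/\ x < y, tau x 0 0 0, tau y 0 0 0
    & forall z : 'I_n, tau z 0 0 0 -> z <> x -> z <> y -> H x z = H y z].

(** Taking the pair with the least code makes the choice unique and expressible by a bounded
    formula. *)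
Definition selected tau (x y : 'I_n) : Prop :=
  twins tau x y /\ forall x' y' : 'I_n, twins tau x' y' -> x * n + y <= x' * n + y'.

(** The vertex [x] takes over the module of [y], whose table becomes empty. Once no twins are left,
    nothing changes. *)
Definition merged tau : 'I_n -> table := fun u p q r =>
  (exists x y, selected tau x y /\
     [\/ [/\ u <> x, u <> y & tau u p q r],
         [/\ u = x, ~ H x y & union_rule D (tau x) (tau y) p q r] |
         [/\ u = x, H x y & join_rule D (tau x) (tau y) p q r]])
  \/ ((~ exists x y, selected tau x y) /\ tau u p q r).

Definition fiber (rho : 'I_n -> 'I_n) (u : 'I_n) : {set 'I_n} := [set x | rho x == u].

(* [rho] maps a vertex to the representative of its module. *)
Definition modular tau (j : nat) : Prop :=
  exists rho : 'I_n -> 'I_n,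
    [/\ forall x, rho (rho x) = rho x,
        forall x y, rho x != rho y -> H x y = H (rho x) (rho y),
        forall u p q r, p < D -> q < D -> r < D -> tau u p q r -> rho u = u,
        forall u, rho u = u -> correct e v D (fiber rho u) (tau u)
      & #|[set u | rho u == u]| <= maxn 1 j].

Lemma modular_leaves tau :
  (forall u p q r, p < D -> q < D -> r < D -> tau u p q r <-> leaf_rule e v u p q r) ->
  modular tau n.
Proof.
move=> Ht; exists id; split=> // [u _|].
  have -> : fiber id u = [set u] by apply/setP => x; rewrite !inE.
  by apply: correct_leaf => //; apply: Ht.
by apply: leq_trans (max_card _) _; rewrite card_ord leq_max leqnn orbT.
Qed.

Lemma correct_ext (M : {set 'I_n}) (t t' : table) :
  (forall p q r, p < D -> q < D -> r < D -> t p q r <-> t' p q r) ->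
  correct e v D M t -> correct e v D M t'.
Proof.
move=> E [z s u]; have D0 : 0 < D by apply: leq_ltn_trans nD.
split; first exact/E.
  by move=> p q r pD qD rD /E h; apply: s => //; apply: h.
move=> k c lk ff; apply/E; last exact: u.
- exact: leq_ltn_trans (leq_trans (only_le e v c M true) lk) TD.
- exact: leq_ltn_trans (leq_trans (only_le e v c M false) lk) TD.
- exact: leq_ltn_trans (leq_trans (both_le e v c M) lk) TD.
Qed.

Lemma modular_ext tau tau' j :
  (forall u p q r, p < D -> q < D -> r < D -> tau u p q r <-> tau' u p q r) ->
  modular tau j -> modular tau' j.
Proof.
move=> E [rho [r1 r2 r3 r4 r5]]; exists rho; split=> //.
  by move=> u p q r pD qD rD /E h; apply: (r3 u p q r) => //; apply: h.
by move=> u /r4; apply: correct_ext => p q r pD qD rD; apply: E.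
Qed.

Lemma pair_code_inj (x y x' y' : 'I_n) : x * n + y = x' * n + y' -> x = x' /\ y = y'.
Proof.
move=> E; have n0 : 0 < n by apply: leq_ltn_trans (ltn_ord x).
have Ey : y = y' :> nat.
  by have := f_equal (modn^~ n) E; rewrite !modnMDl !modn_small.
split; apply: val_inj => //=; apply/eqP; rewrite -(eqn_pmul2r n0) -(eqn_add2r y) E Ey //.
Qed.

(** The representatives induce a graph without induced [P4], so there are twins among them as long
    as two are left. Twins agree on all other representatives, hence the union of their fibers is
    again a module. *)
Lemma modular_merged tau j : modular tau j -> modular (merged tau) j.-1.
Proof.
move=> [rho [r1 r2 r3 r4 r5]].
have D0 : 0 < D by apply: leq_ltn_trans nD.
have alive u : tau u 0 0 0 <-> rho u = u.
  by split=> [/r3|/r4[]] //; apply.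
pose roots := [set u | rho u == u].
pose tw (a : 'I_n * 'I_n) := [&& a.1 < a.2, rho a.1 == a.1, rho a.2 == a.2
  & [forall z, (rho z == z) ==> (z != a.1) ==> (z != a.2) ==> (H a.1 z == H a.2 z)]].
have twP x y : reflect (twins tau x y) (tw (x, y)).
  apply: (iffP and4P) => /= -[lt].
    move=> /eqP/alive ax /eqP/alive ay /forallP Hz; split=> // z /alive/eqP az /eqP zx /eqP zy.
    by have := Hz z; rewrite az zx zy => /eqP.
  move=> /alive/eqP ax /alive/eqP ay Hz; split=> //; apply/forallP => z.
  apply/implyP => /eqP/alive az; apply/implyP => /eqP zx; apply/implyP => /eqP zy.
  by apply/eqP; apply: Hz.
case: (pickP tw) => [a0 Ha0|no]; last first.
  have no' : ~ exists x y, selected tau x y.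
    by move=> [x [y [/twP]]]; rewrite no.
  have c1 : #|roots| <= 1.
    rewrite leqNgt; apply/negP => c2.
    have [x [y [xR yR xy Hxy]]] := twins_exist Hsy (isolate_irr v ir) P4 c2.
    rewrite !inE in xR yR.
    have Hz z : rho z == z -> z != x -> z != y -> H x z = H y z.
      by move=> zR; apply: Hxy; rewrite inE.
    move: xy; rewrite neq_ltn => /orP[lt|lt].
      have := no (x, y); rewrite /tw /= lt xR yR /= => /negP[]; apply/forallP => z.
      by do 3!(apply/implyP => ?); apply/eqP; apply: Hz.
    have := no (y, x); rewrite /tw /= lt xR yR /= => /negP[]; apply/forallP => z.
    by do 3!(apply/implyP => ?); rewrite eq_sym; apply/eqP; apply: Hz.
  apply: (@modular_ext tau).
    move=> u p q r _ _ _; split=> [h|]; first by right.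
    by case=> [[x [y [s _]]]|[]//]; case: no'; exists x, y.
  by exists rho; split=> //; apply: leq_trans c1 (leq_maxl _ _).
case: (@arg_minnP _ a0 tw (fun a => a.1 * n + a.2) Ha0) => -[x y] /= twxy minxy.
have sel : selected tau x y.
  by split; [exact/twP | move=> x' y' /twP/minxy].
have selU x' y' : selected tau x' y' -> x' = x /\ y' = y.
  move=> [t1 m1]; apply: pair_code_inj; apply/eqP; rewrite eqn_leq.
  by rewrite (m1 _ _ sel.1) (sel.2 _ _ t1).
have /and4P[/= xy /eqP rx /eqP ry /forallP Hz] := twxy.
have yx : y != x by rewrite neq_ltn xy orbT.
have {}Hz z : rho z = z -> z != x -> z != y -> H x z = H y z.
  by move=> /eqP rz zx zy; have := Hz z; rewrite rz zx zy => /eqP.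
have mergedE u p q r : merged tau u p q r <->
     [\/ [/\ u <> x, u <> y & tau u p q r],
         [/\ u = x, ~ H x y & union_rule D (tau x) (tau y) p q r] |
         [/\ u = x, H x y & join_rule D (tau x) (tau y) p q r]].
  split=> [|h]; last by left; exists x, y.
  case=> [[x1 [y1 [s1 h]]]|[no _]]; last by case: no; exists x, y.
  by have [E1 E2] := selU _ _ s1; rewrite E1 E2 in h.
pose rho' z := if rho z == y then x else rho z.
have rho'x : rho' x = x by rewrite /rho' rx eq_sym (negbTE yx).
(* A vertex that moves from the fiber of [y] to that of [x] keeps its adjacencies to the other
   fibers, since [x] and [y] are twins. *)
have mod' a b : rho' a != rho' b -> H a b = H (rho' a) (rho' b).
  rewrite /rho'; case: (eqVneq (rho a) y) => ay; case: (eqVneq (rho b) y) => yb.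
  - by rewrite eqxx.
  - rewrite eq_sym => bx; rewrite (Hz (rho b) (r1 b) bx yb) -ay.
    by apply: r2; rewrite ay eq_sym.
  - move=> ax; rewrite [RHS]Hsy (Hz (rho a) (r1 a) ax ay) -yb Hsy.
    by apply: r2; rewrite yb eq_sym.
  - exact: r2.
have fib u : u <> x -> u <> y -> fiber rho' u = fiber rho u.
  move=> /eqP ux /eqP uy; apply/setP => z; rewrite !inE /rho'.
  case: (rho z =P y) => [->|//]; by rewrite eq_sym (negbTE ux) eq_sym (negbTE uy).
have fibx : fiber rho' x = fiber rho x :|: fiber rho y.
  apply/setP => z; rewrite !inE /rho'; case: (rho z =P y) => [->|/eqP zy].
    by rewrite !eqxx orbT.
  by rewrite orbF.
have cross a b : a \in fiber rho x -> b \in fiber rho y -> H a b = H x y.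
  rewrite !inE => /eqP ax /eqP by_; rewrite r2 ax by_ //.
  by rewrite eq_sym.
exists rho'; split=> //.
- move=> z; rewrite {2 3}/rho'; case: (rho z =P y) => // zy.
  by rewrite /rho' r1; case: eqP zy.
- move=> u p q r pD qD rD /mergedE[[ux uy /r3 ru]|[-> _ _]|[-> _ _]] //.
  by rewrite /rho' ru //; case: eqP.
- move=> u ru; case: (u =P x) => [->|ux].
    rewrite fibx; case: (boolP (H x y)) => Hxy.
      apply: (correct_join sy TD (r4 _ rx) (r4 _ ry)).
        by move=> a b ax by_; rewrite -/H cross.
      move=> p q r _ _ _; rewrite mergedE; split.
        by case=> [[]|[]|[]].
      by move=> h; apply: Or33.
    apply: (correct_union sy TD (r4 _ rx) (r4 _ ry)).
    + by move=> a b ax by_; rewrite -/H cross // (negbTE Hxy).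
    + move=> a b z; rewrite -fibx !inE => /eqP ax /eqP bx zx.
      have nzx : x != rho' z by rewrite eq_sym.
      by rewrite -/H (mod' a z) ?ax // (mod' b z) ?bx.
    + move=> p q r _ _ _; rewrite mergedE; split.
        by case=> [[]|[]|[]] //; rewrite (negbTE Hxy).
      by move=> h; apply: Or32; split=> //; apply/negP.
  have uy : u <> y.
    by move=> uy; move: ru; rewrite uy /rho' ry eqxx => E; rewrite E eqxx in yx.
  have ru' : rho u = u.
    by move: ru; rewrite /rho'; case: eqP => // _ E; case: ux.
  rewrite fib //; apply: correct_ext (r4 u ru') => p q r _ _ _; rewrite mergedE.
  by split=> [h|]; [apply: Or31 | case=> [[]|[]|[]]].
have sub : [set u | rho' u == u] \subset roots :\ y.
  apply/subsetP => u; rewrite !inE /rho'; case: (rho u =P y) => [uy /eqP xu|uy /eqP ru].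
    by move: uy; rewrite -xu rx => E; rewrite E eqxx in yx.
  by rewrite ru eqxx andbT; apply/eqP => E; case: uy; rewrite ru.
have := subset_leq_card sub; have := cardsD1 y roots.
have -> : y \in roots by rewrite inE ry.
move: r5; rewrite -/roots; set A := #|roots|; set B := #|roots :\ y|; set C := #|_| => r5.
by move: r5; rewrite /maxn; do 2!case: ifP; lia.
Qed.

Lemma modular_final tau : modular tau 1 ->
  exists2 u, correct e v D setT (tau u)
    & forall w p q r, p < D -> q < D -> r < D -> tau w p q r -> w = u.
Proof.
move=> [rho [r1 r2 r3 r4]]; rewrite maxnn => r5; pose u := rho v.
have uq w : rho w = w -> w = u.
  move=> rw; apply/eqP/negPn/negP => wu.
  have sb : [set w; u] \subset [set u | rho u == u].
    by apply/subsetP => z; rewrite !inE => /orP[]/eqP->; rewrite ?rw ?r1.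
  by have := leq_trans (subset_leq_card sb) r5; rewrite cards2 wu.
exists u; last by move=> w p q r pD qD rD /r3 h; apply/uq/h.
have -> : setT = fiber rho u by apply/setP => z; rewrite !inE [rho z]uq ?r1 ?eqxx.
by apply: r4; apply: r1.
Qed.

End Merging.

(** Quantifying over [v] amounts to guessing a vertex of largest colour. The slack [c] expresses
    [i <= p + r] by a bounded existential quantifier. *)
Lemma lt_grundy_tables n (e : rel 'I_n) D (root : 'I_n -> 'I_n) (tau : 'I_n -> 'I_n -> table) i :
  symmetric e -> irreflexive e -> n < D ->
  (forall v, correct e v D setT (tau v (root v))) ->
  i < grundy e <->
  exists v p q r c, [/\ p < D, q < D, r < D, c < D & tau v (root v) p q r /\ i + c = p + r].
Proof.
move=> sy ir nD ct; split; last first.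
  move=> [v [p [q [r [c [pD qD rD cD [tv E]]]]]]]; have [_ sound _] := ct v.
  have := packing_grundy sy ir (sound p q r pD qD rD tv); rewrite -E.
  by apply: leq_ltn_trans; rewrite leq_addr.
move=> /lt_grundyP[k [c [ik lk ff]]]; rewrite card_ord in lk.
have k0 : 0 < k by apply: leq_ltn_trans ik.
have kk : k.-1 < k by rewrite prednK.
(* The last class is nonempty and supplies [v]. *)
have /and3P[/forallP/(_ (Ordinal kk))/existsP[v /eqP cv] _ _] := ff.
have cv' : c v = k.-1 :> nat by rewrite cv.
have [_ _ cpl] := ct v.
have /andP[lo hi] := counts_top ff cv'.
exists v, (only e v c setT true), (only e v c setT false), (both e v c setT).
exists (only e v c setT true + both e v c setT - i); split.
- exact: leq_ltn_trans (leq_trans (only_le e v c setT true) lk) nD.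
- exact: leq_ltn_trans (leq_trans (only_le e v c setT false) lk) nD.
- exact: leq_ltn_trans (leq_trans (both_le e v c setT) lk) nD.
- by apply: leq_ltn_trans (leq_subr _ _) (leq_ltn_trans (leq_trans hi lk) nD).
split; first by apply: cpl; rewrite ?card_ord.
by rewrite subnKC //; apply: leq_trans lo; rewrite -ltnS prednK.
Qed.
(** * The dynamic programme as a formula *)

(* Variables: [1] the bound [D = n^2 + 1], [2] the current address, [3] the number [n]
   of vertices, [4] the time, [5] the isolated vertex [v], [6] the vertex [u] owning the
   table, [7]-[9] the entry [(p, q, r)], [10] the previous time, [11]-[15] vertices,
   [16] a slack, [17]-[24] the entries and the parameters [s], [t] of the rules,
   [30] the slack of inequalities. *)
Definition FOr f g := FNot (FAnd (FNot f) (FNot g)).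
Definition FImp f g := FNot (FAnd f (FNot g)).
Definition FXor f g := FOr (FAnd f (FNot g)) (FAnd (FNot f) g).
Definition FLe a b := FEx 30 (FEq (Plus a (Var 30)) b).
Definition ExV x f := FEx x (FAnd (FLe (Succ (Var x)) (Var 3)) f).
Definition AllV x f := FNot (ExV x (FNot f)).

(* Addresses are written in base [D]; the leading digit [1] keeps the tables clear of
   the input, and [cells = 2 D^6] is the first address after them. *)
Definition digit (a b : term) : term := Plus (Mult a (Var 1)) b.
Definition address t v u p q r : term :=
  digit (digit (digit (digit (digit (digit (Succ (Var 0)) t) v) u) p) q) r.
Definition addr (D t v u p q r : nat) : nat :=
  ((((((0.+1 * D + t) * D + v) * D + u) * D + p) * D + q) * D + r).
Definition cells : term :=
  Mult (Mult (Mult (Mult (Mult (Mult (Succ (Succ (Var 0))) (Var 1)) (Var 1)) (Var 1))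
    (Var 1)) (Var 1)) (Var 1).

Definition fEdge x y := FMem (Plus (Mult (Var x) (Var 3)) (Var y)).
Definition fIso x y := FXor (FXor (fEdge x y) (fEdge 5 x)) (fEdge 5 y).
(** Variable [10] selects the time at which the table is read. The arguments are variables, so in
    [fTab x 0 0 0] the zeros refer to variable [0], which holds zero. *)
Definition fTab x p q r := FMem (address (Var 10) (Var 5) (Var x) (Var p) (Var q) (Var r)).
Definition fEq x y := FEq (Var x) (Var y).

Definition fTwins x y :=
  FAnd (FLe (Succ (Var x)) (Var y)) (FAnd (fTab x 0 0 0) (FAnd (fTab y 0 0 0)
    (AllV 15 (FImp (fTab 15 0 0 0) (FImp (FNot (fEq 15 x)) (FImp (FNot (fEq 15 y))
       (FNot (FXor (fIso x 15) (fIso y 15))))))))).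

Definition fSelected :=
  FAnd (fTwins 11 12) (AllV 13 (AllV 14 (FImp (fTwins 13 14)
    (FLe (Plus (Mult (Var 11) (Var 3)) (Var 12)) (Plus (Mult (Var 13) (Var 3)) (Var 14)))))).

Definition fParts f :=
  FEx 17 (FEx 18 (FEx 19 (FEx 20 (FEx 21 (FEx 22
    (FAnd (fTab 11 17 18 19) (FAnd (fTab 12 20 21 22) f))))))).

Definition fUnion :=
  fParts (FAnd (FEq (Var 9) (Plus (Var 19) (Var 22)))
    (FAnd (FOr (FLe (Var 7) (Var 17)) (FLe (Var 7) (Var 20)))
          (FOr (FLe (Var 8) (Var 18)) (FLe (Var 8) (Var 21))))).

Definition fJoin :=
  fParts (FEx 23 (FEx 24
    (FAnd (FAnd (FAnd (FLe (Var 23) (Var 17)) (FLe (Var 23) (Var 21)))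
                (FAnd (FLe (Var 24) (Var 18)) (FLe (Var 24) (Var 20))))
    (FAnd (FAnd (FEq (Plus (Plus (Var 7) (Var 23)) (Var 24)) (Plus (Var 17) (Var 20)))
                (FEq (Plus (Plus (Var 8) (Var 23)) (Var 24)) (Plus (Var 18) (Var 21))))
          (FEq (Var 9) (Plus (Plus (Plus (Var 19) (Var 22)) (Var 23)) (Var 24))))))).

Definition fMerged :=
  FOr (ExV 11 (ExV 12 (FAnd fSelected
        (FOr (FAnd (FNot (fEq 6 11)) (FAnd (FNot (fEq 6 12)) (fTab 6 7 8 9)))
        (FOr (FAnd (fEq 6 11) (FAnd (FNot (fIso 11 12)) fUnion))
             (FAnd (fEq 6 11) (FAnd (fIso 11 12) fJoin)))))))
      (FAnd (FNot (ExV 11 (ExV 12 fSelected))) (fTab 6 7 8 9)).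

Definition fConst x (k : nat) := FEq (Var x) (iter k Succ (Var 0)).

Definition fLeaf :=
  FAnd (fConst 9 0)
    (FOr (FAnd (fConst 7 0) (fConst 8 0))
    (FOr (FAnd (fEdge 5 6) (FAnd (fConst 7 1) (fConst 8 0)))
         (FAnd (FNot (fEdge 5 6)) (FAnd (fConst 7 0) (fConst 8 1))))).

(** The formula is given only [D]; the number of vertices is recovered as the root of [D - 1]. *)
Definition fOrder f := FEx 3 (FAnd (FEq (Var 1) (Succ (Mult (Var 3) (Var 3)))) f).

(** The digits of the current address are guessed by the quantifiers and checked by evaluating the
    address. *)
Definition fCell :=
  fOrder (FEx 4 (ExV 5 (ExV 6 (FEx 7 (FEx 8 (FEx 9
    (FAnd (FEq (Var 2) (address (Var 4) (Var 5) (Var 6) (Var 7) (Var 8) (Var 9)))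
      (FOr (FAnd (fConst 4 0) fLeaf)
           (FEx 10 (FAnd (FEq (Var 4) (Succ (Var 10))) fMerged)))))))))).

(** Variable [4] now is the index of the output cell. The tables are read at time [n], when enough
    merging steps have been made to leave a single module. *)
Definition fOutput :=
  fOrder (FEx 4 (ExV 5 (ExV 6 (FEx 7 (FEx 8 (FEx 9 (FEx 16 (FEx 10
    (FAnd (FEq (Var 2) (Plus cells (Var 4)))
    (FAnd (fEq 10 3)
    (FAnd (fTab 6 7 8 9)
          (FEq (Plus (Var 4) (Var 16)) (Plus (Var 7) (Var 9)))))))))))))).

Definition fProgram := FOr fCell fOutput.

(** * Meaning of the formulas *)

Section Connectives.
Variables (env : nat -> nat) (mem : nat -> bool).

Lemma sat_or f g : sat (FOr f g) env mem <-> sat f env mem \/ sat g env mem.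
Proof. by rewrite /=; case: (satP f env mem); case: (satP g env mem); tauto. Qed.

Lemma sat_imp f g : sat (FImp f g) env mem <-> (sat f env mem -> sat g env mem).
Proof. by rewrite /=; case: (satP f env mem); case: (satP g env mem); tauto. Qed.

Lemma sat_xor f g (b c : bool) :
  (sat f env mem <-> b) -> (sat g env mem <-> c) -> (sat (FXor f g) env mem <-> b (+) c).
Proof.
move=> Hf Hg; rewrite sat_or /= Hf Hg.
by case: b {Hf}; case: c {Hg}; split=> //; intuition.
Qed.

(** The slack is at most the value of [b], hence within reach of the quantifier; variable [30] is
    kept out of both terms to avoid capture. *)
Lemma sat_le a b : twf 30 a -> twf 30 b -> teval b env < env 1 ->
  sat (FLe a b) env mem <-> teval a env <= teval b env.
Proof.
move=> wa wb lt.
have E (t : term) c : twf 30 t -> teval t (upd env 30 c) = teval t env.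
  by move=> wt; apply: (eq_teval wt) => x x30; rewrite /upd ltn_eqF.
split.
  by move=> [c _]; rewrite /= !E // => <-; rewrite leq_addr.
move=> le; exists (teval b env - teval a env); first by apply: leq_ltn_trans (leq_subr _ _) lt.
by rewrite /= !E // /upd eqxx subnKC.
Qed.

Lemma sat_not f : sat (FNot f) env mem <-> ~ sat f env mem.
Proof. by []. Qed.

Lemma sat_and f g : sat (FAnd f g) env mem <-> sat f env mem /\ sat g env mem.
Proof. by []. Qed.
End Connectives.

Lemma sat_exv env mem n x f : x < 30 -> x != 3 -> x != 1 -> env 3 = n -> n < env 1 ->
  sat (ExV x f) env mem <-> exists a : 'I_n, sat f (upd env x a) mem.
Proof.
move=> x30 x3 x1 En lt.
have E1 a : upd env x a 1 = env 1 by rewrite /upd eq_sym (negbTE x1).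
have E3 a : upd env x a 3 = n by rewrite /upd eq_sym (negbTE x3).
have L a : sat (FLe (Succ (Var x)) (Var 3)) (upd env x a) mem <-> a < n.
  by rewrite sat_le /= ?E3 ?E1 ?updE.
split.
  by move=> [a aD [/L an h]]; exists (Ordinal an).
move=> [a h]; exists (nat_of_ord a); first exact: ltn_trans (ltn_ord a) lt.
by split=> //; apply/L.
Qed.

Lemma sat_allv env mem n x f : x < 30 -> x != 3 -> x != 1 -> env 3 = n -> n < env 1 ->
  sat (AllV x f) env mem <-> forall a : 'I_n, sat f (upd env x a) mem.
Proof.
move=> x30 x3 x1 En lt; rewrite sat_not (sat_exv _ _ x30 x3 x1 En lt); split.
  by move=> H a; case: (satP f (upd env x a) mem) => // h; case: H; exists a.
by move=> H [a]; apply; apply: H.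
Qed.

Section Semantics.
Variables (n : nat) (e : rel 'I_n) (D s : nat) (v : 'I_n) (mem : nat -> bool).
Variable tau : 'I_n -> table.
Hypothesis nD : n * n < D.
Hypothesis mem_edge : forall a b : 'I_n, mem (a * n + b) = e a b.
Hypothesis mem_tab : forall (u : 'I_n) p q r, p < D -> q < D -> r < D ->
  mem (addr D s v u p q r) <-> tau u p q r.

Definition context (env : nat -> nat) : Prop :=
  [/\ env 0 = 0, env 1 = D, env 3 = n, env 5 = v & env 10 = s].

Lemma context_upd env x a : context env -> x \notin [:: 0; 1; 3; 5; 10] -> context (upd env x a).
Proof.
move=> [c0 c1 c3 c5 c10]; rewrite !inE !negb_or => /and5P[x0 x1 x3 x5 x10].
by split; rewrite /upd eq_sym ?(negbTE x0) ?(negbTE x1) ?(negbTE x3) ?(negbTE x5) ?(negbTE x10).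
Qed.

Let n_lt : n < D.
Proof. by apply: leq_ltn_trans nD; case: (n) => // m; rewrite leq_pmulr. Qed.
Let D0 : 0 < D. Proof. exact: leq_ltn_trans nD. Qed.

Lemma sat_edge env x y (a b : 'I_n) : env 3 = n -> env x = a -> env y = b ->
  sat (fEdge x y) env mem <-> e a b.
Proof. by move=> c3 Ex Ey; rewrite /= c3 Ex Ey mem_edge. Qed.

Lemma sat_iso env x y (a b : 'I_n) : context env -> env x = a -> env y = b ->
  sat (fIso x y) env mem <-> isolate e v a b.
Proof.
move=> [c0 c1 c3 c5 c10] Ex Ey; rewrite /isolate.
by apply: sat_xor; [apply: sat_xor |]; apply: sat_edge.
Qed.

Lemma sat_tab env x p q r (u : 'I_n) : context env -> env x = u ->
  env p < D -> env q < D -> env r < D ->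
  sat (fTab x p q r) env mem <-> tau u (env p) (env q) (env r).
Proof.
move=> [c0 c1 c3 c5 c10] Ex pD qD rD; rewrite -mem_tab //.
by rewrite /= c0 c1 c5 c10 Ex.
Qed.

Lemma sat_alive env x (u : 'I_n) : context env -> env x = u ->
  sat (fTab x 0 0 0) env mem <-> tau u 0 0 0.
Proof.
move=> c Ex; have [c0 _ _ _ _] := c.
by rewrite (sat_tab c Ex) ?c0.
Qed.

Lemma sat_twins env x y (a b : 'I_n) :
  x != 15 -> y != 15 -> x < 30 -> y < 30 -> context env -> env x = a -> env y = b ->
  sat (fTwins x y) env mem <-> twins e v tau a b.
Proof.
move=> x15 y15 x30 y30 c Ex Ey; have [c0 c1 c3 c5 c10] := c.
have L : sat (FLe (Succ (Var x)) (Var y)) env mem <-> a < b.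
  rewrite sat_le /= ?Ex ?Ey ?c1 //; exact: ltn_trans (ltn_ord b) n_lt.
have A : sat (AllV 15 (FImp (fTab 15 0 0 0) (FImp (FNot (fEq 15 x)) (FImp (FNot (fEq 15 y))
       (FNot (FXor (fIso x 15) (fIso y 15))))))) env mem <->
    forall z : 'I_n, tau z 0 0 0 -> z <> a -> z <> b -> isolate e v a z = isolate e v b z.
  rewrite (@sat_allv env mem n 15) ?c1 //.
  have P z : sat (FImp (fTab 15 0 0 0) (FImp (FNot (fEq 15 x)) (FImp (FNot (fEq 15 y))
       (FNot (FXor (fIso x 15) (fIso y 15)))))) (upd env 15 (nat_of_ord z)) mem <->
      (tau z 0 0 0 -> z <> a -> z <> b -> isolate e v a z = isolate e v b z).
    have cz : context (upd env 15 z) by apply: context_upd.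
    have zx : upd env 15 z x = a by rewrite /upd (negbTE x15).
    have zy : upd env 15 z y = b by rewrite /upd (negbTE y15).
    have zz : upd env 15 z 15 = z by [].
    have Nx : sat (FNot (fEq 15 x)) (upd env 15 z) mem <-> z <> a.
      by rewrite /fEq /= zx zz; split=> h E; apply: h; [rewrite E | apply: val_inj].
    have Ny : sat (FNot (fEq 15 y)) (upd env 15 z) mem <-> z <> b.
      by rewrite /fEq /= zy zz; split=> h E; apply: h; [rewrite E | apply: val_inj].
    have X : sat (FNot (FXor (fIso x 15) (fIso y 15))) (upd env 15 z) mem <->
        isolate e v a z = isolate e v b z.
      rewrite (sat_not _ _ (FXor _ _)) (sat_xor (sat_iso cz zx zz) (sat_iso cz zy zz)).
      by case: (isolate e v a z); case: (isolate e v b z); split.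
    by rewrite !sat_imp (sat_alive cz zz) Nx Ny X.
  by split=> H z; apply/P; apply: H.
rewrite /fTwins !sat_and L (sat_alive c Ex) (sat_alive c Ey) A.
by split=> [[? [? []]]|[]].
Qed.

Lemma sat_selected env (a b : 'I_n) : context env -> env 11 = a -> env 12 = b ->
  sat fSelected env mem <-> selected e v tau a b.
Proof.
move=> c Ea Eb; have [c0 c1 c3 c5 c10] := c.
rewrite /fSelected sat_and (sat_twins (a := a) (b := b)) // (@sat_allv env mem n 13) ?c1 //.
have P x' : sat (AllV 14 (FImp (fTwins 13 14)
    (FLe (Plus (Mult (Var 11) (Var 3)) (Var 12)) (Plus (Mult (Var 13) (Var 3)) (Var 14)))))
    (upd env 13 (nat_of_ord x')) mem <->
    forall y' : 'I_n, twins e v tau x' y' -> a * n + b <= x' * n + y'.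
  have n1 : n < upd env 13 x' 1 by rewrite /upd /= c1.
  have n3 : upd env 13 x' 3 = n by [].
  rewrite (sat_allv _ _ _ _ _ n3 n1) //.
  have Q y' : sat (FImp (fTwins 13 14)
      (FLe (Plus (Mult (Var 11) (Var 3)) (Var 12)) (Plus (Mult (Var 13) (Var 3)) (Var 14))))
      (upd (upd env 13 (nat_of_ord x')) 14 (nat_of_ord y')) mem <->
      (twins e v tau x' y' -> a * n + b <= x' * n + y').
    have cz : context (upd (upd env 13 x') 14 y') by do 2!apply: context_upd => //.
    rewrite sat_imp (sat_twins (a := x') (b := y')) // sat_le //.
      by rewrite /= /upd /= c3 Ea Eb.
    rewrite /= /upd /= c3 c1; apply: leq_ltn_trans nD.
    apply: leq_trans (_ : x'.+1 * n <= _); first by rewrite mulSn addnC leq_add2r ltnW.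
    by rewrite leq_mul2r ltn_ord orbT.
  by split=> H y'; apply/Q; apply: H.
split=> -[h1 h2]; split=> //.
  by move=> x' y'; apply: (P x').1 => //; apply: h2.
by move=> x'; apply/P; apply: h2.
Qed.

Definition env6 env a1 a2 a3 a4 a5 a6 : nat -> nat :=
  upd (upd (upd (upd (upd (upd env 17 a1) 18 a2) 19 a3) 20 a4) 21 a5) 22 a6.

Lemma context_env6 env a1 a2 a3 a4 a5 a6 :
  context env -> context (env6 env a1 a2 a3 a4 a5 a6).
Proof. by move=> c; do 6!apply: context_upd => //. Qed.

Lemma sat_parts env f (a b : 'I_n) : context env -> env 11 = a -> env 12 = b ->
  sat (fParts f) env mem <->
  exists p1 q1 r1 p2 q2 r2,
    [/\ [/\ p1 < D, q1 < D, r1 < D, p2 < D & q2 < D /\ r2 < D],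
        tau a p1 q1 r1, tau b p2 q2 r2 & sat f (env6 env p1 q1 r1 p2 q2 r2) mem].
Proof.
move=> c Ea Eb; have [c0 c1 c3 c5 c10] := c.
have T1 p1 q1 r1 p2 q2 r2 : p1 < D -> q1 < D -> r1 < D ->
    sat (fTab 11 17 18 19) (env6 env p1 q1 r1 p2 q2 r2) mem <-> tau a p1 q1 r1.
  by move=> *; apply: sat_tab => //; apply: context_env6.
have T2 p1 q1 r1 p2 q2 r2 : p2 < D -> q2 < D -> r2 < D ->
    sat (fTab 12 20 21 22) (env6 env p1 q1 r1 p2 q2 r2) mem <-> tau b p2 q2 r2.
  by move=> *; apply: sat_tab => //; apply: context_env6.
split.
  move=> [p1 b1 [q1 b2 [r1 b3 [p2 b4 [q2 b5 [r2 b6 [h1 [h2 h3]]]]]]]].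
  rewrite /upd /= c1 in b1 b2 b3 b4 b5 b6.
  exists p1, q1, r1, p2, q2, r2; split=> //.
  - exact: (T1 p1 q1 r1 p2 q2 r2 b1 b2 b3).1 h1.
  - exact: (T2 p1 q1 r1 p2 q2 r2 b4 b5 b6).1 h2.
move=> [p1 [q1 [r1 [p2 [q2 [r2 [[b1 b2 b3 b4 [b5 b6]] h1 h2 h3]]]]]]].
exists p1; first by rewrite c1.
exists q1; first by rewrite /upd /= c1.
exists r1; first by rewrite /upd /= c1.
exists p2; first by rewrite /upd /= c1.
exists q2; first by rewrite /upd /= c1.
exists r2; first by rewrite /upd /= c1.
split; first exact: (T1 p1 q1 r1 p2 q2 r2 b1 b2 b3).2 h1.
by split=> //; exact: (T2 p1 q1 r1 p2 q2 r2 b4 b5 b6).2 h2.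
Qed.

Lemma sat_leD env a b : context env -> twf 30 a -> twf 30 b -> teval b env < D ->
  sat (FLe a b) env mem <-> teval a env <= teval b env.
Proof. by move=> [c0 c1 c3 c5 c10] wa wb lt; apply: sat_le; rewrite ?c1. Qed.

Lemma sat_union env (a b : 'I_n) : context env -> env 11 = a -> env 12 = b ->
  sat fUnion env mem <-> union_rule D (tau a) (tau b) (env 7) (env 8) (env 9).
Proof.
move=> c Ea Eb; rewrite /fUnion (sat_parts _ c Ea Eb).
have X p1 q1 r1 p2 q2 r2 : p1 < D -> q1 < D -> p2 < D -> q2 < D ->
    sat (FAnd (FEq (Var 9) (Plus (Var 19) (Var 22)))
      (FAnd (FOr (FLe (Var 7) (Var 17)) (FLe (Var 7) (Var 20)))
          (FOr (FLe (Var 8) (Var 18)) (FLe (Var 8) (Var 21)))))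
      (env6 env p1 q1 r1 p2 q2 r2) mem <->
    env 9 = r1 + r2 /\ (env 7 <= p1 \/ env 7 <= p2) /\ (env 8 <= q1 \/ env 8 <= q2).
  move=> b1 b2 b4 b5; have c6 := context_env6 p1 q1 r1 p2 q2 r2 c.
  by rewrite !sat_and !sat_or !sat_leD.
split.
  move=> [p1 [q1 [r1 [p2 [q2 [r2 [bb h1 h2 h3]]]]]]].
  exists p1, q1, r1, p2, q2, r2; have [b1 b2 b3 b4 [b5 b6]] := bb.
  by have [E L] := (X _ _ _ _ _ _ b1 b2 b4 b5).1 h3; split.
move=> [p1 [q1 [r1 [p2 [q2 [r2 [bb h1 h2 E L]]]]]]].
exists p1, q1, r1, p2, q2, r2; have [b1 b2 b3 b4 [b5 b6]] := bb.
by split=> //; apply/X.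
Qed.

Lemma sat_join env (a b : 'I_n) : context env -> env 11 = a -> env 12 = b ->
  sat fJoin env mem <-> join_rule D (tau a) (tau b) (env 7) (env 8) (env 9).
Proof.
move=> c Ea Eb; have [c0 c1 c3 c5 c10] := c; rewrite /fJoin (sat_parts _ c Ea Eb).
have X p1 q1 r1 p2 q2 r2 t1 t2 : p1 < D -> q1 < D -> p2 < D -> q2 < D ->
    sat (FAnd (FAnd (FAnd (FLe (Var 23) (Var 17)) (FLe (Var 23) (Var 21)))
                (FAnd (FLe (Var 24) (Var 18)) (FLe (Var 24) (Var 20))))
    (FAnd (FAnd (FEq (Plus (Plus (Var 7) (Var 23)) (Var 24)) (Plus (Var 17) (Var 20)))
                (FEq (Plus (Plus (Var 8) (Var 23)) (Var 24)) (Plus (Var 18) (Var 21))))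
          (FEq (Var 9) (Plus (Plus (Plus (Var 19) (Var 22)) (Var 23)) (Var 24)))))
      (upd (upd (env6 env p1 q1 r1 p2 q2 r2) 23 t1) 24 t2) mem <->
    ((t1 <= p1 /\ t1 <= q2) /\ t2 <= q1 /\ t2 <= p2) /\
    (env 7 + t1 + t2 = p1 + p2 /\ env 8 + t1 + t2 = q1 + q2) /\ env 9 = r1 + r2 + t1 + t2.
  move=> b1 b2 b4 b5.
  have cc : context (upd (upd (env6 env p1 q1 r1 p2 q2 r2) 23 t1) 24 t2).
    by do 2!apply: context_upd => //; apply: context_env6.
  by rewrite !sat_and !sat_leD.
split.
  move=> [p1 [q1 [r1 [p2 [q2 [r2 [bb h1 h2 [t1 d1 [t2 d2 h3]]]]]]]]].
  exists p1, q1, r1, p2, q2, r2; have [b1 b2 b3 b4 [b5 b6]] := bb; split=> //.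
  have [[[l1 l2] [l3 l4]] [E12 E3]] := (X _ _ _ _ _ _ _ _ b1 b2 b4 b5).1 h3.
  by rewrite /env6 /upd /= c1 in d1 d2; exists t1, t2; split.
move=> [p1 [q1 [r1 [p2 [q2 [r2 [bb h1 h2 [t1 [t2 [d1 d2 [l1 l2 l3 l4] E12 E3]]]]]]]]]].
exists p1, q1, r1, p2, q2, r2; have [b1 b2 b3 b4 [b5 b6]] := bb; split=> //.
exists t1; first by rewrite /env6 /upd /= c1.
exists t2; first by rewrite /env6 /upd /= c1.
by apply/X.
Qed.

Lemma sat_merged env (u : 'I_n) : context env -> env 6 = u ->
  env 7 < D -> env 8 < D -> env 9 < D ->
  sat fMerged env mem <-> merged e v D tau u (env 7) (env 8) (env 9).
Proof.
move=> c Eu pD qD rD; have [c0 c1 c3 c5 c10] := c.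
have n1 : n < env 1 by rewrite c1.
have cc (x y : 'I_n) : context (upd (upd env 11 x) 12 y) by do 2!apply: context_upd => //.
have n1' (x : 'I_n) : n < upd env 11 x 1 by [].
have Ex2 f : sat (ExV 11 (ExV 12 f)) env mem <->
    exists x y : 'I_n, sat f (upd (upd env 11 x) 12 y) mem.
  rewrite (sat_exv _ _ _ _ _ c3 n1) //; split=> -[x].
    by rewrite (sat_exv _ _ _ _ _ (c3 : upd env 11 x 3 = n) (n1' x)) // => -[y h]; exists x, y.
  by move=> [y h]; exists x; rewrite (sat_exv _ _ _ _ _ (c3 : upd env 11 x 3 = n) (n1' x)) //; exists y.
have Sel x y : sat fSelected (upd (upd env 11 (nat_of_ord x)) 12 (nat_of_ord y)) mem <->
    selected e v tau x y by apply: sat_selected.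
have Tab : sat (fTab 6 7 8 9) env mem <-> tau u (env 7) (env 8) (env 9) by apply: sat_tab.
have Tab2 (x y : 'I_n) : sat (fTab 6 7 8 9) (upd (upd env 11 x) 12 y) mem <->
    tau u (env 7) (env 8) (env 9) by apply: sat_tab.
have U (x y : 'I_n) := sat_union (a := x) (b := y) (cc x y) erefl erefl.
have J (x y : 'I_n) := sat_join (a := x) (b := y) (cc x y) erefl erefl.
have I (x y : 'I_n) := sat_iso (a := x) (b := y) (x := 11) (y := 12) (cc x y) erefl erefl.
have Q1 (x y : 'I_n) : sat (fEq 6 11) (upd (upd env 11 x) 12 y) mem <-> u = x.
  by rewrite /fEq /= /upd /= Eu; split=> [/val_inj|->].
have Q2 (x y : 'I_n) : sat (fEq 6 12) (upd (upd env 11 x) 12 y) mem <-> u = y.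
  by rewrite /fEq /= /upd /= Eu; split=> [/val_inj|->].
have NS : (exists x y : 'I_n, sat fSelected (upd (upd env 11 x) 12 y) mem) <->
    exists x y, selected e v tau x y.
  by split=> -[x [y /Sel h]]; exists x, y => //; apply/Sel.
rewrite /fMerged sat_or sat_and sat_not Tab !Ex2 NS /merged.
suff B x y : sat (FAnd fSelected
        (FOr (FAnd (FNot (fEq 6 11)) (FAnd (FNot (fEq 6 12)) (fTab 6 7 8 9)))
        (FOr (FAnd (fEq 6 11) (FAnd (FNot (fIso 11 12)) fUnion))
             (FAnd (fEq 6 11) (FAnd (fIso 11 12) fJoin)))))
     (upd (upd env 11 (nat_of_ord x)) 12 (nat_of_ord y)) mem <->
  selected e v tau x y /\
     [\/ [/\ u <> x, u <> y & tau u (env 7) (env 8) (env 9)],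
         [/\ u = x, ~ isolate e v x y & union_rule D (tau x) (tau y) (env 7) (env 8) (env 9)] |
         [/\ u = x, isolate e v x y & join_rule D (tau x) (tau y) (env 7) (env 8) (env 9)]].
  split=> -[[x [y h]]|h]; (try by right); left; exists x, y; exact/B.
have D1 : sat (FAnd (FNot (fEq 6 11)) (FAnd (FNot (fEq 6 12)) (fTab 6 7 8 9)))
    (upd (upd env 11 x) 12 y) mem <-> u <> x /\ u <> y /\ tau u (env 7) (env 8) (env 9).
  rewrite (sat_and _ _ (FNot _)) (sat_not _ _ (fEq 6 11)) Q1.
  by rewrite (sat_and _ _ (FNot _)) (sat_not _ _ (fEq 6 12)) Q2 Tab2.
have D2 : sat (FAnd (fEq 6 11) (FAnd (FNot (fIso 11 12)) fUnion))
    (upd (upd env 11 x) 12 y) mem <-> u = x /\ ~ isolate e v x y /\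
    union_rule D (tau x) (tau y) (env 7) (env 8) (env 9).
  rewrite (sat_and _ _ (fEq 6 11)) Q1.
  by rewrite (sat_and _ _ (FNot _)) (sat_not _ _ (fIso 11 12)) I U.
have D3 : sat (FAnd (fEq 6 11) (FAnd (fIso 11 12) fJoin))
    (upd (upd env 11 x) 12 y) mem <-> u = x /\ isolate e v x y /\
    join_rule D (tau x) (tau y) (env 7) (env 8) (env 9).
  by rewrite (sat_and _ _ (fEq 6 11)) Q1 (sat_and _ _ (fIso _ _)) I J.
rewrite (sat_and _ _ fSelected) Sel.
rewrite (sat_or _ _ (FAnd (FNot (fEq 6 11)) _)) D1 (sat_or _ _ (FAnd (fEq 6 11) _)) D2 D3.
split=> -[h1 h2]; split=> //.
  by case: h2 => [[? [? ?]]|[[? [? ?]]|[? [? ?]]]]; [apply: Or31|apply: Or32|apply: Or33].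
by case: h2 => [[? ? ?]|[? ? ?]|[? ? ?]]; [left | right; left | right; right].
Qed.

Lemma sat_leaf env (u : 'I_n) : context env -> env 6 = u ->
  sat fLeaf env mem <-> leaf_rule e v u (env 7) (env 8) (env 9).
Proof.
move=> [c0 c1 c3 c5 c10] Eu; have E := sat_edge (x := 5) (y := 6) (a := v) (b := u) c3 c5 Eu.
have K x k : sat (fConst x k) env mem <-> env x = k.
  rewrite /fConst /=; suff -> : teval (iter k Succ (Var 0)) env = k by [].
  by elim: k => //= k ->.
rewrite /fLeaf sat_and !sat_or !sat_and sat_not !K E /leaf_rule.
split=> -[h1 h2]; split=> //.
  case: h2 => [|[|[h3 h4]]]; [by left | by right; left | right; right].
  by split=> //; apply/negP.
case: h2 => [|[|[h3 h4]]]; [by left | by right; left | right; right].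
by split=> //; apply/negP.
Qed.

End Semantics.

(** * Arithmetic of addresses *)

Lemma digit_lt D a b x y : a < b -> x < D -> a * D + x < b * D + y.
Proof.
move=> ab xD; apply: leq_trans (leq_addr y _).
by apply: leq_trans (_ : a.+1 * D <= _); [rewrite mulSn addnC ltn_add2r | rewrite leq_mul2r ab orbT].
Qed.

Lemma digit_lt0 D a b x : a < b -> x < D -> a * D + x < b * D.
Proof. by move=> ab xD; have := digit_lt 0 ab xD; rewrite addn0. Qed.

Lemma digit_inj D a b x y : x < D -> y < D -> a * D + x = b * D + y -> a = b /\ x = y.
Proof.
move=> xD yD E; have [ab|ba|ab] := ltngtP a b.
- by have := digit_lt y ab xD; rewrite E ltnn.
- by have := digit_lt x ba yD; rewrite E ltnn.
- by split=> //; apply: (@addnI (a * D)); rewrite E ab.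
Qed.

Section Addresses.
Variable D : nat.
Implicit Types t v u p q r : nat.

(** Time is the digit after the leading [1], so all tables of one time are stored before those of
    any later time, as the recursion demands. *)
Lemma addr_lt t v u p q r t' v' u' p' q' r' :
  v < D -> u < D -> p < D -> q < D -> r < D ->
  t < t' -> addr D t v u p q r < addr D t' v' u' p' q' r'.
Proof. by move=> *; do 5!apply: digit_lt => //; rewrite ltn_add2l. Qed.

Lemma addr_cells t v u p q r :
  t < D -> v < D -> u < D -> p < D -> q < D -> r < D ->
  addr D t v u p q r < teval cells (env_at D 0).
Proof.
by move=> *; rewrite /= /env_at /upd /= /addr; do 6!apply: digit_lt0 => //.
Qed.

Lemma addr_ge t v u p q r : 0 < D -> D <= addr D t v u p q r.
Proof.
move=> D0; have le a x : a <= a * D + x by apply: leq_trans (leq_addr _ _); rewrite leq_pmulr.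
apply: leq_trans (_ : 0.+1 * D + t <= _); first by rewrite mul1n leq_addr.
by rewrite /addr; do 5!(apply: leq_trans _ (le _ _)).
Qed.

Lemma addr_inj t v u p q r t' v' u' p' q' r' :
  t < D -> v < D -> u < D -> p < D -> q < D -> r < D ->
  t' < D -> v' < D -> u' < D -> p' < D -> q' < D -> r' < D ->
  addr D t v u p q r = addr D t' v' u' p' q' r' ->
  [/\ t = t', v = v', u = u' & [/\ p = p', q = q' & r = r']].
Proof.
move=> tD vD uD pD qD rD tD' vD' uD' pD' qD' rD' /digit_inj-/(_ rD rD')[].
move=> /digit_inj-/(_ qD qD')[] /digit_inj-/(_ pD pD')[] /digit_inj-/(_ uD uD')[].
by move=> /digit_inj-/(_ vD vD')[] /digit_inj-/(_ tD tD')[].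
Qed.

End Addresses.

(** * Correctness of the recursion *)

Section Correctness.
Variables (n : nat) (e : rel 'I_n).
Hypotheses (sg : simple_graph e) (cam : cameron e).
Let D := (n * n).+1.
Let E := teval cells (env_at D 0).
Variable Z : nat -> bool.
Hypothesis sol : solution fProgram cells (adjacency e) Z.

Let sy : symmetric e := sg.1.
Let ir : irreflexive e := sg.2.
Let nn : n * n < D. Proof. by []. Qed.
Let nD : n < D. Proof. by apply: leq_ltn_trans nn; case: (n) => // m; rewrite leq_pmulr. Qed.
Let oD (x : 'I_n) : x < D. Proof. exact: ltn_trans (ltn_ord x) nD. Qed.

Lemma code_lt (a b : 'I_n) : a * n + b < D.
Proof.
apply: leq_ltn_trans nn; apply: leq_trans (_ : a.+1 * n <= _).
  by rewrite mulSn addnC leq_add2r ltnW.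
by rewrite leq_mul2r ltn_ord orbT.
Qed.

Lemma Z_edge (a b : 'I_n) : Z (a * n + b) = e a b.
Proof.
have [H _] := sol; rewrite H ?nth_adjacency // size_adjacency.
exact: code_lt.
Qed.

Lemma Z_sat i : D <= i < E + D ->
  Z i <-> sat fProgram (env_at D i) (fun j => (j < i) && Z j).
Proof.
move=> iE; have [_ H] := sol; rewrite H size_adjacency //.
by split=> /satP.
Qed.

Lemma sat_order f env mem : env 1 = D -> sat (fOrder f) env mem <-> sat f (upd env 3 n) mem.
Proof.
move=> E1; split=> [[m mD [Em h]]|h].
  suff -> : n = m by [].
  move: Em; rewrite /= /upd /= E1 => -[/eqP]; rewrite !mulnn eqn_exp2r // => /eqP//.
by exists n; rewrite ?E1 //; split=> //; rewrite /= /upd /= E1.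
Qed.

Definition cell_env i t (v u : 'I_n) p q r : nat -> nat :=
  upd (upd (upd (upd (upd (upd (upd (env_at D i) 3 n) 4 t) 5 v) 6 u) 7 p) 8 q) 9 r.

Lemma sat_cells f i mem :
  sat (fOrder (FEx 4 (ExV 5 (ExV 6 (FEx 7 (FEx 8 (FEx 9 f))))))) (env_at D i) mem <->
  exists t v u p q r, [/\ t < D, p < D, q < D, r < D & sat f (cell_env i t v u p q r) mem].
Proof.
have V5 t g : sat (ExV 5 g) (upd (upd (env_at D i) 3 n) 4 t) mem <->
    exists v : 'I_n, sat g (upd (upd (upd (env_at D i) 3 n) 4 t) 5 v) mem by exact: sat_exv.
have V6 t (v : 'I_n) g : sat (ExV 6 g) (upd (upd (upd (env_at D i) 3 n) 4 t) 5 v) mem <->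
    exists u : 'I_n, sat g (upd (upd (upd (upd (env_at D i) 3 n) 4 t) 5 v) 6 u) mem.
  exact: sat_exv.
rewrite sat_order //; split.
  move=> [t tD h5]; have [v h6] := (V5 t (ExV 6 (FEx 7 (FEx 8 (FEx 9 f))))).1 h5.
  have [u [p pD [q qD [r rD h]]]] := (V6 t v (FEx 7 (FEx 8 (FEx 9 f)))).1 h6.
  by exists t, v, u, p, q, r.
move=> [t [v [u [p [q [r [tD pD qD rD h]]]]]]].
exists t => //; apply/V5; exists v; apply/V6; exists u.
by exists p => //; exists q => //; exists r.
Qed.

(** An address below [E] is no output cell. The input and the tables of the previous time have
    smaller addresses, so cutting the memory off below [i] does not affect what the formula
    reads. *)
Lemma Z_cell t (v u : 'I_n) p q r : t < D -> p < D -> q < D -> r < D ->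
  Z (addr D t v u p q r) <->
  (t = 0 /\ leaf_rule e v u p q r) \/
  (exists2 s, t = s.+1 & merged e v D (fun u p q r => Z (addr D s v u p q r)) u p q r).
Proof.
move=> tD pD qD rD; set i := addr _ _ _ _ _ _ _.
have iE : i < E by apply: addr_cells.
have Di : D <= i by apply: addr_ge.
rewrite Z_sat; last by rewrite Di (leq_trans iE) ?leq_addr.
set mem := fun j => _.
have mem_edge (a b : 'I_n) : mem (a * n + b) = e a b.
  by rewrite /mem Z_edge (leq_trans (code_lt a b) Di).
rewrite /fProgram sat_or.
have noOut : ~ sat fOutput (env_at D i) mem.
  move=> /sat_cells[t' [v' [u' [p' [q' [r' [t'D _ _ _ [c cD [s sD [Ei _]]]]]]]]]].
  have {}Ei : i = E + t' by exact: Ei.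
  by rewrite Ei ltnNge leq_addr in iE.
have L : sat fLeaf (cell_env i t v u p q r) mem <-> leaf_rule e v u p q r.
  exact: (@sat_leaf n e D 0 v mem).
have M s : t = s.+1 -> sat fMerged (upd (cell_env i t v u p q r) 10 s) mem <->
    merged e v D (fun u p q r => Z (addr D s v u p q r)) u p q r.
  move=> ts; apply: (@sat_merged n e D s v mem) => // u1 p1 q1 r1 p1D q1D r1D.
  by rewrite /mem addr_lt // ts.
have body : sat fCell (env_at D i) mem <->
    sat (FOr (FAnd (fConst 4 0) fLeaf)
           (FEx 10 (FAnd (FEq (Var 4) (Succ (Var 10))) fMerged))) (cell_env i t v u p q r) mem.
  rewrite sat_cells; split.
    move=> [t' [v' [u' [p' [q' [r' [t'D p'D q'D r'D [Ei h]]]]]]]].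
    have {}Ei : i = addr D t' v' u' p' q' r' by exact: Ei.
    have [] := addr_inj tD (oD v) (oD u) pD qD rD t'D (oD v') (oD u') p'D q'D r'D Ei.
    by move=> -> /val_inj-> /val_inj-> [-> -> ->].
  by move=> h; exists t, v, u, p, q, r; split.
rewrite body sat_or; split.
  case=> [|//]; case=> [[t0 /L h]|[s sD [ts h]]]; [left | right].
    by split.
  by exists s => //; apply/M.
case=> [[t0 h]|[s ts h]]; left; [left | right].
  by split=> //; apply/L.
exists s; first by rewrite ts in tD; exact: ltnW.
by split=> //; apply/M.
Qed.

Lemma Z_modular (v : 'I_n) t : t <= n ->
  modular e v D (fun u p q r => Z (addr D t v u p q r)) (n - t).
Proof.
have P4 := cameron_isolate v sg cam.
elim: t => [_|t IH lt].
  rewrite subn0; apply: modular_leaves => // u p q r pD qD rD; rewrite Z_cell //.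
  by split=> [[[]//|[]//]|h]; left.
rewrite subnS; apply: modular_ext (modular_merged sy ir P4 nD (IH (ltnW lt))) => //.
move=> u p q r pD qD rD; rewrite Z_cell ?(leq_trans lt (ltnW nD)) //; last exact: leq_ltn_trans nD.
by split=> [h|[[]//|[s [->]]//]]; right; exists t.
Qed.

Lemma cells_ge : D <= E.
Proof.
by apply: leq_trans (addr_ge 0 0 0 0 0 0 (ltn0Sn _)) _; apply/ltnW/addr_cells.
Qed.

(** Addresses from [E] on are no table cells, and all tables lie below them. *)
Lemma Z_output i : i < D -> Z (E + i) <->
  exists (v u : 'I_n) p q r c,
    [/\ p < D, q < D, r < D, c < D & Z (addr D n v u p q r) /\ i + c = p + r].
Proof.
move=> iD; rewrite Z_sat; last by rewrite (leq_trans cells_ge) ?leq_addr // ltn_add2l.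
set mem := fun j => _; rewrite /fProgram sat_or.
have noCell : ~ sat fCell (env_at D (E + i)) mem.
  move=> /sat_cells[t [v [u [p [q [r [tD pD qD rD [Ei _]]]]]]]].
  have {}Ei : E + i = addr D t v u p q r by exact: Ei.
  have := addr_cells tD (oD v) (oD u) pD qD rD.
  by rewrite -Ei ltnNge leq_addr.
have memZ (v u : 'I_n) p q r : p < D -> q < D -> r < D ->
    mem (addr D n v u p q r) = Z (addr D n v u p q r).
  move=> pD qD rD; rewrite /mem (leq_trans _ (leq_addr _ _)) //.
  exact: addr_cells.
split.
  case=> [//|/sat_cells[t [v [u [p [q [r [tD pD qD rD]]]]]]]].
  move=> [c cD [s sD [Ei [Es [h Ec]]]]].
  have {}Ei : E + i = E + t by exact: Ei.
  have {}Es : s = n by exact: Es.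
  have {}h : mem (addr D s v u p q r) by exact: h.
  move/addnI: Ei => Ei; rewrite Es memZ // in h.
  by exists v, u, p, q, r, c; split=> //; split=> //; rewrite Ei; exact: Ec.
move=> [v [u [p [q [r [c [pD qD rD cD [h Ec]]]]]]]]; right; apply/sat_cells.
exists i, v, u, p, q, r; split=> //; exists c => //; exists n => //.
do 2!split=> //; split=> //.
by rewrite -[sat _ _ _]/(is_true (mem (addr D n v u p q r))) memZ.
Qed.

Lemma Z_grundy i : i < D -> Z (E + i) = (i < grundy e).
Proof.
move=> iD.
(* After [n] merging steps one module is left, and only its representative has a nonempty table. The
   formula can therefore quantify over [u] without naming the root. *)
have ex_root v : exists u : 'I_n,
    correct e v D setT (fun p q r => Z (addr D n v u p q r)) /\
    (forall (w : 'I_n) p q r, p < D -> q < D -> r < D -> Z (addr D n v w p q r) -> w = u).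
  have [|u cu uu] := @modular_final n e v D (fun u p q r => Z (addr D n v u p q r)).
    by have := Z_modular v (leqnn n); rewrite subnn.
  by exists u.
have [root Hroot] := fin_all_exists ex_root.
have G := lt_grundy_tables (tau := fun v u p q r => Z (addr D n v u p q r))
  i sy ir nD (fun v => (Hroot v).1).
apply/idP/idP => [/(Z_output iD)[v [u [p [q [r [c [pD qD rD cD [h Ec]]]]]]]]|/G].
  apply/G; exists v, p, q, r, c; split=> //; split=> //.
  by rewrite -((Hroot v).2 u p q r).
move=> [v [p [q [r [c H]]]]]; apply/(Z_output iD).
by exists v, (root v), p, q, r, c.
Qed.

End Correctness.

Lemma grundy_le n (e : rel 'I_n) : grundy e <= n.
Proof.
apply/bigmax_leqP => k _; apply: leq_trans (_ : #|'I_n| <= _); last by rewrite card_ord.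
by rewrite -ltnS.
Qed.

Theorem mainTheorem1 :
  exists (M : TM) (c k : nat),
    well_formed_TM M /\
    computes_within M (fun m => c * m ^ k + c)
      (fun n e => simple_graph e /\ cameron e)
      (fun n e => grundy e).
Proof.
(* The largest variable of [fProgram] is [30], the slack of inequalities, so [31] bounds all
   variables. *)
have [|||M [c [k [wf HM]]]] := @formula_machine 31 fProgram cells; try by [].
exists M, c, k; split=> // n e [sg cam].
apply: HM.
- exact: cells_ge.
(* The unary answer fits into the [D] output cells, since the Grundy number is at most [n], hence at
   most [n * n]. *)
- apply: leq_trans (grundy_le e) _; apply: leqW.
  by case: (n) => // m; rewrite leq_pmulr.
- by move=> Z sol i iD; apply: Z_grundy.
Qed.
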